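(* Let $B\in C([-1,1])\cap C^2((-1,1))$ be even and real-valued, with $(1-x^2)B'(x)\to0$ at both endpoints $x\to\pm1$. Assume that, for $x\in(-1,1)$, $$\mathcal LB(x)=\frac a{\sqrt{1-x^2}}+J_B(x),\qquad J_B\in C([-1,1]),\quad a\in\mathbb R.$$ Then, as $n\to\infty$, $$\mathscr R_n[B]=\frac a{2\pi}\frac{\log n}{n^2}+\frac1{n^2}\left(\frac{a(\gamma+\log16)}{2\pi}+\frac14\mathcal A(J_B)\right)+o(n^{-2}).$$
   Context: $\gamma$ is Euler's constant. Put $\mathcal Lq=-\frac{\mathrm d}{\mathrm dx}\bigl((1-x^2)q'(x)\bigr)$ (the Legendre operator) and $\mathcal A(q)=\frac1\pi\int_{-1}^1\frac{q(x)}{\sqrt{1-x^2}}\,\mathrm dx$. For a continuous even real-valued $B$ on $[-1,1]$ and $t\in\mathbb R$, let $\eta_t^B$ be the even probability measure on $[-1,1]$ $$\mathrm d\eta_t^B(x)=\frac{e^{tB(x)}}{\int_{-1}^1e^{tB(u)}\,\mathrm du}\,\mathrm dx.$$ The circle lift of an even probability measure $\eta$ on $[-1,1]$ is the distribution on the unit circle $\mathbb T$ of $e^{2i\arccos X}$, where $X$ has distribution $\eta$. For a conjugation-symmetric probability measure on $\mathbb T$ of infinite support, with monic orthogonal polynomials $\Phi_j$ and $\Phi_j^*(z)=z^j\overline{\Phi_j(1/\bar z)}$, the Verblunsky coefficients $\alpha_j\in(-1,1)$ are the real numbers given by $\Phi_{j+1}(z)=z\Phi_j(z)-\alpha_j\Phi_j^*(z)$,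 $\Phi_0=1$. Let $\alpha_j^B(t)$ be the Verblunsky coefficients of the circle lift of $\eta_t^B$, and set $$\mathscr R_n[B]=\left.\frac{\mathrm d}{\mathrm dt}\alpha_{n-1}^B(t)\right|_{t=0}\qquad(n\ge1).$$ *)

(* Defs.v *)
From HB Require Import structures.
From mathcomp Require Export all_boot all_order all_algebra.
From mathcomp Require Export complex.
From mathcomp Require Export all_classical all_reals all_analysis.
Set Implicit Arguments.
Unset Strict Implicit.
Unset Printing Implicit Defensive.
Export Order.TTheory GRing.Theory Num.Theory.
Export numFieldNormedType.Exports.

Local Open Scope classical_set_scope.
Local Open Scope ring_scope.

Definition euler_gamma (R : realType) : R :=
  lim ((fun n : nat => \sum_(1 <= k < n.+1) k%:R^-1 - ln n%:R : R) @ \oo).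

Definition legendre_op (R : realType) (q : R -> R) (x : R) : R :=
  - derive1 (fun y : R => (1 - y ^+ 2) * derive1 q y) x.

(* The endpoints, where the weight is singular, form a null set. *)
Definition arcsine_mean (R : realType) (q : R -> R) : R :=
  pi^-1 *
  \int[@lebesgue_measure R]_(x in `]-1, 1[) (q x / Num.sqrt (1 - x ^+ 2)).

(* The interval is open, so the two-sided derivatives at its points do not
   depend on the values of q outside it. *)
Definition C2_oo (R : realType) (q : R -> R) (a b : R) : Prop :=
  forall x : R, x \in `]a, b[ ->
    [/\ derivable q x 1, derivable (derive1 q) x 1 &
        {for x, continuous (derive1 (derive1 q))}].

Definition eta (R : realType) (B : R -> R) (t : R) : set R -> \bar R :=
  fun A => (\int[@lebesgue_measure R]_(x in A `&` `[(-1)%R, 1%R])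
    (expR (t * B x) /
     \int[@lebesgue_measure R]_(u in `[-1, 1]) expR (t * B u))%R%:E)%E.

(* The complex plane with its Borel sigma-algebra. *)
Definition borelC (R : realType) : Type :=
  g_sigma_algebraType (@open (R[i])^o).
HB.instance Definition _ (R : realType) :=
  Measurable.copy (borelC R) (g_sigma_algebraType (@open (R[i])^o)).

(* x |-> e^(2 i arccos x); measures on the unit circle are represented by
   measures on the plane concentrated on the circle. *)
Definition circle_map (R : realType) (x : R) : borelC R :=
  (cos (2 * acos x) +i* sin (2 * acos x))%C.

Definition circle_lift (R : realType) (nu : set R -> \bar R) :
    set (borelC R) -> \bar R :=
  pushforward nu (@circle_map R).

Definition integralC (R : realType) (mu : set (borelC R) -> \bar R)
    (f : borelC R -> R[i]) : R[i] :=
  (fine (\int[mu]_z (complex.Re (f z))%:E) +i*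
   fine (\int[mu]_z (complex.Im (f z))%:E))%C.

Definition monic_OPUC (R : realType) (mu : set (borelC R) -> \bar R)
    (Phi : nat -> {poly R[i]}) : Prop :=
  (forall j, Phi j \is monic /\ size (Phi j) = j.+1) /\
  (forall j k, j != k ->
     integralC mu (fun z => (Phi j).[z] * conjc (Phi k).[z]) = 0).

(* z^j conj (p (1 / conj z)); this is a polynomial in z when deg p <= j, but
   the formula itself is only meaningful for z != 0. *)
Definition reversed (R : realType) (j : nat) (p : {poly R[i]}) (z : R[i]) :
    R[i] :=
  z ^+ j * conjc p.[(conjc z)^-1].

Definition is_verblunsky (R : realType) (mu : set (borelC R) -> \bar R)
    (j : nat) (a : R) : Prop :=
  exists2 Phi : nat -> {poly R[i]}, monic_OPUC mu Phi &
    forall z : R[i], z != 0 ->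
      (Phi j.+1).[z] = z * (Phi j).[z] - (a%:C)%C * reversed j (Phi j) z.

(* For conjugation-symmetric measures of infinite support the coefficient
   exists and is unique; otherwise the value may be arbitrary. *)
Definition verblunsky (R : realType) (mu : set (borelC R) -> \bar R)
    (j : nat) : R :=
  get [set a | is_verblunsky mu j a].

Definition alphaB (R : realType) (B : R -> R) (j : nat) (t : R) : R :=
  verblunsky (circle_lift (eta B t)) j.

(* Only n >= 1 is meaningful. *)
Definition response (R : realType) (B : R -> R) (n : nat) : R :=
  derive1 (alphaB B n.-1) 0.

(* Main.v *)
(* At t = 0 everything is explicit. With x = cos t and z = e^(2it), Szego's
   recursion for the lift of the uniform measure is solved, up to a constant, by
   z Phi_(n-1)(z) = e^(int) (n P_n + i sin(t) P_n'), P_n being the Legendre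
   polynomial; the recursion coefficient is -1/(2n+1). An exact increment formula
   for the Verblunsky coefficient then gives its derivative,
     R_n = 1/(2n+1) int B (n(n+1) P_n^2 - (1-x^2) P_n'^2)
         = 1/(2(2n+1)) int B L(P_n^2) = 1/(2(2n+1)) int (LB) P_n^2,
   the last step by parts. The continuous part J of LB is handled by the weak
   convergence of (2n+1)/2 P_n^2 dx to the arcsine law. For the singular part,
   P_n(cos t) = sum_k g_k g_(n-k) cos((n-2k)t) with g_k = C(2k,k)/4^k yields
   int P_n^2 / sqrt(1-x^2) = pi sum_k g_k^2 g_(n-k)^2, and since
   k g_k^2 -> 1/pi this convolution is governed by Landau's constants
   sum_(k<n) g_k^2 = (log n + gamma + log 16)/pi + o(1). *)
From HB Require Import structures.
Require Import Defs.
From mathcomp Require Import measurable_realfun ring lra zify.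
Set Implicit Arguments.
Unset Strict Implicit.
Unset Printing Implicit Defensive.
Local Open Scope classical_set_scope.
Local Open Scope ring_scope.

(** * Calculus on a segment *)

(** The delicate step is to differentiate a Verblunsky coefficient, which depends on the measure
    through a nonlinear recursion. The increment formula avoids differentiating the orthogonal
    polynomials: the change of the coefficient, times the squared norm of Phi_n at t = 0, is the
    integral of Phi_(n+1) at time t against the reversal of Phi_n at time 0, for the difference of
    the two measures. Continuity of Phi_(n+1) in t is then enough. Conjugation symmetry makes all
    coefficients real, so the algebra is done for real moment sequences.

    The second form of R_n rests on L(P_n^2) = 2 (n(n+1) P_n^2 - (1-x^2) P_n'^2), a consequence of
    the Legendre equation.

    In log 16 = 2 (log 2 + log 2), one log 2 comes from the sums of 1/(2k+1), the other is the
    integral of tan(t/2) over [0, pi/2]. The factor 1/4 in front of A(J) is the limit of n^2 /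
    (2(2n+1)) times the 2/(2n+1) left over when P_n^2 is normalised. *)

Section Continuity.
Context {R : realType}.
Implicit Types (f g : R -> R).

Lemma cont_cst (k : R) : continuous (fun _ : R => k).
Proof. by move=> x; exact: cst_continuous. Qed.

Lemma cont_id : continuous (fun x : R => x).
Proof. by move=> x; exact: cvg_id. Qed.

Lemma cont_add f g : continuous f -> continuous g ->
  continuous (fun x => f x + g x).
Proof. by move=> cf cg x; apply: continuousD; [exact: cf|exact: cg]. Qed.

Lemma cont_opp f : continuous f -> continuous (fun x => - f x).
Proof. by move=> cf x; apply: continuousN; exact: cf. Qed.

Lemma cont_mul f g : continuous f -> continuous g ->
  continuous (fun x => f x * g x).
Proof. by move=> cf cg x; apply: continuousM; [exact: cf|exact: cg]. Qed.

Lemma cont_exp f n : continuous f -> continuous (fun x => f x ^+ n).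
Proof. by move=> cf x; apply: (@continuous_comp _ _ _ f (fun y => y ^+ n)); [exact: cf|exact: exprn_continuous]. Qed.

Lemma cont_comp f g : continuous f -> continuous g ->
  continuous (fun x => g (f x)).
Proof. by move=> cf cg x; apply: continuous_comp; [exact: cf|exact: cg]. Qed.

Lemma cont_poly (p : {poly R}) f : continuous f -> continuous (fun x => p.[f x]).
Proof. by move=> cf x; apply: continuous_comp; [exact: cf|exact: continuous_horner]. Qed.

End Continuity.

Ltac prove_cont :=
  lazymatch goal with
  | |- forall x, continuous_at x ?h =>
    lazymatch h with
    | (fun _ => ?k) => first [exact: cont_cst | prove_cont_atom]
    | (fun x => x) => exact: cont_id
    | (fun x => (- @?f x)%R) => apply: (@cont_opp _ f); prove_cont
    | (fun x => (@?f x + @?g x)%R) => apply: (@cont_add _ f g); prove_cont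
    | (fun x => (@?f x * @?g x)%R) => apply: (@cont_mul _ f g); prove_cont
    | (fun x => (@?f x ^+ ?n)%R) => apply: (@cont_exp _ f n); prove_cont
    | (fun x => (horner ?p (@?f x))%R) => apply: (@cont_poly _ p f); prove_cont
    | (fun x => cos (@?f x)) =>
        apply: (@cont_comp _ f (@cos _) _ (@continuous_cos _)); prove_cont
    | (fun x => sin (@?f x)) =>
        apply: (@cont_comp _ f (@sin _) _ (@continuous_sin _)); prove_cont
    | (fun x => expR (@?f x)) =>
        apply: (@cont_comp _ f (@expR _) _ (@continuous_expR _)); prove_cont
    | (fun x => Num.sqrt (@?f x)) =>
        apply: (@cont_comp _ f (@Num.sqrt _) _ (@sqrt_continuous _)); prove_cont
    | _ => prove_cont_atom
    end
  | _ => idtac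
  end
with prove_cont_atom :=
  first [ assumption | exact: continuous_cos | exact: continuous_sin
        | match goal with H : _ |- _ => exact: H end | idtac ].

Section Derivation.
Context {R : realType}.
Implicit Types (f g : R -> R) (x d e : R).

Lemma D_cst k x : is_derive x (1:R) (fun _ : R => k) (0:R).
Proof. exact: is_derive_cst. Qed.

Lemma D_id x : is_derive x (1:R) (fun y : R => y) (1:R).
Proof. exact: is_derive_id. Qed.

Lemma D_opp f x d : is_derive x 1 f d -> is_derive x 1 (fun y => - f y) (- d).
Proof. exact: is_deriveN. Qed.

Lemma D_add f g x d e : is_derive x 1 f d -> is_derive x 1 g e ->
  is_derive x 1 (fun y => f y + g y) (d + e).
Proof. exact: is_deriveD. Qed.

Lemma D_mul f g x d e : is_derive x 1 f d -> is_derive x 1 g e ->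
  is_derive x 1 (fun y => f y * g y) (d * g x + f x * e).
Proof.
move=> fd ge; have H := is_deriveM fd ge.
apply: is_derive_eq H _; rewrite /GRing.scale /=.
by rewrite addrC; congr (_ + _); exact: mulrC.
Qed.

Lemma D_exp f x d n : is_derive x 1 f d ->
  is_derive x 1 (fun y => f y ^+ n) (n%:R * f x ^+ n.-1 * d).
Proof.
move=> fd; elim: n => [|n IH]; first by rewrite !mul0r; exact: D_cst.
have -> : (fun y => f y ^+ n.+1) = (fun y => f y * f y ^+ n).
  by apply/funext => y; rewrite exprS.
apply: is_derive_eq (D_mul fd IH) _ => /=.
case: n {IH} => [|n] /=; first by rewrite !mul0r mulr0 addr0 ?mulr1 !mul1r.
by rewrite !exprS (mulrSr _ n.+1); ring.
Qed.

Lemma D_comp f g x d e : is_derive x 1 f d -> is_derive (f x) 1 g e ->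
  is_derive x 1 (fun y => g (f y)) (e * d).
Proof.
move=> fd ge; have H := is_derive1_comp ge fd.
by apply: is_derive_eq H _; rewrite /GRing.scale /= mulrC.
Qed.

Lemma D_poly (p : {poly R}) f x d : is_derive x 1 f d ->
  is_derive x 1 (fun y => p.[f y]) (p^`().[f x] * d).
Proof. by move=> fd; apply: D_comp (horner p) _ _ _ fd _; exact: is_derive_poly. Qed.

End Derivation.

Ltac prove_deriv :=
  lazymatch goal with
  | |- is_derive ?x _ ?h _ =>
    lazymatch h with
    | (fun _ => ?k) => exact: D_cst
    | (fun x => x) => exact: D_id
    | (fun x => (- @?f x)%R) => apply: (@D_opp _ f); prove_deriv
    | (fun x => (@?f x + @?g x)%R) => apply: (@D_add _ f g); prove_deriv
    | (fun x => (@?f x * @?g x)%R) => apply: (@D_mul _ f g); prove_deriv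
    | (fun x => (@?f x ^+ ?n)%R) => apply: (@D_exp _ f); prove_deriv
    | (fun x => (horner ?p (@?f x))%R) => apply: (@D_poly _ p f); prove_deriv
    | (fun x => cos (@?f x)) =>
        apply: (@D_comp _ f (@cos _)); [prove_deriv|exact: is_derive_cos]
    | (fun x => sin (@?f x)) =>
        apply: (@D_comp _ f (@sin _)); [prove_deriv|exact: is_derive_sin]
    | _ => first [assumption | match goal with H : _ |- _ => exact: H end | idtac]
    end
  | _ => idtac
  end.

Section SegmentIntegral.
Context {R : realType}.
Implicit Types (a b : R) (f g F : R -> R).
Local Notation mu := (@lebesgue_measure R).

Lemma continuous_integrable a b f : continuous f ->
  mu.-integrable `[a, b] (EFin \o f).
Proof.
move=> cf; apply: continuous_compact_integrable; first exact: segment_compact.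
exact: continuous_subspaceT.
Qed.

Lemma integral_add a b f g : continuous f -> continuous g ->
  \int[mu]_(x in `[a, b]) (f x + g x) =
  \int[mu]_(x in `[a, b]) f x + \int[mu]_(x in `[a, b]) g x.
Proof. by move=> cf cg; rewrite RintegralD//; exact: continuous_integrable. Qed.

Lemma integral_sub a b f g : continuous f -> continuous g ->
  \int[mu]_(x in `[a, b]) (f x - g x) =
  \int[mu]_(x in `[a, b]) f x - \int[mu]_(x in `[a, b]) g x.
Proof. by move=> cf cg; rewrite RintegralB//; exact: continuous_integrable. Qed.

Lemma integral_scale a b f k : continuous f ->
  \int[mu]_(x in `[a, b]) (k * f x) = k * \int[mu]_(x in `[a, b]) f x.
Proof. by move=> cf; rewrite RintegralZl//; exact: continuous_integrable. Qed.

Lemma continuous_sumf (I : Type) (r : seq I) (f : I -> R -> R) :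
  (forall i, continuous (f i)) -> continuous (fun x => \sum_(i <- r) f i x).
Proof.
move=> cf x; elim: r => [|i r IH].
  under eq_fun do rewrite big_nil; exact: cst_continuous.
under eq_fun do rewrite big_cons; apply: continuousD => //; exact: cf.
Qed.

Lemma integral_sum_cont (I : Type) (r : seq I) a b (f : I -> R -> R) :
  (forall i, continuous (f i)) ->
  \int[mu]_(x in `[a, b]) (\sum_(i <- r) f i x) =
  \sum_(i <- r) \int[mu]_(x in `[a, b]) f i x.
Proof.
move=> cf; elim: r => [|i r IH].
  rewrite big_nil; under eq_Rintegral do rewrite big_nil.
  by rewrite Rintegral_cst// mul0r.
rewrite big_cons -IH -integral_add; [|exact: cf|exact: continuous_sumf].
by apply: eq_Rintegral => x _; rewrite big_cons.
Qed.

Lemma integral_le a b f g : continuous f -> continuous g ->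
  (forall x : R, a <= x <= b -> f x <= g x) ->
  \int[mu]_(x in `[a, b]) f x <= \int[mu]_(x in `[a, b]) g x.
Proof.
move=> cf cg fg; apply: le_Rintegral => //; exact: continuous_integrable.
Qed.

Lemma integral_cst_seg a b (k : R) : a <= b ->
  \int[mu]_(x in `[a, b]) k = k * (b - a).
Proof.
move=> ab; rewrite Rintegral_cst//= lebesgue_measure_itv/= lte_fin.
move: ab; rewrite le_eqVlt => /predU1P[->|->] //=.
by rewrite ltxx subrr.
Qed.

Lemma integral_norm_le a b f (k : R) : a <= b -> continuous f ->
  (forall x : R, a <= x <= b -> `|f x| <= k) ->
  `|\int[mu]_(x in `[a, b]) f x| <= k * (b - a).
Proof.
move=> ab cf fk; rewrite -integral_cst_seg//.
apply: le_trans; first by apply: le_normr_Rintegral => //; exact: continuous_integrable.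
apply: integral_le => // [x|]; last by move=> ?; exact: cst_continuous.
by apply: continuous_comp; [exact: cf|exact: norm_continuous].
Qed.

(** The derivative is asked for in the open interval only, because [zeta_derive] and similar
    formulas divide by sqrt(1 - x^2) and stop short of the endpoints. *)
Lemma FTC_seg a b f F : a < b ->
  {within `[a, b], continuous f} ->
  (forall x : R, a <= x <= b -> {for x, continuous F}) ->
  (forall x : R, a < x < b -> is_derive x (1:R) F (f x)) ->
  \int[mu]_(x in `[a, b]) f x = F b - F a.
Proof.
move=> ab cf cF dF; rewrite /Rintegral (@continuous_FTC2 _ f F)//.
- split => [x|/=|/=]; first by rewrite in_itv/= => /dF[].
  + by apply/cvg_at_right_filter/cF; rewrite lexx ltW.
  + by apply/cvg_at_left_filter/cF; rewrite lexx ltW.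
- by move=> x; rewrite in_itv/= => /dF d; rewrite derive1E derive_val.
Qed.

Lemma FTC_cont a b f F : a < b -> continuous f ->
  (forall x : R, is_derive x (1:R) F (f x)) ->
  \int[mu]_(x in `[a, b]) f x = F b - F a.
Proof.
move=> ab cf dF; apply: FTC_seg => //; first exact: continuous_subspaceT.
move=> x _; apply: differentiable_continuous.
by apply/derivable1_diffP; have [] := dF x.
Qed.

End SegmentIntegral.

(** * Improper integrals over ]-1, 1[ from limits of a primitive *)

Section Improper.
Context {R : realType}.
Implicit Types (f F : R -> R).
Local Notation mu := (@lebesgue_measure R).

(** Starting from 1/2 keeps [c n] strictly between 0 and 1 already at [n = 0]. *)
Let c (n : nat) : R := 1 - (n.+2%:R)^-1.
Let D n : set R := `[- c n, c n].

Let c_bnd n : 0 < c n < 1.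
Proof.
rewrite /c; have : (n.+2%:R)^-1 < (1:R) by rewrite invf_lt1// ltr1n.
have : 0 < (n.+2%:R)^-1 :> R by rewrite invr_gt0.
by move: (n.+2%:R^-1) => e h1 h2; apply/andP; split; lra.
Qed.

Let c_homo : {homo c : m n / (m <= n)%N >-> m <= n}.
Proof. by move=> m n mn; rewrite lerD2l lerN2 lef_pV2 ?posrE// ler_nat. Qed.

Let c_cvg : c n @[n --> \oo] --> (1 : R).
Proof.
rewrite -[X in _ --> X]subr0; apply: cvgB; first exact: cvg_cst.
by have := @cvg_harmonic R; rewrite -(cvg_shiftS (@harmonic R)).
Qed.

Let D_homo : nondecreasing_seq D.
Proof.
move=> m n mn; apply/subsetPset => x; rewrite /D /= !in_itv/= => /andP[h1 h2].
by have := c_homo mn; move=> h; apply/andP; split; lra.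
Qed.

Let D_union : \bigcup_n D n = `]-1, 1[%classic.
Proof.
apply/seteqP; split=> [x [n _]|x]; rewrite /D /= !in_itv/= => /andP[h1 h2].
  by have /andP[h3 h4] := c_bnd n; apply/andP; split; lra.
have [n _ nP] : \forall n \near \oo, `|x| < c n.
  apply: cvgr_gt c_cvg _ _; rewrite ltr_norml; lra.
exists n => //; rewrite /D /= in_itv/=; have := nP n (leqnn n).
by rewrite /= ltr_norml => /andP[h3 h4]; apply/andP; split; lra.
Qed.

Section fixed.
Variables (f F : R -> R) (l r : R).
Hypothesis cf : {in `]-1, 1[, continuous f}.
Hypothesis dF : forall x : R, -1 < x < 1 -> is_derive x (1:R) F (f x).
Hypothesis Fr : F x @[x --> 1^'-] --> r.
Hypothesis Fl : F x @[x --> (-1)^'+] --> l.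

Let FTC_D n : \int[mu]_(x in D n) f x = F (c n) - F (- c n).
Proof.
have /andP[c0 c1] := c_bnd n.
have dF' x : - c n <= x <= c n -> is_derive x 1 F (f x).
  by move=> /andP[h1 h2]; apply: dF; apply/andP; split; lra.
have cF x : - c n <= x <= c n -> {for x, continuous F}.
  move=> xc; apply: differentiable_continuous.
  by apply/derivable1_diffP; have [] := dF' x xc.
rewrite /Rintegral (@continuous_FTC2 _ f F)//; first lra.
- apply: (@continuous_in_subspaceT _ _ `[- c n, c n] f) => x.
  rewrite inE/= in_itv/= => /andP[h1 h2].
  by apply: cf; rewrite in_itv/=; apply/andP; split; lra.
- split => [x|/=|/=].
  + by rewrite in_itv/= => /andP[h1 h2]; have [] // := dF' x; apply/andP; split; lra.
  + by apply: cvg_at_right_filter; apply: cF; apply/andP; split; lra.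
  + by apply: cvg_at_left_filter; apply: cF; apply/andP; split; lra.
- move=> x; rewrite in_itv/= => /andP[h1 h2].
  have d : is_derive x 1 F (f x) by apply: dF'; apply/andP; split; lra.
  by rewrite derive1E derive_val.
Qed.

Let cvg_FD : F (c n) - F (- c n) @[n --> \oo] --> r - l.
Proof.
apply: cvgB.
  move/cvg_at_leftP: Fr; apply; split; last exact: c_cvg.
  by move=> n; have /andP[] := c_bnd n.
move/cvg_at_rightP: Fl; apply; split; last by apply: cvgN; exact: c_cvg.
by move=> n; have /andP[] := c_bnd n; lra.
Qed.

Let mf : measurable_fun (`]-1, 1[ : set (measurableTypeR R)) f.
Proof. by apply: open_continuous_measurable_fun => // x; rewrite inE => /cf. Qed.

(** The integrals over [D n] increase and equal [F (c n) - F (- c n)], so they stay below the finite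
    limit [r - l]; monotone convergence carries the bound to ]-1, 1[. *)
Lemma FTC_oo_ge0_integrable : (forall x : R, -1 < x < 1 -> 0 <= f x) ->
  mu.-integrable `]-1, 1[ (EFin \o f).
Proof.
move=> f0; apply/integrableP; split; first by apply/measurable_EFinP.
rewrite -D_union.
have mD n : measurable (D n : set (measurableTypeR R)) by exact: measurable_itv.
have Dsub n : D n `<=` `]-1, 1[%classic by rewrite -D_union; exact: bigcup_sup.
have mfU : measurable_fun (\bigcup_i D i : set (measurableTypeR R)) (fun x => `|(f x)%:E|%E).
  rewrite D_union; apply: measurableT_comp => //; exact/measurable_EFinP.
have key n : (\int[mu]_(x in D n) `|(f x)%:E| = (F (c n) - F (- c n))%:E)%E.
  rewrite -FTC_D /Rintegral fineK.
    apply: eq_integral => x /[!inE] Dx; rewrite gee0_abs// lee_fin f0//.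
    by have := Dsub n x Dx; rewrite /= in_itv.
  have H : mu.-integrable (D n) (EFin \o f); last first.
    exact: (integrable_fin_num (mD n) H).
  apply: continuous_compact_integrable; first exact: segment_compact.
  apply: (@continuous_in_subspaceT _ _ (D n) f) => x; rewrite inE => Dx.
  apply: cf; exact: (Dsub n x Dx).
have nn : nondecreasing_seq (fun n => \int[mu]_(x in D n) `|(f x)%:E|)%E.
  move=> m n mn; apply: ge0_subset_integral => //.
    apply: measurable_funS mfU => //; last exact: bigcup_sup.
    exact: bigcup_measurable.
  exact/subsetPset/D_homo.
have ub n : (\int[mu]_(x in D n) `|(f x)%:E| <= (r - l)%:E)%E.
  rewrite key lee_fin -(cvg_lim _ cvg_FD)//.
  apply: (@nondecreasing_cvgn_le _ (fun n => F (c n) - F (- c n))).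
    by move=> m k mk; rewrite -lee_fin -!key; exact: nn.
  by apply: cvgP; exact: cvg_FD.
have H : (\int[mu]_(x in D n) `|(f x)%:E| @[n --> \oo] -->
    \int[mu]_(x in \bigcup_n D n) `|(f x)%:E|)%E.
  apply: ge0_nondecreasing_set_cvg_integral => //.
  move=> n; apply: measurable_funS mfU; last exact: bigcup_sup.
  exact: bigcup_measurable.
apply: (@le_lt_trans _ _ (r - l)%:E); last exact: ltry.
rewrite -(cvg_lim _ H)//; apply: lime_le; first exact: cvgP H.
by near=> n; exact: ub.
Unshelve. all: by end_near. Qed.

(** For an integrand of any sign, the positive and negative parts converge separately along [D n];
    integrability keeps the difference of the limits from being oo - oo. *)
Lemma FTC_oo : mu.-integrable `]-1, 1[ (EFin \o f) ->
  \int[mu]_(x in `]-1, 1[) f x = r - l.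
Proof.
move=> fi.
have mD n : measurable (D n : set (measurableTypeR R)) by exact: measurable_itv.
have Dsub n : D n `<=` `]-1, 1[%classic by rewrite -D_union; exact: bigcup_sup.
have H : \int[mu]_(x in D n) f x @[n --> \oo] --> \int[mu]_(x in `]-1, 1[) f x.
  apply: fine_cvg; rewrite fineK; last exact: integrable_fin_num.
  have mfE : measurable_fun (`]-1, 1[ : set (measurableTypeR R)) (EFin \o f) by apply/measurable_EFinP.
  under eq_cvg do rewrite integralE.
  rewrite integralE; apply: cvgeB.
  - rewrite fin_num_adde_defl// fin_numN; exact: integrable_neg_fin_num.
  - rewrite -D_union; apply: ge0_nondecreasing_set_cvg_integral => // n.
    by apply: measurable_funS (measurable_funepos mfE).
  - rewrite -D_union; apply: ge0_nondecreasing_set_cvg_integral => // n.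
    by apply: measurable_funS (measurable_funeneg mfE).
have E : (fun n => \int[mu]_(x in D n) f x) = (fun n => F (c n) - F (- c n)).
  by apply/funext => n; rewrite FTC_D.
by apply: (cvg_unique _ H) => //; rewrite E; exact: cvg_FD.
Qed.

End fixed.
End Improper.

(** * Legendre polynomials *)

(** Derives an equation from two others once the coefficients of the linear combination are given;
    what remains is an identity for [ring]. *)
Lemma lincomb2 (A : comPzRingType) (x y c1 a1 b1 c2 a2 b2 : A) :
  a1 = b1 -> a2 = b2 -> x - y = c1 * (a1 - b1) + c2 * (a2 - b2) -> x = y.
Proof.
by move=> -> -> /eqP; rewrite !subrr !mulr0 addr0 subr_eq0 => /eqP.
Qed.

Section Legendre.
Context {R : realType}.
Implicit Types (n : nat) (p q : {poly R}).
Local Notation mu := (@lebesgue_measure R).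

(** Bonnet's recursion reaches two steps back, so two consecutive polynomials are carried along. *)
Fixpoint legendre_pair n : {poly R} * {poly R} :=
  if n is m.+1 then
    let: (p, q) := legendre_pair m in
    (q, m.+2%:R^-1 *: ((m.*2.+3)%:R * 'X * q - m.+1%:R * p))
  else (1, 'X).

Definition legendre n : {poly R} := (legendre_pair n).1.

Lemma legendre0 : legendre 0 = 1. Proof. by []. Qed.

Lemma legendre1 : legendre 1 = 'X. Proof. by []. Qed.

Lemma legendreS n : n.+2%:R * legendre n.+2 =
  (n.*2.+3)%:R * 'X * legendre n.+1 - n.+1%:R * legendre n.
Proof.
rewrite /legendre /=; case: (legendre_pair n) => p q /=.
by rewrite mulr_natl -scaler_nat scalerA divff ?scale1r// pnatr_eq0.
Qed.

Lemma deriv_natr n : (n%:R : {poly R})^`() = 0.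
Proof. by rewrite -polyC_natr derivC. Qed.

(** The two relations need each other in the induction: differentiating Bonnet's recursion and using
    the first at n gives the second at n + 1, and the first at n + 1 follows by elimination. *)
Lemma legendre_deriv n :
  'X * (legendre n.+1)^`() = (legendre n)^`() + n.+1%:R * legendre n.+1 /\
  (legendre n.+1)^`() = 'X * (legendre n)^`() + n.+1%:R * legendre n.
Proof.
elim: n => [|n [IHA IHB]].
  by rewrite legendre0 legendre1 derivX derivC mulr0 !add0r !mul1r mulr1.
have nz k : (k.+1%:R : {poly R}) != 0 by rewrite -polyC_natr polyC_eq0 pnatr_eq0.
have HS := legendreS n; have dHS := congr1 (fun p => p^`()) HS.
move: dHS; rewrite derivB !derivM !deriv_natr derivX => dHS.
have HB : (legendre n.+2)^`() = 'X * (legendre n.+1)^`() + n.+2%:R * legendre n.+1.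
  apply: (mulfI (nz n.+1)).
  apply: (lincomb2 (c1 := 1) (c2 := n.+1%:R) dHS IHA).
  by rewrite -!addnn !mulrSr !natrD; ring.
split=> //.
apply: (lincomb2 (c1 := 'X) (c2 := 1) HB (esym HS)).
(* Eliminating P_n' between the two induction hypotheses leaves (1 - x^2) P_(n+1)' in terms of P_n
   and P_(n+1). *)
have C := lincomb2 (c1 := 1) (c2 := - 'X) (x := (1 - 'X ^+ 2) * (legendre n.+1)^`())
  (y := n.+1%:R * (legendre n - 'X * legendre n.+1)) IHB IHA.
have {}C : (1 - 'X ^+ 2) * (legendre n.+1)^`() = n.+1%:R * (legendre n - 'X * legendre n.+1).
  by apply: C; ring.
apply: (lincomb2 (c1 := -1) (c2 := 0) C (erefl (0 : {poly R}))).
by rewrite -!addnn !mulrSr !natrD; ring.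
Qed.

Lemma legendre_derivX n :
  'X * (legendre n.+1)^`() = (legendre n)^`() + n.+1%:R * legendre n.+1.
Proof. by have [] := legendre_deriv n. Qed.

Lemma legendre_derivS n :
  (legendre n.+1)^`() = 'X * (legendre n)^`() + n.+1%:R * legendre n.
Proof. by have [] := legendre_deriv n. Qed.

Lemma legendre_derivC n :
  (1 - 'X ^+ 2) * (legendre n.+1)^`() = n.+1%:R * (legendre n - 'X * legendre n.+1).
Proof.
apply: (lincomb2 (c1 := 1) (c2 := - 'X) (legendre_derivS n) (legendre_derivX n)).
by ring.
Qed.

Lemma legendre_ODE n : ((1 - 'X ^+ 2) * (legendre n)^`())^`() =
  - (n * n.+1)%:R * legendre n.
Proof.
case: n => [|n]; first by rewrite legendre0 derivC mulr0 deriv0 mul0n oppr0 mul0r.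
rewrite legendre_derivC derivM derivB (derivM 'X) derivX deriv_natr mul0r add0r mul1r.
apply: (lincomb2 (c1 := - n.+1%:R) (c2 := 0) (legendre_derivX n) (erefl (0 : {poly R}))).
by rewrite natrM !mulrSr; ring.
Qed.

Lemma horner_natr n (x : R) : (n%:R : {poly R}).[x] = n%:R.
Proof. by rewrite -polyC_natr hornerC. Qed.

Lemma legendreSE n (x : R) : n.+2%:R * (legendre n.+2).[x] =
  (n.*2.+3)%:R * x * (legendre n.+1).[x] - n.+1%:R * (legendre n).[x].
Proof.
have := congr1 (fun p => p.[x]) (legendreS n).
by rewrite /= hornerD hornerN !hornerM hornerX !horner_natr.
Qed.

Lemma legendre_derivSE n (x : R) :
  (legendre n.+1)^`().[x] = x * (legendre n)^`().[x] + n.+1%:R * (legendre n).[x].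
Proof. by rewrite legendre_derivS !(hornerE, horner_natr). Qed.

Lemma legendre_derivCE n (x : R) :
  (1 - x ^+ 2) * (legendre n.+1)^`().[x] =
  n.+1%:R * ((legendre n).[x] - x * (legendre n.+1).[x]).
Proof.
have := congr1 (fun p => p.[x]) (legendre_derivC n).
by rewrite /= !(hornerE, horner_natr).
Qed.

Definition poly_int p : R := \int[mu]_(x in `[-1, 1]) p.[x].

Lemma continuous_poly p : continuous (horner p).
Proof. by move=> x; exact: continuous_horner. Qed.

Lemma poly_intD p q : poly_int (p + q) = poly_int p + poly_int q.
Proof.
rewrite /poly_int -integral_add; [|exact: continuous_poly..].
by apply: eq_Rintegral => x _; rewrite hornerD.
Qed.

Lemma poly_intZ k p : poly_int (k *: p) = k * poly_int p.
Proof.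
rewrite /poly_int -integral_scale; [|exact: continuous_poly].
by apply: eq_Rintegral => x _; rewrite hornerZ.
Qed.

Lemma poly_intMn k p : poly_int (k%:R * p) = k%:R * poly_int p.
Proof. by rewrite mulr_natl -scaler_nat poly_intZ. Qed.

Lemma poly_intB p q : poly_int (p - q) = poly_int p - poly_int q.
Proof. by rewrite -scaleN1r poly_intD poly_intZ mulN1r. Qed.

Lemma poly_int_deriv p : poly_int p^`() = p.[1] - p.[-1].
Proof. apply: (@FTC_cont _ _ _ (horner p^`()) (horner p)); first by lra.
exact: continuous_poly. Qed.

(** Sturm-Liouville argument: the difference of the eigenvalues times P_m P_n is the derivative of
    (1 - x^2) times a Wronskian, which vanishes at both ends; k(k+1) is injective in k. *)
Lemma legendre_orth m n : m != n -> poly_int (legendre m * legendre n) = 0.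
Proof.
move=> mn.
have E : (m * m.+1)%:R * (legendre m * legendre n)
    - (n * n.+1)%:R * (legendre m * legendre n) =
  ((1 - 'X ^+ 2) * (legendre n)^`() * legendre m
   - (1 - 'X ^+ 2) * (legendre m)^`() * legendre n)^`().
  rewrite derivB (derivM (_ * (legendre n)^`())) (derivM (_ * (legendre m)^`())).
  by rewrite !legendre_ODE; ring.
have := congr1 poly_int E.
rewrite poly_int_deriv poly_intB !poly_intMn !hornerE !expr1n sqrrN expr1n.
rewrite -mulrBl => H.
have /eqP : ((m * m.+1)%:R - (n * n.+1)%:R) * poly_int (legendre m * legendre n) = 0.
  by rewrite H; ring.
rewrite mulf_eq0 => /orP[|/eqP//].
rewrite subr_eq0 eqr_nat => /eqP H2; exfalso; move/eqP: mn; apply; nia.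
Qed.

(** Two instances of Bonnet's recursion express the integral of x P_k P_(k+1) through the norm of
    P_k and through that of P_(k+1), whence their ratio. *)
Lemma legendre_norm n : poly_int (legendre n * legendre n) = 2 / (n.*2.+1)%:R.
Proof.
have H k : (k.*2.+3)%:R * poly_int (legendre k.+1 * legendre k.+1) =
           (k.*2.+1)%:R * poly_int (legendre k * legendre k).
  have E1 : k.+2%:R * (legendre k.+2 * legendre k) =
    (k.*2.+3)%:R * ('X * legendre k.+1 * legendre k)
     - k.+1%:R * (legendre k * legendre k).
    by rewrite mulrA legendreS; ring.
  (* At k = 0 the index [k.-1] is 0 instead of -1; the factor [k%:R] removes that term. *)
  have E2 : k.+1%:R * (legendre k.+1 * legendre k.+1) =
    (k.*2.+1)%:R * ('X * legendre k.+1 * legendre k)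
     - k%:R * (legendre k.+1 * legendre k.-1).
    case: k {E1} => [|k]; first by rewrite legendre0 legendre1 mul0r subr0 !mul1r mulr1.
    rewrite mulrA legendreS /=.
    by rewrite doubleS; ring.
  move: (congr1 poly_int E1) (congr1 poly_int E2).
  rewrite !poly_intB !poly_intMn legendre_orth; last by lia.
  have -> : k%:R * poly_int (legendre k.+1 * legendre k.-1) = 0.
    by case: k {E1 E2} => [|k]; rewrite ?mul0r// legendre_orth ?mulr0//; lia.
  move=> /eqP; rewrite mulr0 eq_sym subr_eq0 => /eqP F1; rewrite subr0 => F2.
  have nz : (k.+1%:R : R) != 0 by rewrite pnatr_eq0.
  by apply: (mulfI nz); rewrite mulrCA F2 mulrCA F1 mulrCA.
elim: n => [|n IH].
  rewrite legendre0 mulr1 divr1 /poly_int.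
  under eq_Rintegral do rewrite hornerC.
  by rewrite integral_cst_seg ?mul1r//; lra.
have nz m : (m.+1%:R : R) != 0 by rewrite pnatr_eq0.
by apply: (mulfI (nz n.*2.+2)); rewrite H IH doubleS !(mulrCA _ 2) !divff ?mulr1.
Qed.

End Legendre.

(** * Cosine expansion of the Legendre polynomials *)

Section Trig.
Context {R : realType}.
Implicit Types (n k : nat) (t : R).
Local Notation mu := (@lebesgue_measure R).

Fixpoint cbin_rec n : R :=
  if n is m.+1 then cbin_rec m * (m.*2.+1)%:R / (m.*2.+2)%:R else 1.

(* C(2n, n) / 4^n, locked so that unification never unfolds it. *)
Definition cbin n : R := locked cbin_rec n.

Lemma natS_neq0 n : (n.+1%:R : R) != 0. Proof. by rewrite pnatr_eq0. Qed.

Lemma natD2 n : (n.*2%:R : R) = n%:R + n%:R. Proof. by rewrite -addnn natrD. Qed.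

Lemma natD1 n : (n.+1%:R : R) = n%:R + 1. Proof. by rewrite mulrSr. Qed.

Lemma cbin0 : cbin 0 = 1. Proof. by rewrite /cbin -lock. Qed.

Lemma cbinSE n : cbin n.+1 = cbin n * (n.*2.+1)%:R / (n.*2.+2)%:R.
Proof. by rewrite /cbin -lock. Qed.

Lemma cbinS n : (n.*2.+2)%:R * cbin n.+1 = (n.*2.+1)%:R * cbin n.
Proof. by rewrite cbinSE mulrC divfK ?natS_neq0// mulrC. Qed.

Lemma nat2p1 n : ((n.*2.+1)%:R : R) = 2 * n%:R + 1.
Proof. by rewrite -addn1 natrD -mul2n natrM. Qed.

Lemma nat2p2 n : ((n.*2.+2)%:R : R) = 2 * n%:R + 2.
Proof. by rewrite -addn2 natrD -mul2n natrM. Qed.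

Lemma nat2p3 n : ((n.*2.+3)%:R : R) = 2 * n%:R + 3.
Proof. by rewrite -addn3 natrD -mul2n natrM. Qed.

Lemma cbinS2 n : n.+1%:R * cbin n.+1 = (n.*2.+1)%:R / 2 * cbin n.
Proof.
have -> : n.+1%:R = (n.*2.+2)%:R / 2 :> R by rewrite -doubleS -muln2 natrM mulfK.
by rewrite mulrAC cbinS mulrAC.
Qed.

Lemma cbin_gt0 n : 0 < cbin n.
Proof. by elim: n => [|n IH]; rewrite ?cbinSE ?cbin0// !mulr_gt0// invr_gt0. Qed.

Lemma cos_prod (a b : R) : cos a * cos b = (cos (a + b) + cos (a - b)) / 2.
Proof. by rewrite cosD cosB; field. Qed.

(** Both sides obey Bonnet's recursion and agree for n = 0 and n = 1. Multiplication by cos t splits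
    each cosine into its two neighbouring frequencies, which reduces the recursion to one between
    coefficients. *)
Lemma legendre_cos n t : (legendre n).[cos t] =
  \sum_(k < n.+1) cbin k * cbin (n - k) * cos ((n%:R - k.*2%:R) * t).
Proof.
pose S n := \sum_(k < n.+1) cbin k * cbin (n - k) * cos ((n%:R - k.*2%:R) * t).
have recS m : m.+2%:R * S m.+2 =
  (m.*2.+3)%:R * cos t * S m.+1 - m.+1%:R * S m.
  pose D k := cos ((m.+2%:R - k.*2%:R) * t).
  (* All three sums are written over the frequencies [D k] of [S m.+2], with the two extreme
     frequencies, absent from [S m], split off. *)
  have E2 : S m.+2 = cbin m.+2 * D 0%N
      + \sum_(k < m.+1) cbin k.+1 * cbin (m.+1 - k) * D k.+1
      + cbin m.+2 * D m.+2.
    rewrite /S big_ord_recl big_ord_recr /= ?subn0 ?cbin0 ?mul1r addrA.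
    congr (_ + _ + _).
    by rewrite /bump /= add1n subnn cbin0 mulr1.
  have E1 : cos t * S m.+1 = 2^-1 * (cbin m.+1 * D 0%N
      + \sum_(k < m.+1) (cbin k.+1 * cbin (m - k) + cbin k * cbin (m.+1 - k)) * D k.+1
      + cbin m.+1 * D m.+2).
    have -> : cos t * S m.+1 = 2^-1 *
       (\sum_(k < m.+2) cbin k * cbin (m.+1 - k) * D k
        + \sum_(k < m.+2) cbin k * cbin (m.+1 - k) * D k.+1).
      rewrite -big_split /= /S !mulr_sumr; apply: eq_bigr => k _.
      rewrite mulrCA mulrC cos_prod mulrC.
      have -> : t + (m.+1%:R - k.*2%:R) * t = (m.+2%:R - k.*2%:R) * t.
        by rewrite (natD1 m.+1); ring.
      have -> : t - (m.+1%:R - k.*2%:R) * t = - ((m.+2%:R - k.+1.*2%:R) * t).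
        by rewrite (natD1 m.+1) !natD2 !natD1; ring.
      by rewrite cosN /D; ring.
    congr (_ * _).
    rewrite big_ord_recl [X in _ + X]big_ord_recr /= ?subn0 ?subnn cbin0 mul1r mulr1.
    rewrite addrA; congr (_ + _); rewrite -addrA; congr (_ + _).
    rewrite -big_split /=; apply: eq_bigr => k _.
    by rewrite /bump /= add1n subSS mulrDl.
  have E0 : S m = \sum_(k < m.+1) cbin k * cbin (m - k) * D k.+1.
    apply: eq_bigr => k _; congr (_ * cos (_ * _)).
    by rewrite !natD2 !natD1; ring.
  rewrite E2 -mulrA E1 E0.
  rewrite !mulrDr !mulr_sumr.
  have -> : m.+2%:R * (cbin m.+2 * D 0%N) =
            m.*2.+3%:R * (2^-1 * (cbin m.+1 * D 0%N)).
    have H : m.+2%:R * cbin m.+2 = m.*2.+3%:R / 2 * cbin m.+1 by rewrite cbinS2.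
    by rewrite mulrA H; ring.
  have -> : m.+2%:R * (cbin m.+2 * D m.+2) =
            m.*2.+3%:R * (2^-1 * (cbin m.+1 * D m.+2)).
    have H : m.+2%:R * cbin m.+2 = m.*2.+3%:R / 2 * cbin m.+1 by rewrite cbinS2.
    by rewrite mulrA H; ring.
  rewrite [X in _ = X - _]addrAC -addrA; apply/eqP; rewrite -subr_eq0; apply/eqP.
  rewrite -sumrN.
  set A := \sum_(k < m.+1) _; set B := \sum_(k < m.+1) _; set C := \sum_(k < m.+1) _.
  have -> : A = B + C.
    rewrite /A /B /C -big_split /=; apply: eq_bigr => -[k /= km] _.
    (* With m = k + j the ratios of consecutive values of [cbin] at k and at j are rational
       functions, and [field] can check the coefficient identity. *)
    have [j mE] : exists j, m = (k + j)%N by exists (m - k)%N; lia.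
    have -> : (m - k = j)%N by lia.
    have -> : (m.+1 - k = j.+1)%N by lia.
    rewrite mE !cbinSE.
    have h1 : (2 * k%:R + 2 : R) != 0 by rewrite -nat2p2 natS_neq0.
    have h2 : (2 * j%:R + 2 : R) != 0 by rewrite -nat2p2 natS_neq0.
    rewrite !nat2p1 !nat2p2 nat2p3 -addn2 -addn1 !natrD.
    by field; rewrite h1 h2.
  by ring.
have H m : (legendre m).[cos t] = S m /\ (legendre m.+1).[cos t] = S m.+1.
  elim: m => [|m [IH0 IH1]].
    split; first by rewrite legendre0 hornerC /S big_ord1 /= subr0 mul0r cos0 cbin0 !mulr1.
    rewrite legendre1 hornerX /S !big_ord_recl big_ord0 /= /bump /= ?subn0 ?subnn cbinSE cbin0 !mulr1 !mul1r.
    have -> : (1 - 0) * t = t by ring.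
    have -> : (1 - 2%:R) * t = - t by ring.
    rewrite cosN (_ : 0.*2.+2 = 2)%N//.
    by field.
  split=> //; apply: (mulfI (natS_neq0 m.+1)).
  by rewrite legendreSE IH0 IH1 recS.
by have [] := H n.
Qed.

(** Both sides are P_n(1), the cosine expansion being taken at t = 0. In generating functions: (1 -
    x)^(-1/2) squared is 1/(1 - x). *)
Lemma cbin_conv n : \sum_(k < n.+1) cbin k * cbin (n - k) = 1.
Proof.
have H := legendre_cos n 0.
transitivity (legendre n).[1 : R].
  rewrite -[1]cos0 H; apply: eq_bigr => k _.
  by rewrite mulr0 cos0 mulr1.
have {H} H m : (legendre m).[1 : R] = 1 /\ (legendre m.+1).[1 : R] = 1.
  elim: m => [|m [IH0 IH1]]; first by rewrite legendre0 legendre1 hornerC hornerX.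
  split=> //; apply: (mulfI (natS_neq0 m.+1)).
  by rewrite legendreSE IH0 IH1 !natD1 natD2; ring.
by have [] := H n.
Qed.

Lemma sin_natpi n : sin (n%:R * pi) = 0 :> R.
Proof.
elim: n => [|n IH]; first by rewrite mul0r sin0.
by rewrite natD1 mulrDl mul1r sinD IH sinpi mulr0 mul0r addr0.
Qed.

Lemma continuous_cosM (a : R) : continuous (fun t : R => cos (a * t)).
Proof.
move=> t; apply: (@continuous_comp _ _ _ ( *%R a) cos); last exact: continuous_cos.
exact: mulrl_continuous.
Qed.

Lemma integral_cos (i j : nat) :
  \int[mu]_(t in `[0, pi]) cos ((i%:R - j%:R) * t) = if i == j then pi else 0.
Proof.
case: eqVneq => [->|ij].
  under eq_Rintegral do rewrite subrr mul0r cos0.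
  by rewrite integral_cst_seg ?pi_ge0// mul1r subr0.
pose d : R := i%:R - j%:R.
have d0 : d != 0 by rewrite subr_eq0 eqr_nat.
transitivity (d^-1 * sin (d * pi) - d^-1 * sin (d * 0)); last first.
  have -> : sin (d * pi) = 0 by rewrite mulrBl sinB !sin_natpi mul0r mulr0 subrr.
  by rewrite !mulr0 sin0 mulr0 subrr.
apply: (@FTC_cont _ _ _ _ (fun t => d^-1 * sin (d * t))); first exact: pi_gt0.
  exact: continuous_cosM.
move=> t; apply: is_derive_eq.
by rewrite /GRing.scale /= mulr1 mulrCA mulVf// mulr1.
Qed.

Lemma integral_cosM (i j k l : nat) :
  \int[mu]_(t in `[0, pi]) (cos ((i%:R - j%:R) * t) * cos ((k%:R - l%:R) * t)) =
  ((if (i + k == j + l)%N then pi else 0) + (if (i + l == j + k)%N then pi else 0)) / 2.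
Proof.
rewrite -!integral_cos mulrC -integral_add; [|exact: continuous_cosM..].
rewrite -integral_scale; last first.
  by move=> t; apply: continuousD; exact: continuous_cosM.
apply: eq_Rintegral => t _; rewrite cos_prod mulrC !natrD.
by congr (_ * (cos _ + cos _)); ring.
Qed.

Lemma legendre_sqr_cos_integral n :
  \int[mu]_(t in `[0, pi]) ((legendre n).[cos t] ^+ 2) =
  pi * \sum_(k < n.+1) cbin k ^+ 2 * cbin (n - k) ^+ 2.
Proof.
pose a (k : 'I_n.+1) := cbin k * cbin (n - k).
pose c (k : 'I_n.+1) t : R := cos ((n%:R - k.*2%:R) * t).
have cc (k : 'I_n.+1) : continuous (c k) by exact: continuous_cosM.
transitivity (\int[mu]_(t in `[0, pi])
    (\sum_(k < n.+1) \sum_(l < n.+1) a k * a l * (c k t * c l t))).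
  apply: eq_Rintegral => t _; rewrite legendre_cos expr2 big_distrl /=.
  apply: eq_bigr => k _; rewrite big_distrr /=; apply: eq_bigr => l _.
  by rewrite /a /c; ring.
have cM (k l : 'I_n.+1) : continuous (fun t => c k t * c l t).
  by move=> t; apply: continuousM; exact: cc.
have cZ (k l : 'I_n.+1) : continuous (fun t => a k * a l * (c k t * c l t)).
  by apply: cont_mul (cM k l); exact: cont_cst.
rewrite integral_sum_cont; last by move=> k; exact: continuous_sumf.
rewrite mulr_sumr; apply: eq_bigr => k _.
rewrite integral_sum_cont; last exact: cZ.
(* The frequency n - 2k is met again, up to sign, at l = k and at l = n - k. When n = 2k these
   indices coincide and the two halves add up to pi, the integral of the constant cosine squared. *)
have -> : \sum_(l < n.+1) \int[mu]_(x in `[0, pi]) (a k * a l * (c k x * c l x)) =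
  \sum_(l < n.+1) (a k * a l * (pi / 2) *+ (l == k) + a k * a l * (pi / 2) *+ (l == rev_ord k)).
  apply: eq_bigr => l _; rewrite integral_scale; last exact: cM.
  rewrite integral_cosM mulrDl mulrDr addrC; congr (_ + _).
    have -> : (n + l.*2 == k.*2 + n)%N = (l == k) by rewrite -val_eqE /=; lia.
    by case: eqP => _; rewrite ?mulr1n// mul0r mulr0 mulr0n.
  have -> : (n + n == k.*2 + l.*2)%N = (l == rev_ord k).
    by rewrite -val_eqE /=; have := ltn_ord k; have := ltn_ord l; lia.
  by case: eqP => _; rewrite ?mulr1n// mul0r mulr0 mulr0n.
rewrite big_split /=.
have D (P : 'I_n.+1) : \sum_(l < n.+1) a k * a l * (pi / 2) *+ (l == P) =
    a k * a P * (pi / 2).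
  by rewrite (bigD1 P)//= eqxx mulr1n big1 ?addr0// => l /negbTE ->.
rewrite !D /a /= subSS subKn; last by rewrite -ltnS.
by field.
Qed.

End Trig.

(** * Landau's constants *)

Section Landau.
Context {R : realType}.
Implicit Types (n k : nat) (t x y : R).
Local Notation mu := (@lebesgue_measure R).
Local Notation cbin := (@cbin R).

Definition wallis n : R := \int[mu]_(t in `[0, pi / 2]) cos t ^+ n.

Lemma pihalf_gt0 : 0 < pi / 2 :> R.
Proof. by rewrite divr_gt0// pi_gt0. Qed.

Lemma cos_pihalf_itv t : 0 <= t <= pi / 2 -> 0 <= cos t <= 1.
Proof.
move=> /andP[t0 t1]; rewrite cos_le1 andbT cos_ge0_pihalf//.
by rewrite t1 andbT (le_trans _ t0)// oppr_le0 ltW// pihalf_gt0.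
Qed.

Lemma wallis0 : wallis 0 = pi / 2.
Proof.
rewrite /wallis; under eq_Rintegral do rewrite expr0.
by rewrite integral_cst_seg ?ltW ?pihalf_gt0// subr0 mul1r.
Qed.

Lemma wallis1 : wallis 1 = 1.
Proof.
rewrite /wallis.
transitivity (sin (pi / 2) - sin 0 : R); last by rewrite sin_pihalf sin0 subr0.
by apply: FTC_cont; [exact: pihalf_gt0|prove_cont].
Qed.

(** The derivative of sin t cos^(n+1) t is (n+2) cos^(n+2) t - (n+1) cos^n t, and the primitive
    vanishes at 0 and pi/2. *)
Lemma wallisS n : n.+2%:R * wallis n.+2 = n.+1%:R * wallis n.
Proof.
have c k : continuous (fun t : R => cos t ^+ k) by prove_cont.
rewrite /wallis -!integral_scale//; apply/eqP; rewrite -subr_eq0; apply/eqP.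
rewrite -integral_sub; [|prove_cont..].
transitivity (sin (pi / 2) * cos (pi / 2) ^+ n.+1 - sin 0 * cos 0 ^+ n.+1 : R).
  apply: (@FTC_cont _ _ _ _ (fun t => sin t * cos t ^+ n.+1)).
  - exact: pihalf_gt0.
  - by prove_cont.
  - move=> t; apply: is_derive_eq; first by prove_deriv.
    have S : sin t * sin t = 1 - cos t ^+ 2 by rewrite -expr2 sin2cos2.
    rewrite /= !exprS (natD1 n.+1).
    transitivity (cos t * (cos t * cos t ^+ n)
      - (sin t * sin t) * n.+1%:R * cos t ^+ n); first by ring.
    by rewrite S; ring.
by rewrite sin0 mul0r cos_pihalf expr0n mulr0 subrr.
Qed.

Lemma wallis_decr m n : (m <= n)%N -> wallis n <= wallis m.
Proof.
move=> mn; apply: integral_le; [prove_cont..|].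
move=> t /cos_pihalf_itv /andP[c0 c1].
by rewrite -(subnK mn) exprD ler_piMl ?exprn_ge0// exprn_ile1.
Qed.

Lemma wallis_even n : wallis n.*2 = pi / 2 * cbin n.
Proof.
elim: n => [|n IH]; first by rewrite wallis0 cbin0 mulr1.
apply: (mulfI (@natS_neq0 R n.*2.+1)).
by rewrite doubleS wallisS IH mulrCA -cbinS mulrCA.
Qed.

Lemma wallis_odd n : wallis n.*2.+1 = (n.*2.+1%:R * cbin n)^-1.
Proof.
have c0 k : cbin k != 0 by rewrite gt_eqF// cbin_gt0.
elim: n => [|n IH]; first by rewrite wallis1 cbin0 mulr1 invr1.
apply: (mulfI (@natS_neq0 R n.*2.+2)).
rewrite doubleS wallisS IH -(cbinS n); move: (cbin n.+1) => c.
by rewrite !invfM !mulVKf// natS_neq0.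
Qed.

Definition cbin2 n : R := cbin n ^+ 2.

Lemma cbin2_ge0 n : 0 <= cbin2 n. Proof. by rewrite exprn_ge0// ltW// cbin_gt0. Qed.

(** This is W_(2n+2) <= W_(2n+1) for the Wallis integrals. Together with [cbin2_lb], which is
    W_(2n+1) <= W_(2n), it pins k g_k^2 to 1/pi with error O(1/k). *)
Lemma cbin2_ub n : n.+1%:R * cbin2 n.+1 <= pi^-1.
Proof.
have := @wallis_decr n.*2.+1 n.*2.+2 (leqnSn _).
rewrite -doubleS wallis_even wallis_odd -cbinS.
have c0 := @cbin_gt0 R n.+1; have p0 := @pi_gt0 R.
have n0 : 0 < n.+1%:R :> R by [].
have -> : (n.*2.+2)%:R = 2 * n.+1%:R :> R by rewrite -doubleS -mul2n natrM.
move=> H; have {}H : pi / 2 * cbin n.+1 * (2 * n.+1%:R * cbin n.+1) <= 1.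
  rewrite -ler_pdivlMr ?mulr_gt0//.
  by rewrite div1r.
have : n.+1%:R * cbin2 n.+1 * pi <= 1.
  apply: le_trans H; rewrite le_eqVlt; apply/orP; left; apply/eqP; rewrite /cbin2.
  by move: (pi : R) => P; field.
by rewrite -ler_pdivlMr// div1r.
Qed.

Lemma cbin2_lb n : 2 / (pi * (n.*2.+1)%:R) <= cbin2 n.
Proof.
have := @wallis_decr n.*2 n.*2.+1 (leqnSn _).
rewrite wallis_even wallis_odd.
have c0 := @cbin_gt0 R n; have p0 := @pi_gt0 R.
have n0 : 0 < n.*2.+1%:R :> R by [].
rewrite -[(_ * cbin _)^-1]div1r ler_pdivrMr ?mulr_gt0// ler_pdivrMr ?mulr_gt0// /cbin2 => H.
have -> : cbin n ^+ 2 * (pi * n.*2.+1%:R) = 2 * (pi / 2 * cbin n * (n.*2.+1%:R * cbin n)).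
  by field.
by rewrite -[X in X <= _]mulr1 ler_pM2l.
Qed.

(** Cruder than [cbin2_ub], but it includes n = 0 and so fits every term of a convolution. *)
Lemma cbin2_le n : cbin2 n <= n.+1%:R^-1.
Proof.
case: n => [|n]; first by rewrite /cbin2 cbin0 expr1n invr1.
have n0 : 0 < n.+1%:R :> R by [].
have := cbin2_ub n; rewrite -ler_pdivlMl// => /le_trans; apply.
rewrite -invfM lef_pV2 ?posrE ?mulr_gt0// ?pi_gt0//.
have := @pi_ge2 R; rewrite (natD1 n.+1) => p2.
have : 1 <= n.+1%:R :> R by rewrite ler1n.
by move: (n.+1%:R) n0 => z z0 z1; nra.
Qed.

Lemma cvg_inv_nat : (n.+1%:R^-1 : R) @[n --> \oo] --> 0.
Proof. exact: cvg_harmonic. Qed.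

Lemma cbin2_cvg0 : cbin2 n @[n --> \oo] --> (0 : R).
Proof.
apply: (squeeze_cvgr _ (cvg_cst 0) cvg_inv_nat).
by near=> n; rewrite cbin2_ge0 cbin2_le.
Unshelve. all: by end_near. Qed.

Lemma cbin_cvg0 : cbin n @[n --> \oo] --> (0 : R).
Proof.
have -> : cbin = Num.sqrt \o cbin2.
  by apply/funext => n; rewrite /= sqrtr_sqr gtr0_norm// cbin_gt0.
rewrite -[X in _ --> X]sqrtr0; apply: cvg_comp cbin2_cvg0 _.
exact: sqrt_continuous.
Qed.

Definition harm n : R := \sum_(1 <= k < n.+1) k%:R^-1.

Lemma harm0 : harm 0 = 0. Proof. by rewrite /harm big_geq. Qed.

Lemma harmS n : harm n.+1 = harm n + n.+1%:R^-1.
Proof. by rewrite /harm big_nat_recr. Qed.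

(** [euler_gamma] is a bare [lim], so existence of the limit must be shown: the sequence decreases
    and is bounded below by 0, both from ln(1 + x) <= x. *)
Lemma harm_cvg : harm n - ln n%:R @[n --> \oo] --> euler_gamma R.
Proof.
pose u n : R := harm n - ln n%:R.
(* The index is shifted because [ln 0] is 0: [u 0 = 0] lies below [u 1 = 1]. *)
have nu : nonincreasing_seq (fun n => u n.+1).
  apply/nonincreasing_seqP => n; rewrite /u harmS.
  have p1 : 0 < n.+1%:R :> R by []. have p2 : 0 < n.+2%:R :> R by [].
  have -> : ln n.+1%:R = ln n.+2%:R + ln (n.+1%:R / n.+2%:R) :> R.
    by rewrite ln_div ?posrE//; ring.
  have E : n.+1%:R / n.+2%:R = 1 + - n.+2%:R^-1 :> R.
    have -> : n.+1%:R = n.+2%:R - 1 :> R by rewrite (natD1 n.+1) addrK.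
    by rewrite mulrBl divff// mul1r.
  have := @le_ln1Dx R (- n.+2%:R^-1); rewrite -E ltrN2 invf_lt1// ltr1n => /(_ isT).
  by move: (ln (n.+1%:R / n.+2%:R : R)) (ln (n.+2%:R : R)) (n.+2%:R^-1 : R) => x y z; lra.
have [l ul] : exists l, u n.+1 @[n --> \oo] --> (l : R).
  exists (lim (u n.+1 @[n --> \oo])); apply: nonincreasing_is_cvgn nu _.
  have H n : ln n.+1%:R <= harm n.
    elim: n => [|n IH]; first by rewrite ln1 harm0.
    rewrite harmS; have p1 : 0 < n.+1%:R :> R by []. have p2 : 0 < n.+2%:R :> R by [].
    have -> : ln n.+2%:R = ln n.+1%:R + ln (n.+2%:R / n.+1%:R) :> R.
      by rewrite ln_div ?posrE//; ring.
    have E : n.+2%:R / n.+1%:R = 1 + n.+1%:R^-1 :> R.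
      by rewrite (natD1 n.+1) mulrDl divff// mul1r.
    have i0 : -1 < n.+1%:R^-1 :> R by rewrite (@lt_trans _ _ 0)// invr_gt0.
    by rewrite lerD// E le_ln1Dx.
  exists 0 => _ [n _ <-]; rewrite /u /= subr_ge0.
  by apply: le_trans (H n) _; rewrite harmS lerDl invr_ge0.
move: ul; rewrite (cvg_shiftS u) => ul.
by rewrite /euler_gamma (cvg_lim _ ul).
Qed.

Lemma odd_harm_sum n : \sum_(k < n) (k.*2.+1%:R^-1 : R) = harm n.*2 - harm n / 2.
Proof.
elim: n => [|n IH]; first by rewrite big_ord0 harm0 mul0r subrr.
rewrite big_ord_recr /= IH doubleS !harmS.
have -> : (n.*2.+2)%:R = 2 * n.+1%:R :> R by rewrite -doubleS -mul2n natrM.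
have nz1 := @natS_neq0 R n.*2; have nz2 := @natS_neq0 R n.
move: (harm _) (harm _) (n.*2.+1%:R) (n.+1%:R) nz1 nz2 => u v x y x0 y0.
by field; rewrite x0 y0.
Qed.

Lemma odd_harm_cvg : \sum_(k < n) (k.*2.+1%:R^-1 : R) - ln n%:R / 2 @[n --> \oo]
  --> euler_gamma R / 2 + ln 2.
Proof.
have H2 : harm n.*2 - ln n.*2%:R @[n --> \oo] --> euler_gamma R.
  have := @cvg_comp _ _ _ double (fun n => harm n - ln n%:R) \oo \oo (nbhs (euler_gamma R)).
  apply; last exact: harm_cvg.
  move=> P [N _ NP]; exists N => // n /= Nn; apply: NP => /=; lia.
have -> : euler_gamma R / 2 + ln 2 = euler_gamma R - euler_gamma R / 2 + ln 2 :> R.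
  by field.
have H : (harm n.*2 - ln n.*2%:R) - (harm n - ln n%:R) / 2 + ln 2 @[n --> \oo]
    --> euler_gamma R - euler_gamma R / 2 + ln 2.
  apply: cvgD; last exact: cvg_cst.
  by apply: cvgB => //; apply: cvgM; [exact: harm_cvg|exact: cvg_cst].
apply: cvg_trans H; apply: near_eq_cvg; near=> n.
have n0 : 0 < n%:R :> R by rewrite ltr0n; near: n; exists 1%N.
rewrite /= odd_harm_sum -mul2n natrM lnM ?posrE//.
by field.
Unshelve. all: by end_near. Qed.

(** Truncated binomial series of (1 - x)^(-1/2). *)
Definition cbin_sum n x : R := \sum_(k < n) cbin k * x ^+ k.

(** By [cbin_conv] the coefficients of the squared truncation equal 1 below degree n, and beyond it
    they keep only some of the nonnegative terms of a sum equal to 1. *)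
Lemma cbin_sum_sqr n x : 0 <= x -> 
  \sum_(k < n) x ^+ k <= cbin_sum n x ^+ 2 <= \sum_(k < n.*2) x ^+ k.
Proof.
move=> x0; pose p : {poly R} := \poly_(k < n) cbin k.
have pE : p.[x] = cbin_sum n x by rewrite horner_poly.
have sp : (size (p ^+ 2)%R <= n.*2)%N.
  rewrite expr2; apply: leq_trans (size_polyMleq _ _) _.
  by have := size_poly n cbin; rewrite -/p; lia.
rewrite -pE -horner_exp (horner_coef_wide _ sp).
have ge0 (m : nat) : 0 <= (p ^+ 2)`_m.
  rewrite expr2 coefM sumr_ge0// => i _; rewrite !coef_poly.
  by do 2 case: ifP => _; rewrite ?mulr0 ?mul0r// mulr_ge0// ltW// cbin_gt0.
have le1 (m : nat) : (p ^+ 2)`_m <= 1.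
  rewrite -(cbin_conv m) expr2 coefM ler_sum// => i _; rewrite !coef_poly.
  by do 2 case: ifP => _; rewrite ?mulr0 ?mul0r// mulr_ge0// ltW// cbin_gt0.
have eq1 (m : nat) : (m < n)%N -> (p ^+ 2)`_m = 1.
  move=> mn; rewrite -(cbin_conv m) expr2 coefM; apply: eq_bigr => i _.
  by rewrite !coef_poly !ifT//; have := ltn_ord i; lia.
apply/andP; split; last first.
  by apply: ler_sum => i _; rewrite ler_piMl// exprn_ge0.
rewrite -addnn big_split_ord /= -[X in X <= _]addr0 lerD//.
  by apply: ler_sum => i _; rewrite eq1// mul1r.
by apply: sumr_ge0 => i _; rewrite mulr_ge0// exprn_ge0.
Qed.

(** At x = cos^2 t the full series is 1 / sin t, so the product should be close to 1; the geometric
    sums of [cbin_sum_sqr] make this quantitative. *)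
Lemma cbin_sum_sin n t : 0 <= t <= pi / 2 ->
  1 - cos t ^+ (n.*2) <= cbin_sum n (cos t ^+ 2) * sin t <= 1.
Proof.
move=> tI; have /andP[c0 c1] := cos_pihalf_itv tI.
have s0 : 0 <= sin t.
  apply: sin_ge0_pi; case/andP: tI => -> /= h; have := @pi_gt0 R; lra.
set y := cos t ^+ 2; have y0 : 0 <= y by rewrite exprn_ge0.
have y1 : y <= 1 by rewrite exprn_ile1.
have /andP[h1 h2] := cbin_sum_sqr n y0.
have S0 : 0 <= cbin_sum n y.
  by apply: sumr_ge0 => i _; rewrite mulr_ge0 ?exprn_ge0// ltW// cbin_gt0.
have s2 : sin t ^+ 2 = 1 - y by rewrite sin2cos2.
have geo m : (1 - y) * (\sum_(k < m) y ^+ k) = 1 - y ^+ m.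
  by rewrite -opprB mulNr -subrX1 opprB.
have q0 : 0 <= cbin_sum n y * sin t by rewrite mulr_ge0.
have q2 : 1 - y ^+ n <= (cbin_sum n y * sin t) ^+ 2 <= 1.
  rewrite [(_ * sin t) ^+ 2]exprMn s2 mulrC -geo; apply/andP; split.
    by rewrite ler_wpM2l// subr_ge0.
  apply: (@le_trans _ _ (1 - y ^+ n.*2)).
    by rewrite -geo ler_wpM2l// subr_ge0.
  by rewrite lerBlDr lerDl exprn_ge0.
have -> : cos t ^+ n.*2 = y ^+ n by rewrite -mul2n exprM.
have z0 : 0 <= y ^+ n by rewrite exprn_ge0.
(* From 0 <= q and q^2 <= 1 follows q <= 1, hence q >= q^2 >= 1 - z without a square root. *)
move: (y ^+ n) (cbin_sum n y * sin t) q0 q2 z0 => z q q0 /andP[a b] z0.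
by apply/andP; split; nra.
Qed.

(** One factor of g_k^2 is (2/pi) W_(2k). Replacing W_(2k) by W_(2k+1) gives exactly 1/(2k+1), since
    g_k W_(2k+1) = 1/(2k+1); the differences W_(2k) - W_(2k+1) form the integral. *)
Lemma cbin2_sum_wallis n : \sum_(k < n) cbin2 k =
  2 / pi * (\sum_(k < n) (k.*2.+1%:R^-1 : R)
   + \int[mu]_(t in `[0, pi / 2]) (cbin_sum n (cos t ^+ 2) * (1 - cos t))).
Proof.
have p0 : (pi : R) != 0 by rewrite gt_eqF// pi_gt0.
have c (k : nat) : continuous (fun t : R => cos t ^+ k.*2 - cos t ^+ k.*2.+1).
  by prove_cont.
have c' (k : nat) : continuous (fun t : R => cbin k * (cos t ^+ k.*2 - cos t ^+ k.*2.+1)).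
  by prove_cont.
have -> : \int[mu]_(t in `[0, pi / 2]) (cbin_sum n (cos t ^+ 2) * (1 - cos t)) =
  \sum_(k < n) cbin k * (wallis k.*2 - wallis k.*2.+1).
  transitivity (\int[mu]_(t in `[0, pi / 2])
      \sum_(k < n) cbin k * (cos t ^+ k.*2 - cos t ^+ k.*2.+1)).
    apply: eq_Rintegral => t _; rewrite mulr_suml; apply: eq_bigr => k _.
    by rewrite -exprM mul2n exprS; ring.
  rewrite integral_sum_cont; last by move=> k; exact: c'.
  apply: eq_bigr => k _; rewrite integral_scale; last exact: c.
  by rewrite integral_sub; [|prove_cont..].
rewrite -big_split mulr_sumr; apply: eq_bigr => k _ /=.
rewrite wallis_even wallis_odd /cbin2.
have c0 : cbin k != 0 by rewrite gt_eqF// cbin_gt0.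
have := @natS_neq0 R k.*2; move: (k.*2.+1%:R) (cbin k) (pi : R) c0 p0 => x y z y0 z0 x0.
by field; rewrite x0 y0 z0.
Qed.

(** This is tan(t/2); the primitive -ln(1 + cos t) is visible in this form. *)
Definition tanhalf t : R := sin t / (1 + cos t).

Lemma cont_tanhalf t : 0 < 1 + cos t -> {for t, continuous tanhalf}.
Proof.
move=> t0; apply: (@continuousM _ _ sin (fun t : R => (1 + cos t)^-1)).
  exact: continuous_sin.
apply: continuousV; first by rewrite gt_eqF.
have H : continuous (fun t : R => 1 + cos t) by prove_cont.
exact: H.
Qed.

Lemma integral_tanhalf : \int[mu]_(t in `[0, pi / 2]) tanhalf t = ln 2.
Proof.
have pos t : 0 <= t <= pi / 2 -> 0 < 1 + cos t.
  by move=> /cos_pihalf_itv/andP[c0 _]; lra.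
have D t : 0 <= t <= pi / 2 -> is_derive t 1 (fun t => - ln (1 + cos t)) (tanhalf t).
  move=> /pos t0; apply: is_derive_eq.
    apply: (@D_opp _ (fun t => ln (1 + cos t))).
    apply: (@D_comp _ (fun t => 1 + cos t) (@ln R)).
    exact: is_derive1_ln.
  by rewrite /tanhalf; ring.
transitivity (- ln (1 + cos (pi / 2)) - - ln (1 + cos 0) : R); last first.
  by rewrite cos_pihalf cos0 addr0 ln1 oppr0 sub0r opprK.
apply: (@FTC_seg _ _ _ _ (fun t => - ln (1 + cos t))).
- exact: pihalf_gt0.
- apply: (@continuous_in_subspaceT _ _ `[0, pi / 2] tanhalf) => t.
  by rewrite inE/= in_itv/= => /pos; exact: cont_tanhalf.
- by move=> t /D[d _]; exact/differentiable_continuous/derivable1_diffP.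
- by move=> t /andP[t0 t1]; apply: D; rewrite !ltW.
Qed.

(** Since 1 - cos t = sin t tan(t/2), the integrand is tan(t/2) times a factor that lies between 1 -
    cos^(2n) t and 1 by [cbin_sum_sin]. As tan(t/2) <= 1 here, the error is at most W_(2n) = (pi/2)
    g_n, which tends to 0. *)
Lemma landau_remainder_cvg :
  \int[mu]_(t in `[0, pi / 2]) (cbin_sum n (cos t ^+ 2) * (1 - cos t)) @[n --> \oo]
    --> ln 2.
Proof.
have pos t : 0 <= t <= pi / 2 -> 0 < 1 + cos t.
  by move=> /cos_pihalf_itv/andP[c0 _]; lra.
have cT : mu.-integrable `[0, pi / 2] (EFin \o tanhalf).
  apply: continuous_compact_integrable; first exact: segment_compact.
  apply: (@continuous_in_subspaceT _ _ `[0, pi / 2] tanhalf) => t.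
  rewrite inE/= in_itv/= => /pos; exact: cont_tanhalf.
have cs n : continuous (fun t : R => cbin_sum n (cos t ^+ 2) * (1 - cos t)).
  apply: cont_mul; last by prove_cont.
  by apply: continuous_sumf => k; prove_cont.
have W n : mu.-integrable `[0, pi / 2] (EFin \o (fun t : R => cos t ^+ n.*2)).
  by apply: continuous_integrable; prove_cont.
have T01 t : 0 <= t <= pi / 2 -> 0 <= sin t <= 1 /\ 0 <= tanhalf t <= 1.
  move=> tI; have t0 := pos _ tI; have /andP[c0 _] := cos_pihalf_itv tI.
  have s0 : 0 <= sin t.
    by apply: sin_ge0_pi; case/andP: tI => -> /= h; have := @pi_gt0 R; lra.
  rewrite s0 sin_le1; split=> //; rewrite divr_ge0 ?(ltW t0)//=.
  by rewrite ler_pdivrMr// mul1r; have := @sin_le1 R t; lra.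
have E n t : 0 <= t <= pi / 2 -> cbin_sum n (cos t ^+ 2) * (1 - cos t) =
     cbin_sum n (cos t ^+ 2) * sin t * tanhalf t.
  move=> /pos t0; rewrite -mulrA; congr (_ * _).
  have S : sin t * sin t = (1 - cos t) * (1 + cos t).
    by rewrite -expr2 sin2cos2; ring.
  by rewrite /tanhalf mulrA S mulfK// gt_eqF.
have c2 : cbin n * (pi / 2) @[n --> \oo] --> (0 : R).
  by rewrite -(mul0r (pi / 2)); apply: cvgM; [exact: cbin_cvg0|exact: cvg_cst].
have cl : ln 2 - cbin n * (pi / 2) @[n --> \oo] --> (ln 2 : R).
  by rewrite -[X in _ --> X]subr0; apply: cvgB => //; exact: cvg_cst.
apply: (squeeze_cvgr _ cl (cvg_cst _)).
near=> n; apply/andP; split; last first.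
  rewrite -integral_tanhalf; apply: le_Rintegral => //.
    exact: continuous_integrable.
  move=> t /=; rewrite in_itv/= => tI; rewrite E//.
  have [_ /andP[T0 _]] := T01 _ tI; have /andP[_ h] := cbin_sum_sin n tI.
  by rewrite ler_piMl.
rewrite mulrC -wallis_even -integral_tanhalf /wallis -RintegralB//.
apply: le_Rintegral => //.
- have H := @integrableB _ _ _ mu `[0, pi / 2] (measurable_itv _) _ _ cT (W n).
  by apply: eq_integrable H.
- exact: continuous_integrable.
move=> t /=; rewrite in_itv/= => tI; rewrite E//.
have [_ /andP[T0 T1]] := T01 _ tI; have /andP[h _] := cbin_sum_sin n tI.
have /andP[c0 _] := cos_pihalf_itv tI.
have : 0 <= cos t ^+ n.*2 by rewrite exprn_ge0.
move: (cos t ^+ n.*2) h => z h z0; nra.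
Unshelve. all: by end_near. Qed.

Lemma landau_constants :
  \sum_(k < n) cbin2 k - ln n%:R / pi @[n --> \oo]
    --> (euler_gamma R + ln 16) / pi.
Proof.
have p0 : (pi : R) != 0 by rewrite gt_eqF// pi_gt0.
have -> : (euler_gamma R + ln 16) / pi = 2 / pi * (euler_gamma R / 2 + ln 2 + ln 2) :> R.
  have -> : 16 = 2 ^+ 4 :> R by ring.
  rewrite lnXn// -mulr_natl; move: (pi : R) p0 => P P0.
  by field.
have -> : (fun n => \sum_(k < n) cbin2 k - ln n%:R / pi) = (fun n => 2 / pi *
    ((\sum_(k < n) (k.*2.+1%:R^-1 : R) - ln n%:R / 2)
   + \int[mu]_(t in `[0, pi / 2]) (cbin_sum n (cos t ^+ 2) * (1 - cos t)))).
  apply/funext => n; rewrite cbin2_sum_wallis; move: (pi : R) p0 => P P0.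
  by field.
apply: cvgM; first exact: cvg_cst.
by apply: cvgD; [exact: odd_harm_cvg|exact: landau_remainder_cvg].
Qed.

(** Partial fractions: 1/(xy) = (1/x + 1/y)/(x + y), where x + y = n + 1 throughout. *)
Lemma inv_conv n : \sum_(k < n) (k.+1%:R^-1 * (n - k)%:R^-1) = 2 * harm n / n.+1%:R :> R.
Proof.
transitivity (\sum_(k < n) ((k.+1%:R^-1 + (n - k)%:R^-1) / n.+1%:R : R)).
  apply: eq_bigr => -[k /= kn] _.
  have [j ->] : exists j, n = (k + j.+1)%N by exists (n - k.+1)%N; lia.
  have -> : (k + j.+1 - k = j.+1)%N by lia.
  have -> : (k + j.+1).+1%:R = k.+1%:R + j.+1%:R :> R by rewrite -natrD; congr _%:R; lia.
  have h1 : 0 < k.+1%:R :> R by []. have h2 : 0 < j.+1%:R :> R by [].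
  move: (k.+1%:R) (j.+1%:R) h1 h2 => x y x0 y0.
  by field; rewrite !gt_eqF// addr_gt0.
rewrite -mulr_suml big_split /=; congr (_ / _).
have -> : \sum_(k < n) ((n - k)%:R^-1 : R) = harm n.
  rewrite /harm big_add1 /= big_mkord (reindex_inj rev_ord_inj) /=.
  by apply: eq_bigr => k _; congr (_%:R^-1); have := ltn_ord k; lia.
by rewrite /harm big_add1 /= big_mkord; ring.
Qed.

Lemma harm_div_cvg0 : harm n / n.+1%:R @[n --> \oo] --> (0 : R).
Proof.
have H := @cesaro R (fun n => n.+1%:R^-1) 0 cvg_inv_nat.
have H1 : harm n.+1 / n.+1%:R @[n --> \oo] --> (0 : R).
  apply: cvg_trans H; apply: near_eq_cvg; near=> n.
  rewrite /arithmetic_mean /series /= mulrC; congr (_ * _).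
  by rewrite /harm big_add1.
apply: (squeeze_cvgr _ (cvg_cst 0) H1); near=> n.
have h0 : 0 <= harm n by rewrite /harm sumr_ge0.
rewrite divr_ge0//= ler_wpM2r ?invr_ge0// harmS lerDl.
by rewrite invr_ge0.
Unshelve. all: by end_near. Qed.

(** Writing n = k + (n - k) and using symmetry, n times the convolution is twice the sum of k g_k^2
    g_(n-k)^2. Replacing k g_k^2 by 1/pi yields Landau's constants; the defects [e] contribute a
    convolution of order log n / n. *)
Lemma cbin2_conv_cvg :
  n%:R * (\sum_(k < n.+1) cbin2 k * cbin2 (n - k)) - 2 / pi ^+ 2 * ln n%:R
    @[n --> \oo] --> 2 / pi ^+ 2 * (euler_gamma R + ln 16).
Proof.
have p0 : 0 < pi :> R := pi_gt0 R.
pose e k : R := pi^-1 - k.+1%:R * cbin2 k.+1.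
have e0 k : 0 <= e k by rewrite subr_ge0 cbin2_ub.
(* [cbin2_lb] even gives e k <= 1/(pi (2k+3)); the weaker bound is the one that [inv_conv] can
   sum. *)
have e1 k : e k <= k.+1%:R^-1.
  have := cbin2_lb k.+1; have k0 : 0 < k.+1%:R :> R by [].
  have -> : k.+1.*2.+1%:R = 2 * k.+1%:R + 1 :> R by rewrite nat2p1.
  have q0 : 0 < pi * (2 * k.+1%:R + 1) :> R by rewrite mulr_gt0// addr_gt0// mulr_gt0.
  rewrite ler_pdivrMr//.
  rewrite /e; move: (cbin2 k.+1) (cbin2_ge0 k.+1) (k.+1%:R) k0 => c c0 x x0 H.
  rewrite -(ler_pM2r p0) mulrBl mulVf ?gt_eqF// -(ler_pM2l x0) mulrA divff ?gt_eqF// mul1r.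
  have := @pi_ge2 R; nra.
have conv n : n%:R * (\sum_(k < n.+1) cbin2 k * cbin2 (n - k)) =
    2 / pi * (\sum_(k < n) cbin2 k) - 2 * (\sum_(k < n) e k * cbin2 (n.-1 - k)).
  have E1 : n%:R * (\sum_(k < n.+1) cbin2 k * cbin2 (n - k)) =
      2 * \sum_(k < n.+1) k%:R * cbin2 k * cbin2 (n - k).
    have -> : n%:R * (\sum_(k < n.+1) cbin2 k * cbin2 (n - k)) =
      \sum_(k < n.+1) k%:R * cbin2 k * cbin2 (n - k)
      + \sum_(k < n.+1) (n - k)%:R * cbin2 k * cbin2 (n - k).
      rewrite -big_split mulr_sumr; apply: eq_bigr => k _ /=.
      by rewrite natrB -1?ltnS//; ring.
    rewrite [X in _ + X](reindex_inj rev_ord_inj) /= mulr2n mulrDl !mul1r.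
    congr (_ + _); apply: eq_bigr => k _.
    rewrite subSS subKn -1?ltnS//; ring.
  rewrite {}E1 big_ord_recl /= !mul0r add0r.
  have -> : 2 / pi * \sum_(k < n) cbin2 k = 2 * \sum_(k < n) pi^-1 * cbin2 (n.-1 - k).
    rewrite -mulr_sumr mulrA; congr (_ * _); rewrite (reindex_inj rev_ord_inj) /=.
    by apply: eq_bigr => k _; congr cbin2; have := ltn_ord k; lia.
  rewrite -mulrBr -sumrB; congr (_ * _); apply: eq_bigr => k _.
  rewrite /bump /= add1n /e.
  have -> : (n - k.+1 = n.-1 - k)%N by have := ltn_ord k; lia.
  by ring.
have err : 2 * (\sum_(k < n) e k * cbin2 (n.-1 - k)) @[n --> \oo] --> (0 : R).
  have h4 : 4 * (harm n / n.+1%:R) @[n --> \oo] --> (0 : R).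
    by rewrite -(mulr0 4); apply: cvgM; [exact: cvg_cst|exact: harm_div_cvg0].
  apply: (squeeze_cvgr _ (cvg_cst 0) h4); near=> n.
  rewrite mulr_ge0 ?sumr_ge0// => [|k _]; last by rewrite mulr_ge0// cbin2_ge0.
  have -> : 4 * (harm n / n.+1%:R) = 2 * (2 * harm n / n.+1%:R) by ring.
  rewrite ler_pM2l// -inv_conv /=; apply: ler_sum => k _.
  apply: ler_pM => //; first exact: cbin2_ge0.
  have -> : (n - k = (n.-1 - k).+1)%N by have := ltn_ord k; lia.
  exact: cbin2_le.
have -> : (fun n => n%:R * (\sum_(k < n.+1) cbin2 k * cbin2 (n - k))
     - 2 / pi ^+ 2 * ln n%:R) =
  (fun n => 2 / pi * (\sum_(k < n) cbin2 k - ln n%:R / pi)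
     - 2 * (\sum_(k < n) e k * cbin2 (n.-1 - k))).
  apply/funext => n; rewrite conv; move: (pi : R) p0 => P P0.
  by field; rewrite gt_eqF.
have -> : 2 / pi ^+ 2 * (euler_gamma R + ln 16) =
   2 / pi * ((euler_gamma R + ln 16) / pi) - 0 :> R.
  by move: (pi : R) p0 => P P0; field; rewrite gt_eqF.
apply: cvgB err; apply: cvgM; [exact: cvg_cst|exact: landau_constants].
Unshelve. all: by end_near. Qed.

End Landau.

(** * Weak convergence to the arcsine law *)

Section Weierstrass.
Context {R : realType}.
Implicit Types (f : R -> R) (x y : R) (phi psi : nat -> R).

Lemma continuous_bounded_seg f (a b : R) : a <= b -> continuous f ->
  exists2 M : R, 0 < M & forall x, a <= x <= b -> `|f x| <= M.
Proof.
move=> ab cf; have cn : continuous (fun x => `|f x|).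
  by apply: cont_comp cf _; exact: norm_continuous.
have [c _ cM] := EVT_max ab (continuous_subspaceT cn).
exists (`|f c| + 1); first by rewrite ltr_wpDl.
by move=> x xab; apply: le_trans (cM x _) _; rewrite ?in_itv// lerDl.
Qed.

Lemma quadratic_modulus f (a b e : R) : a <= b -> 0 < e -> continuous f ->
  exists K, forall x y, a <= x <= b -> a <= y <= b ->
    `|f x - f y| <= e + K * (x - y) ^+ 2.
Proof.
move=> ab e0 cf; have [M M0 fM] := continuous_bounded_seg ab cf.
have /compact_near_coveringP H := @segment_compact R a b.
(* Compactness enters as near-covering along K -> +oo, which makes one K serve every x. *)
have [|K [_ HK]] := H R +oo%R (fun K x => a <= x <= b -> forall y, a <= y <= b ->
    `|f x - f y| <= e + K * (x - y) ^+ 2) _; last first.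
  exists (K + 1) => x y xab yab.
  by apply: (HK (K + 1)) => //=; rewrite ?ltrDl// in_itv.
move=> x _.
have e2 : 0 < e / 2 by rewrite divr_gt0.
have /cvgrPdist_lt /(_ _ e2) := cf x.
rewrite -nbhs_nearE => /nbhs_ballP [d /= d0 dP].
have d2 : 0 < d / 2 by rewrite divr_gt0.
exists (ball x (d / 2), [set K | 2 * M / (d / 2) ^+ 2 < K]).
  split; first exact: nbhsx_ballx.
  by apply: nbhs_pinfty_gt; exact: num_real.
move=> [x' K] /= [xx' KM] x'ab y yab.
have K0 : 0 <= K by apply: le_trans (ltW KM); rewrite divr_ge0 ?exprn_ge0// ?mulr_ge0// ltW.
have [yx|yx] := ltP `|x - y| d.
  have h1 : `|f x - f x'| < e / 2.
    by apply: dP => /=; apply: lt_trans xx' _; lra.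
  have h2 : `|f x - f y| < e / 2 by exact: dP.
  have -> : f x' - f y = (f x - f y) - (f x - f x') by ring.
  apply: le_trans (ler_normB _ _) _.
  by rewrite (@le_trans _ _ e)//; [lra|rewrite lerDl mulr_ge0// sqr_ge0].
have h : d / 2 <= `|x' - y|.
  move: xx'; rewrite /ball/= => xx'; have := ler_distD x' x y; lra.
have h2 : (d / 2) ^+ 2 <= (x' - y) ^+ 2.
  by rewrite -[X in _ <= X]real_normK ?num_real// lerXn2r ?nnegrE// ltW.
apply: (@le_trans _ _ (2 * M)).
  by apply: le_trans (ler_normB _ _) _; have := fM _ x'ab; have := fM _ yab; lra.
have dd : 0 < (d / 2) ^+ 2 by rewrite exprn_gt0.
have : 2 * M <= K * (x' - y) ^+ 2.
  apply: (@le_trans _ _ (K * (d / 2) ^+ 2)); first by rewrite -ler_pdivrMr// ltW.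
  by rewrite ler_wpM2l.
lra.
Qed.

(* The expectation of [phi] at a binomial variable with [n] trials and success
   probability [(1 + x) / 2], as a polynomial in [x]. *)
Fixpoint bernstein n phi : {poly R} :=
  if n is m.+1 then
    2^-1 *: ((1 - 'X) * bernstein m phi + (1 + 'X) * bernstein m (phi \o S))
  else (phi 0%N)%:P.

Lemma bernstein0E phi x : (bernstein 0 phi).[x] = phi 0%N.
Proof. by rewrite /= hornerC. Qed.

Lemma bernsteinSE n phi x : (bernstein n.+1 phi).[x] =
  ((1 - x) * (bernstein n phi).[x] + (1 + x) * (bernstein n (phi \o S)).[x]) / 2.
Proof. by rewrite /= !hornerE mulrC. Qed.

Lemma bernstein_le n phi psi x : -1 <= x <= 1 ->
  (forall k, (k <= n)%N -> phi k <= psi k) ->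
  (bernstein n phi).[x] <= (bernstein n psi).[x].
Proof.
move=> /andP[x0 x1]; elim: n phi psi => [|n IH] phi psi le_pp.
  by rewrite !bernstein0E le_pp.
rewrite !bernsteinSE ler_pM2r ?invr_gt0// lerD// ler_wpM2l//; try lra.
  by apply: IH => k kn; apply: le_pp; exact: leqW.
by apply: IH => k kn; exact: le_pp.
Qed.

Lemma bernstein_lin n phi psi (k : R) x :
  (bernstein n (fun i => phi i + k * psi i)).[x] =
  (bernstein n phi).[x] + k * (bernstein n psi).[x].
Proof.
elim: n phi psi => [|n IH] phi psi; first by rewrite !bernstein0E.
rewrite !bernsteinSE IH.
by have := IH (phi \o S) (psi \o S); rewrite /comp => ->; ring.
Qed.

Lemma bernstein_cst n (k : R) x : (bernstein n (fun=> k)).[x] = k.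
Proof.
elim: n => [|n IH]; first by rewrite bernstein0E.
by rewrite bernsteinSE /comp IH; field.
Qed.

(** Squared mean plus variance of a + bN, for N binomial of mean n(1 + x)/2 and variance n(1 -
    x^2)/4. The offset a must be general because one more success shifts it by b. *)
Lemma bernstein_sqr n (a b x : R) :
  (bernstein n (fun k => (a + b * k%:R) ^+ 2)).[x] =
  (a + b * n%:R * (1 + x) / 2) ^+ 2 + b ^+ 2 * n%:R * (1 - x ^+ 2) / 4.
Proof.
elim: n a => [|n IH] a; first by rewrite bernstein0E; ring.
rewrite bernsteinSE IH.
have -> : (fun k : nat => (a + b * k%:R) ^+ 2) \o S =
          (fun k : nat => (a + b + b * k%:R) ^+ 2).
  by apply/funext => k; rewrite /= natD1; ring.
by rewrite IH natD1; field.
Qed.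

Lemma weierstrass f (e : R) : 0 < e -> continuous f ->
  exists p : {poly R}, forall x, -1 <= x <= 1 -> `|f x - p.[x]| <= e.
Proof.
move=> e0 cf; have e2 : 0 < e / 2 by rewrite divr_gt0.
have ab : -1 <= 1 :> R by lra.
have [K HK] := quadratic_modulus ab e2 cf.
(* The nodes below have mean x and variance (1 - x^2)/n <= 1/n, so this n makes the quadratic part
   of the modulus cost at most e/2. *)
pose n := (Num.truncn (2 * `|K| / e)).+1.
have nK : `|K| / n%:R <= e / 2.
  have := truncnS_gt (2 * `|K| / e); rewrite -/n => h.
  rewrite ler_pdivrMr// -ler_pdivrMl//.
  by apply: ltW; apply: le_lt_trans h; rewrite le_eqVlt; apply/orP; left; apply/eqP; field; rewrite gt_eqF.
have n0 : 0 < n%:R :> R by [].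
pose node (k : nat) : R := 2 * k%:R / n%:R - 1.
have nodeI k : (k <= n)%N -> -1 <= node k <= 1.
  move=> kn; rewrite /node.
  have k0 : 0 <= k%:R / n%:R :> R by rewrite divr_ge0.
  have k1 : k%:R / n%:R <= 1 :> R by rewrite ler_pdivrMr// mul1r ler_nat.
  by rewrite -mulrA; apply/andP; split; lra.
exists (bernstein n (f \o node)) => x xI.
have V : (bernstein n (fun k => (node k - x) ^+ 2)).[x] = (1 - x ^+ 2) / n%:R.
  have -> : (fun k => (node k - x) ^+ 2) =
            (fun k : nat => ((- 1 - x) + 2 / n%:R * k%:R) ^+ 2).
    by apply/funext => k; rewrite /node; congr (_ ^+ 2); ring.
  by rewrite bernstein_sqr; move: (n%:R) n0 => N N0; field; rewrite gt_eqF.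
have V1 : `|K| * (bernstein n (fun k => (node k - x) ^+ 2)).[x] <= e / 2.
  apply: le_trans nK; rewrite V mulrA ler_pM2r ?invr_gt0// ler_piMr//.
  by rewrite gerBl sqr_ge0.
have HK' k : (k <= n)%N -> `|f (node k) - f x| <= e / 2 + `|K| * (node k - x) ^+ 2.
  move=> /nodeI kI; apply: le_trans (HK _ _ kI xI) _.
  by rewrite lerD2l ler_wpM2r ?sqr_ge0// ler_norm.
have B1 : (bernstein n (f \o node)).[x] <=
    (bernstein n (fun k => (f x + e / 2) + `|K| * (node k - x) ^+ 2)).[x].
  apply: bernstein_le => // k /HK'; rewrite ler_norml => /andP[_ /=].
  by lra.
have B2 : (bernstein n (fun k => (f x - e / 2) + (- `|K|) * (node k - x) ^+ 2)).[x]
    <= (bernstein n (f \o node)).[x].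
  apply: bernstein_le => // k /HK'; rewrite ler_norml => /andP[/= + _].
  by lra.
move: B1 B2; rewrite !bernstein_lin !bernstein_cst => B1 B2.
by rewrite ler_norml; apply/andP; split; lra.
Qed.

End Weierstrass.

(** * Weak limit of the normalised squares of the Legendre polynomials *)

Section WeakConvergence.
Context {R : realType}.
Implicit Types (f q : R -> R) (x t : R).
Local Notation mu := (@lebesgue_measure R).

Definition arcsine (q : R -> R) : R := pi^-1 * \int[mu]_(t in `[0, pi]) q (cos t).

Lemma ratio_cvg (a b : R) : 0 < b -> (n%:R + a) / (n%:R + b) @[n --> \oo] --> (1 : R).
Proof.
move=> b0.
have H : 1 + (a - b) * (n%:R + b)^-1 @[n --> \oo] --> (1 : R).
  suff : 1 + (a - b) * (n%:R + b)^-1 @[n --> \oo] --> 1 + (a - b) * 0.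
    by rewrite mulr0 addr0.
  apply: cvgD; first exact: cvg_cst.
  apply: cvgM; first exact: cvg_cst.
  apply/gtr0_cvgV0; first by near=> n; rewrite ltr_wpDl.
  apply/cvgryPge => A; near=> n; rewrite -lerBlDr.
  by near: n; exact: nbhs_infty_ger.
apply: cvg_trans H; apply: near_eq_cvg; near=> n.
have : 0 < n%:R + b by rewrite ltr_wpDl.
by move: (n%:R) => N N0; field; rewrite gt_eqF.
Unshelve. all: by end_near. Qed.

(** Asymptotically the matrix entry of multiplication by x^m between the normalised P_(n+c) and
    P_(n+j). Off-diagonal entries are included because Bonnet's recursion moves the index. *)
Let mixed_moment m n c j : R :=
  (n.*2.+1)%:R / 2 * poly_int ('X^m * legendre (n + c) * legendre (n + j)).

Let limit_moment m (c j : nat) : R :=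
  pi^-1 * \int[mu]_(t in `[0, pi]) (cos t ^+ m * cos ((c%:R - j%:R) * t)).

Lemma limit_moment0 c j : limit_moment 0 c j = (c == j)%:R.
Proof.
have p0 : (pi : R) != 0 by rewrite gt_eqF// pi_gt0.
rewrite /limit_moment; under eq_Rintegral do rewrite expr0 mul1r.
by rewrite integral_cos; case: eqP; rewrite ?mulVf ?mulr0.
Qed.

Lemma limit_momentS m c j : limit_moment m.+1 c j.+1 =
  2^-1 * limit_moment m c j.+2 + 2^-1 * limit_moment m c j.
Proof.
have cc k : continuous (fun t => cos t ^+ m * cos ((c%:R - k%:R) * t)).
  by prove_cont.
rewrite /limit_moment ![2^-1 * (_ * _)]mulrCA -mulrDr; congr (_ * _).
rewrite -!integral_scale// -integral_add; [|prove_cont..].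
apply: eq_Rintegral => t _.
have := @cos_prod R t ((c%:R - j.+1%:R) * t).
have -> : t + (c%:R - j.+1%:R) * t = (c%:R - j%:R) * t by rewrite natD1; ring.
have -> : t - (c%:R - j.+1%:R) * t = - ((c%:R - j.+2%:R) * t).
  by rewrite (natD1 j.+1); ring.
rewrite cosN => H; rewrite exprS -mulrA mulrCA H; by field.
Qed.

(** Induction on m: one factor x is moved onto P_(n+j). The coefficients of Bonnet's recursion tend
    to 1/2, and the limiting recursion is the one for cosines in [limit_momentS]. The bound m <= j
    leaves room for lowering j once per factor. *)
Lemma moment_cvg m c j : (m <= j)%N ->
  mixed_moment m n c j @[n --> \oo] --> limit_moment m c j.
Proof.
elim: m c j => [|m IH] c j mj.
  rewrite limit_moment0.
  have H : (n%:R + 2^-1) / (n%:R + (c%:R + 2^-1)) * (c == j)%:R @[n --> \oo]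
      --> ((c == j)%:R : R).
    rewrite -[X in _ --> X]mul1r; apply: cvgM; last exact: cvg_cst.
    by apply: ratio_cvg; rewrite ltr_wpDl.
  apply: cvg_trans H; apply: near_eq_cvg; near=> n.
  rewrite /mixed_moment expr0 mul1r; case: eqVneq => [<-|cj]; last first.
    by rewrite legendre_orth ?mulr0// eqn_add2l.
  rewrite legendre_norm mulr1 !nat2p1 natrD.
  have : 0 <= n%:R + c%:R :> R by rewrite -natrD.
  move: (n%:R) (c%:R) => N C NC.
  have h1 : N + (C + 2^-1) != 0 by rewrite gt_eqF// addrA ltr_wpDl.
  have h2 : 2 * (N + C) + 1 != 0 by rewrite gt_eqF// ltr_wpDl// mulr_ge0.
  by field; do ?[apply/andP; split]; apply: contra h2 => /eqP h; apply/eqP; lra.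
case: j mj => [//|j]; rewrite ltnS => mj; rewrite limit_momentS.
have step n : mixed_moment m.+1 n c j.+1 =
    2^-1 * ((n%:R + j.+2%:R) / (n%:R + (j%:R + 3 / 2))) * mixed_moment m n c j.+2
  + 2^-1 * ((n%:R + j.+1%:R) / (n%:R + (j%:R + 3 / 2))) * mixed_moment m n c j.
  have E : ((n + j).*2.+3)%:R * ('X^(m.+1) * legendre (n + c) * legendre (n + j.+1)) =
      (n + j).+2%:R * ('X^m * legendre (n + c) * legendre (n + j.+2))
    + (n + j).+1%:R * ('X^m * legendre (n + c) * legendre (n + j)) :> {poly R}.
    rewrite !addnS exprS.
    have := @legendreS R (n + j).
    move: (legendre (n + j)) (legendre (n + j).+1) (legendre (n + j).+2) => p0 p1 p2 h.
    transitivity ('X^m * legendre (n + c) * ((n + j).*2.+3%:R * 'X * p1)); first by ring.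
    have -> : (n + j).*2.+3%:R * 'X * p1 = (n + j).+2%:R * p2 + (n + j).+1%:R * p0.
      by rewrite h subrK.
    by ring.
  have := congr1 poly_int E; rewrite poly_intD !poly_intMn nat2p3.
  rewrite /mixed_moment -[(n + j).+2]addn2 -[(n + j).+1]addn1 -[j.+2]addn2 -[j.+1]addn1 !natrD.
  move: (poly_int _) (poly_int _) (poly_int _) => I1 I2 I3.
  have : 0 <= n%:R + j%:R :> R by rewrite -natrD.
  move: (n.*2.+1%:R / 2) (n%:R) (j%:R) => D N J NJ H.
  have h1 : 2 * (N + J) + 3 != 0 by rewrite gt_eqF// ltr_wpDl// mulr_ge0.
  have -> : I3 = ((N + J + 2) * I2 + (N + J + 1) * I1) / (2 * (N + J) + 3).
    by rewrite -H mulrC mulKf.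
  have h2 : 2 * N + (2 * J + 3) != 0 by apply: contra h1 => /eqP h; apply/eqP; lra.
  by field; do ?[apply/andP; split]; apply: contra h1 => /eqP h; apply/eqP; lra.
have c3 : 0 < j%:R + 3 / 2 :> R by rewrite ltr_wpDl.
rewrite (funext step).
apply: cvgD; (apply: cvgM; last by apply: IH; rewrite ?(leq_trans mj)// -addn2 leq_addr).
  by rewrite -[X in _ --> X]mulr1; apply: cvgM; [exact: cvg_cst|exact: ratio_cvg].
by rewrite -[X in _ --> X]mulr1; apply: cvgM; [exact: cvg_cst|exact: ratio_cvg].
Unshelve. all: by end_near. Qed.

Definition legendre_mean n q : R :=
  (n.*2.+1)%:R / 2 * \int[mu]_(x in `[-1, 1]) (q x * (legendre n).[x] ^+ 2).

Lemma legendre_meanX m : legendre_mean n (fun x => x ^+ m) @[n --> \oo] -->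
  arcsine (fun x => x ^+ m).
Proof.
(* After the shift P_n^2 becomes P_(n+m)^2, and c = j = m satisfies the side condition of
   [moment_cvg]. *)
rewrite -(cvg_shiftn m).
have -> : arcsine (fun x => x ^+ m) = 1 * limit_moment m m m.
  rewrite mul1r /arcsine /limit_moment; congr (_ * _).
  by apply: eq_Rintegral => t _; rewrite subrr mul0r cos0 mulr1.
have H : (n%:R + (m%:R + 2^-1)) / (n%:R + 2^-1) * mixed_moment m n m m @[n --> \oo]
   --> 1 * limit_moment m m m.
  by apply: cvgM; [exact: ratio_cvg|exact: moment_cvg].
apply: cvg_trans H; apply: near_eq_cvg; near=> n.
rewrite /legendre_mean /mixed_moment mulrA /=.
have -> : \int[mu]_(x in `[-1, 1]) (x ^+ m * (legendre (n + m)).[x] ^+ 2) =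
    poly_int ('X^m * legendre (n + m) * legendre (n + m)).
  apply: eq_Rintegral => x _; rewrite !hornerM hornerXn; ring.
congr (_ * _); rewrite !nat2p1 natrD.
have : 0 <= n%:R :> R by [].
move: (n%:R) (m%:R) => N M N0.
have h : N + 2^-1 != 0 by rewrite gt_eqF// ltr_wpDl.
by field; apply: contra h => /eqP h; apply/eqP; lra.
Unshelve. all: by end_near. Qed.

Lemma arcsine_lin f q (k : R) : continuous f -> continuous q ->
  arcsine (fun x => f x + k * q x) = arcsine f + k * arcsine q.
Proof.
move=> cf cq; rewrite /arcsine mulrCA -mulrDr; congr (_ * _).
have c1 : continuous (fun t => f (cos t)) by apply: cont_comp cf; exact: continuous_cos.
have c2 : continuous (fun t => q (cos t)) by apply: cont_comp cq; exact: continuous_cos.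
by rewrite -integral_scale// -integral_add//; prove_cont.
Qed.

Lemma legendre_mean_lin n f q (k : R) : continuous f -> continuous q ->
  legendre_mean n (fun x => f x + k * q x) = legendre_mean n f + k * legendre_mean n q.
Proof.
move=> cf cq; rewrite /legendre_mean mulrCA -mulrDr; congr (_ * _).
rewrite -integral_scale; last by prove_cont.
rewrite -integral_add; [|prove_cont..].
by apply: eq_Rintegral => x _; ring.
Qed.

Lemma legendre_mean_poly (p : {poly R}) :
  legendre_mean n (horner p) @[n --> \oo] --> arcsine (horner p).
Proof.
have -> : horner p = (fun x => \sum_(i < size p) p`_i * x ^+ i).
  by apply/funext => x; rewrite horner_coef.
elim: (size p) => [|s IH].
  have E n : legendre_mean n (fun x => \sum_(i < 0) p`_i * x ^+ i) = 0.
    rewrite /legendre_mean; under eq_Rintegral do rewrite big_ord0 mul0r.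
    by rewrite Rintegral_cst// mul0r mulr0.
  under eq_cvg do rewrite E.
  rewrite /arcsine; under eq_Rintegral do rewrite big_ord0.
  by rewrite Rintegral_cst// mul0r mulr0; exact: cvg_cst.
have -> : (fun x => \sum_(i < s.+1) p`_i * x ^+ i) =
    (fun x => \sum_(i < s) p`_i * x ^+ i + p`_s * x ^+ s).
  by apply/funext => x; rewrite big_ord_recr.
have c1 : continuous (fun x => \sum_(i < s) p`_i * x ^+ i).
  by apply: continuous_sumf => i; prove_cont.
have c2 : continuous (fun x : R => x ^+ s) by prove_cont.
under eq_cvg do rewrite legendre_mean_lin//.
rewrite arcsine_lin//; apply: cvgD => //.
by apply: cvgM; [exact: cvg_cst|exact: legendre_meanX].
Qed.

Lemma legendre_mean_norm_le n q (e : R) : 0 <= e -> continuous q ->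
  (forall x, -1 <= x <= 1 -> `|q x| <= e) -> `|legendre_mean n q| <= e.
Proof.
move=> e0 cq qe; rewrite /legendre_mean normrM ger0_norm; last by rewrite divr_ge0.
rewrite mulrC -ler_pdivlMr ?divr_gt0//.
apply: le_trans; first by apply: le_normr_Rintegral => //; apply: continuous_integrable; prove_cont.
apply: (@le_trans _ _ (\int[mu]_(x in `[-1, 1]) (e * (legendre n).[x] ^+ 2))).
  apply: integral_le => [||x /qe xe].
  - by apply: cont_comp; [prove_cont|exact: norm_continuous].
  - by prove_cont.
  - by rewrite normrM [X in _ * X]ger0_norm ?sqr_ge0// ler_wpM2r// sqr_ge0.
rewrite integral_scale; last by prove_cont.
have -> : \int[mu]_(x in `[-1, 1]) ((legendre n).[x] ^+ 2) =
    poly_int (legendre n * legendre n).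
  by apply: eq_Rintegral => x _; rewrite hornerM expr2.
by rewrite legendre_norm invf_div.
Qed.

Lemma arcsine_norm_le q (e : R) : 0 <= e -> continuous q ->
  (forall x, -1 <= x <= 1 -> `|q x| <= e) -> `|arcsine q| <= e.
Proof.
move=> e0 cq qe; have p0 := @pi_gt0 R.
rewrite /arcsine normrM (@ger0_norm _ pi^-1) ?invr_ge0 ?(ltW p0)// ler_pdivrMl// mulrC.
have := @integral_norm_le R 0 pi (fun t => q (cos t)) e (ltW p0).
rewrite subr0; apply; first by apply: cont_comp cq; exact: continuous_cos.
by move=> t _; apply: qe; rewrite cos_geN1 cos_le1.
Qed.

(** Both functionals are contractions for the supremum norm on [-1, 1], so convergence on
    polynomials extends to continuous functions by [weierstrass]. *)
Lemma legendre_mean_cvg q : continuous q ->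
  legendre_mean n q @[n --> \oo] --> arcsine q.
Proof.
move=> cq; apply/cvgrPdist_le => e e0.
have e3 : 0 < e / 3 by rewrite divr_gt0.
have [p Hp] := weierstrass e3 cq.
have cp := @continuous_poly R p.
have /cvgrPdist_le /(_ _ e3) := @legendre_mean_poly p.
have cd : continuous (fun x => q x + -1 * p.[x]) by prove_cont.
have Hd x : -1 <= x <= 1 -> `|q x + -1 * p.[x]| <= e / 3.
  by move=> /Hp; rewrite mulN1r.
have := arcsine_norm_le (ltW e3) cd Hd; rewrite arcsine_lin// mulN1r.
move: (arcsine q) (arcsine (horner p)) => x y xy.
apply: filterS => n /=.
have := legendre_mean_norm_le n (ltW e3) cd Hd; rewrite legendre_mean_lin// mulN1r.
move: (legendre_mean n q) (legendre_mean n (horner p)) => u v uv yv.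
have -> : x - u = (x - y) + (y - v) - (u - v) by ring.
apply: le_trans (ler_normB _ _) _.
have h : `|(x - y) + (y - v)| <= e / 3 + e / 3 by apply: le_trans (ler_normD _ _) _; rewrite lerD.
by apply: le_trans (lerD h uv) _; lra.
Qed.

End WeakConvergence.

(** * The substitution x = cos t in arcsine means *)

Section ArcsineSubstitution.
Context {R : realType}.
Implicit Types (q : R -> R) (x t : R).
Local Notation mu := (@lebesgue_measure R).

Lemma acos_lt_cos (e x : R) : 0 <= e <= pi -> cos e < x -> x <= 1 -> acos x < e.
Proof.
move=> eI ex x1; have xI : -1 <= x <= 1.
  by rewrite x1 andbT (le_trans (cos_geN1 e))// ltW.
rewrite -(@ltr_cos R) ?in_itv//=; last by rewrite acos_ge0// acos_lepi.
by rewrite acosK// in_itv.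
Qed.

Lemma acos_gt_cos (e x : R) : 0 <= e <= pi -> x < cos e -> -1 <= x -> e < acos x.
Proof.
move=> eI ex x1; have xI : -1 <= x <= 1.
  by rewrite x1/= (le_trans (ltW ex))// cos_le1.
rewrite -(@ltr_cos R) ?in_itv//=; last by rewrite acos_ge0// acos_lepi.
by rewrite acosK// in_itv.
Qed.

Lemma acos_cvg_right : acos x @[x --> (1 : R)^'-] --> (0 : R).
Proof.
apply/cvgrPdist_lt => e e0.
(* Capped at pi so that monotonicity of cos on [0, pi] applies. *)
pose d := Num.min e (pi : R).
have d0 : 0 < d by rewrite lt_min e0 pi_gt0.
have dpi : 0 <= d <= pi by rewrite ltW// ge_min lexx orbT.
have c1 : cos d < 1.
  have : cos d < cos 0 by rewrite ltr_cos ?in_itv//= lexx pi_ge0.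
  by rewrite cos0.
near=> x.
have x1 : x < 1 by near: x; exact: nbhs_left_lt.
have xd : cos d < x by near: x; exact: nbhs_left_gt.
have xI : -1 <= x <= 1 by rewrite (ltW x1) andbT (le_trans (cos_geN1 d))// ltW.
rewrite sub0r normrN ger0_norm ?acos_ge0//.
have := acos_lt_cos dpi xd (ltW x1).
by move/lt_le_trans; apply; rewrite ge_min lexx.
Unshelve. all: by end_near. Qed.

Lemma acos_cvg_left : acos x @[x --> (-1 : R)^'+] --> (pi : R).
Proof.
apply/cvgrPdist_lt => e e0.
pose d := Num.max (pi - e) (0 : R).
have p0 := @pi_gt0 R.
have d0 : d < pi by rewrite gt_max p0 andbT; lra.
have dpi : 0 <= d <= pi by rewrite (ltW d0) andbT le_max lexx orbT.
have c1 : -1 < cos d.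
  have : cos pi < cos d by rewrite ltr_cos ?in_itv//= lexx pi_ge0.
  by rewrite cospi.
near=> x.
have x1 : -1 < x by near: x; exact: nbhs_right_gt.
have xd : x < cos d by near: x; exact: nbhs_right_lt.
have xI : -1 <= x <= 1 by rewrite ltW//= (le_trans (ltW xd))// cos_le1.
rewrite ger0_norm ?subr_ge0 ?acos_lepi//.
have := acos_gt_cos dpi xd (ltW x1).
have : pi - e <= d by rewrite le_max lexx.
lra.
Unshelve. all: by end_near. Qed.

Lemma sqrt_1mx2_gt0 x : -1 < x < 1 -> 0 < Num.sqrt (1 - x ^+ 2).
Proof. by move=> xI; rewrite sqrtr_gt0; nra. Qed.

Lemma continuous_arcsine_density q : continuous q ->
  {in `]-1, 1[, continuous (fun x => q x / Num.sqrt (1 - x ^+ 2))}.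
Proof.
move=> cq x; rewrite in_itv/= => xI.
apply: (@continuousM _ _ q (fun x : R => (Num.sqrt (1 - x ^+ 2))^-1)); first exact: cq.
apply: (@continuousV _ _ (fun x : R => Num.sqrt (1 - x ^+ 2))); first by rewrite gt_eqF// sqrt_1mx2_gt0.
have H : continuous (fun x : R => Num.sqrt (1 - x ^+ 2)) by prove_cont.
exact: H.
Qed.

(** The primitive -acos has finite one-sided limits at both ends and the density is nonnegative. *)
Lemma arcsine_density_integrable :
  mu.-integrable `]-1, 1[ (EFin \o (fun x : R => (Num.sqrt (1 - x ^+ 2))^-1)).
Proof.
have D (x : R) : -1 < x < 1 ->
    is_derive x 1 (fun x => - acos x) (Num.sqrt (1 - x ^+ 2))^-1.
  by move=> xI; rewrite -[X in is_derive _ _ _ X]opprK; apply: D_opp; exact: is_derive1_acos.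
apply: (FTC_oo_ge0_integrable _ D (cvgN acos_cvg_right) (cvgN acos_cvg_left)).
  move=> x xI; have := @continuous_arcsine_density (fun=> 1) (@cont_cst R 1) x xI.
  by rewrite (_ : (fun x => _ / _) = (fun x : R => (Num.sqrt (1 - x ^+ 2))^-1))//;
    apply/funext => y; rewrite div1r.
by move=> x _; rewrite invr_ge0 sqrtr_ge0.
Qed.

Lemma arcsine_weight_integrable q : continuous q ->
  mu.-integrable `]-1, 1[ (EFin \o (fun x => q x / Num.sqrt (1 - x ^+ 2))).
Proof.
move=> cq; have [|M M0 qM] := continuous_bounded_seg (a := -1) (b := 1) _ cq; first lra.
have mI : measurable (`]-1, 1[ : set (measurableTypeR R)) by exact: measurable_itv.
have H := integrableZl mI M arcsine_density_integrable.
apply: le_integrable H => //.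
  apply/measurable_EFinP; apply: open_continuous_measurable_fun => // x.
  by rewrite inE => xI; exact: continuous_arcsine_density.
move=> x /=; rewrite in_itv/= => /andP[x0 x1].
rewrite lee_fin !normrM ler_wpM2r//.
by rewrite [X in _ <= X]ger0_norm ?(ltW M0)// qM// !ltW.
Qed.

Lemma arcsine_meanE q : continuous q -> arcsine_mean q = arcsine q.
Proof.
move=> cq; rewrite /arcsine_mean /arcsine; congr (_ * _).
have cqc : continuous (fun t => q (cos t)) by apply: cont_comp cq; exact: continuous_cos.
have p0 := @pi_gt0 R.
(* The base point -1, and pi + 1 as upper end below, put [0, pi] in the interior, where Q has a
   two-sided derivative even at 0 and pi. Then -Q(acos x) is the primitive sought. *)
pose Q (t : R) := \int[mu]_(u in `[-1, t]) q (cos u).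
have DQ (t : R) : 0 <= t <= pi -> is_derive t 1 Q (q (cos t)).
  move=> /andP[t0 t1].
  have t2 : t < pi + 1 by lra.
  have t3 : -1 < t by lra.
  have [d dE] := @continuous_FTC1_closed R (fun u => q (cos u)) (-1) t (pi + 1) t2
    (continuous_integrable _ _ cqc) t3 (cqc t).
  by apply: (DeriveDef d); rewrite -derive1E; exact: dE.
have cQ (t : R) : 0 <= t <= pi -> {for t, continuous Q}.
  by move=> /DQ[d _]; exact/differentiable_continuous/derivable1_diffP.
transitivity (- Q 0 - - Q pi).
  apply: (@FTC_oo R _ (fun x => - Q (acos x))).
  - exact: continuous_arcsine_density.
  - move=> x /andP[x0 x1].
    have xI : -1 <= x <= 1 by rewrite !ltW.
    have aI : 0 <= acos x <= pi by rewrite acos_ge0//= acos_lepi.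
    have H := D_opp (D_comp (is_derive1_acos (introT andP (conj x0 x1))) (DQ _ aI)).
    by apply: is_derive_eq H _; rewrite acosK ?in_itv// mulrN opprK.
  - apply: cvgN; apply: continuous_cvg; last exact: acos_cvg_right.
    by apply: cQ; rewrite lexx ltW.
  - apply: cvgN; apply: continuous_cvg; last exact: acos_cvg_left.
    by apply: cQ; rewrite lexx ltW.
  - exact: arcsine_weight_integrable.
rewrite opprK addrC /Q.
rewrite (@Rintegral_itvB R (fun u => q (cos u)) (BLeft (-1)) (BRight pi) 0).
- by rewrite Rintegral_itv_obnd_cbnd//; apply: integrableS (continuous_integrable 0 pi cqc) => //; apply: subset_itvr; rewrite bnd_simp.
- exact: continuous_integrable.
- by rewrite bnd_simp; lra.
- by rewrite bnd_simp ltW.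
Qed.

End ArcsineSubstitution.

(** * Szego's recursion for real moments *)

Section CoefFunctional.
Context {K : comNzRingType}.
Implicit Types (F G : nat -> K) (p q : {poly K}) (k : K).

(** The linear functional with moments F. *)
Definition coef_fun F p : K := \sum_(i < size p) p`_i * F i.

Lemma coef_fun_wide n F p : (size p <= n)%N -> coef_fun F p = \sum_(i < n) p`_i * F i.
Proof.
move=> pn; rewrite /coef_fun (big_ord_widen _ (fun i => p`_i * F i) pn).
rewrite big_mkcond /=; apply: eq_bigr => i _.
by case: ltnP => // h; rewrite nth_default// mul0r.
Qed.

Lemma coef_funD F p q : coef_fun F (p + q) = coef_fun F p + coef_fun F q.
Proof.
pose n := maxn (size p) (size q).
rewrite !(@coef_fun_wide n) ?leq_maxl ?leq_maxr ?size_polyD//.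
by rewrite -big_split; apply: eq_bigr => i _ /=; rewrite coefD mulrDl.
Qed.

Lemma coef_funZ F k p : coef_fun F (k *: p) = k * coef_fun F p.
Proof.
rewrite !(@coef_fun_wide (size p)) ?size_scale_leq// mulr_sumr.
by apply: eq_bigr => i _; rewrite coefZ mulrA.
Qed.

Lemma coef_funB F p q : coef_fun F (p - q) = coef_fun F p - coef_fun F q.
Proof. by rewrite -scaleN1r coef_funD coef_funZ mulN1r. Qed.

Lemma coef_fun0 F : coef_fun F 0 = 0.
Proof. by rewrite /coef_fun size_poly0 big_ord0. Qed.

Lemma coef_funXl F p : coef_fun F ('X * p) = coef_fun (F \o S) p.
Proof.
rewrite (@coef_fun_wide (size p).+1); last first.
  by rewrite (leq_trans (size_polyMleq _ _))// size_polyX.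
rewrite big_ord_recl coefXM mul0r add0r; apply: eq_bigr => i _.
by rewrite coefXM.
Qed.

Lemma coef_funXn F n : coef_fun F 'X^n = F n.
Proof.
rewrite (@coef_fun_wide n.+1) ?size_polyXn// big_ord_recr /= coefXn eqxx mul1r.
by rewrite big1 ?add0r// => i _; rewrite coefXn ltn_eqF// mul0r.
Qed.

Lemma coef_fun_linF (F G : nat -> K) k p :
  coef_fun (fun i => F i + k * G i) p = coef_fun F p + k * coef_fun G p.
Proof.
by rewrite /coef_fun mulr_sumr -big_split; apply: eq_bigr => i _ /=; ring.
Qed.

(** For real coefficients this is the reversal p* of degree n, as [reverse_cpoly] confirms away from
    z = 0. *)
Definition reverse_poly n p : {poly K} := \poly_(i < n.+1) p`_(n - i).

Lemma coef_fun_reverse n F p : (size p <= n.+1)%N ->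
  coef_fun F (reverse_poly n p) = coef_fun (fun i => F (n - i)%N) p.
Proof.
move=> pn; rewrite (@coef_fun_wide n.+1) ?size_poly// (@coef_fun_wide n.+1)//.
rewrite (reindex_inj rev_ord_inj) /=; apply: eq_bigr => i _.
by rewrite coef_poly subSS ltnS leq_subr subKn// -ltnS.
Qed.

End CoefFunctional.

Section Szego.
Context {R : realType}.
Implicit Types (c : nat -> R) (p q : {poly R}) (i j k n : nat).

Definition absdiff i k : nat := (i - k) + (k - i).

(* [toeplitz c p q] is the integral of p conj(q) on the unit circle against a
   conjugation-symmetric measure with moments [c]. *)
Definition toeplitz c p q : R :=
  coef_fun (fun i => coef_fun (fun k => c (absdiff i k)) q) p.

Lemma toeplitzZl c (k : R) p q : toeplitz c (k *: p) q = k * toeplitz c p q.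
Proof. exact: coef_funZ. Qed.

Lemma toeplitzBl c p p' q : toeplitz c (p - p') q = toeplitz c p q - toeplitz c p' q.
Proof. exact: coef_funB. Qed.

Lemma toeplitzC c p q : toeplitz c p q = toeplitz c q p.
Proof.
rewrite /toeplitz /coef_fun.
under eq_bigr do rewrite mulr_sumr.
rewrite exchange_big; apply: eq_bigr => i _ /=.
rewrite mulr_sumr; apply: eq_bigr => k _ /=.
by rewrite mulrCA /absdiff addnC.
Qed.

Lemma toeplitzXn c p k : toeplitz c p 'X^k = coef_fun (fun i => c (absdiff i k)) p.
Proof. by rewrite toeplitzC /toeplitz coef_funXn; congr coef_fun; apply/funext => i; rewrite /absdiff addnC. Qed.

Lemma toeplitzX c p q : toeplitz c ('X * p) ('X * q) = toeplitz c p q.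
Proof.
rewrite /toeplitz coef_funXl; congr coef_fun; apply/funext => i /=.
by rewrite coef_funXl; congr coef_fun.
Qed.

Lemma toeplitz1 c p : toeplitz c p 'X^0 = coef_fun c p.
Proof.
rewrite toeplitzXn; congr coef_fun; apply/funext => i /=.
by rewrite /absdiff subn0 sub0n addn0.
Qed.

Lemma toeplitz_reverse c n p k : (size p <= n.+1)%N -> (k <= n)%N ->
  toeplitz c (reverse_poly n p) 'X^k = toeplitz c p 'X^(n - k).
Proof.
move=> pn kn; rewrite !toeplitzXn coef_fun_reverse//.
rewrite !(@coef_fun_wide _ n.+1)//; apply: eq_bigr => i _; congr (_ * c _).
by rewrite /absdiff; have := ltn_ord i; lia.
Qed.

(** The coefficient is forced by orthogonality of the next polynomial to 1; as a quotient it is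
    defined for any c, and means something once the denominator, a squared norm, is positive. *)
Fixpoint szego c n : {poly R} :=
  if n is m.+1 then
    'X * szego c m - (coef_fun (c \o S) (szego c m) /
        coef_fun c (reverse_poly m (szego c m))) *: reverse_poly m (szego c m)
  else 1.

Definition schur c n : R :=
  coef_fun (c \o S) (szego c n) / coef_fun c (reverse_poly n (szego c n)).

Lemma szegoS c n : szego c n.+1 =
  'X * szego c n - schur c n *: reverse_poly n (szego c n).
Proof. by []. Qed.

Lemma szego_monic c n : szego c n \is monic /\ size (szego c n) = n.+1.
Proof.
elim: n => [|n [IHm IHs]]; first by rewrite /= monic1 size_poly1.
have sX : size ('X * szego c n) = n.+2.
  by rewrite mulrC size_mulX ?IHs// monic_neq0.
have sR : (size (- (schur c n *: reverse_poly n (szego c n))) <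
    size (szego c n * 'X)%R)%N.
  by rewrite [szego c n * 'X]mulrC sX size_polyN (leq_ltn_trans (size_scale_leq _ _))// ltnS size_poly.
rewrite szegoS monicE lead_coefDl 1?[_ * szego c n]mulrC// size_polyDl// [_ * 'X]mulrC sX; split=> //.
by rewrite lead_coefM lead_coefX mul1r -monicE.
Qed.

Lemma size_szego c n : size (szego c n) = n.+1.
Proof. by have [] := szego_monic c n. Qed.

Definition toeplitz_pos c := forall p, p != 0 -> 0 < toeplitz c p p.

Lemma toeplitz_low c p q n : (size q <= n)%N ->
  (forall k, (k < n)%N -> toeplitz c p 'X^k = 0) -> toeplitz c p q = 0.
Proof.
move=> qn orth; rewrite toeplitzC /toeplitz (@coef_fun_wide _ n)//.
rewrite big1// => i _.
have := orth i (ltn_ord i); rewrite toeplitzXn.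
have -> : (fun i0 : nat => c (absdiff i0 i)) = (fun k : nat => c (absdiff i k)).
  by apply/funext => k; rewrite /absdiff addnC.
by move=> ->; rewrite mulr0.
Qed.

Lemma toeplitz_monic c p n : p \is monic -> size p = n.+1 ->
  (forall k, (k < n)%N -> toeplitz c p 'X^k = 0) -> toeplitz c p 'X^n = toeplitz c p p.
Proof.
move=> pm ps orth; apply/eqP; rewrite -subr_eq0 -opprB oppr_eq0; apply/eqP.
rewrite (toeplitzC c p 'X^n) -toeplitzBl toeplitzC.
apply: (@toeplitz_low _ _ _ n) => //.
apply/leq_sizeP => i; rewrite leq_eqVlt => /predU1P[<-|ni].
  have := monicP pm; rewrite lead_coefE ps /= => pn.
  by rewrite coefB coefXn eqxx pn subrr.
by rewrite coefB coefXn gtn_eqF// subr0 nth_default// ps.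
Qed.

Section positive.
Variable c : nat -> R.
Hypothesis cpos : toeplitz_pos c.

(** Against 1 the coefficient was chosen for this. Against X^(k+1) both terms vanish by induction:
    shifting turns the first into a pairing with X^k, reversal turns the second into one with
    X^(n-k-1). *)
Lemma szego_orth n k : (k < n)%N -> toeplitz c (szego c n) 'X^k = 0.
Proof.
elim: n k => [//|n IH] k kn.
have [pm ps] := szego_monic c n.
have sn : (size (szego c n) <= n.+1)%N by rewrite ps.
rewrite szegoS toeplitzBl toeplitzZl.
case: k kn => [_|k]; last first.
  rewrite ltnS => kn; rewrite exprS toeplitzX IH// -exprS toeplitz_reverse//.
  by rewrite IH ?mulr0 ?subrr//; lia.
have -> : toeplitz c ('X * szego c n) 'X^0 = coef_fun (c \o S) (szego c n).
  rewrite toeplitzXn coef_funXl; congr coef_fun; apply/funext => i /=.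
  by rewrite /absdiff subn0 sub0n addn0.
rewrite toeplitz1.
rewrite /schur divfK ?subrr//.
have -> : coef_fun c (reverse_poly n (szego c n)) = toeplitz c (szego c n) 'X^n.
  by rewrite -toeplitz1 toeplitz_reverse// subn0.
by rewrite toeplitz_monic// gt_eqF// cpos// monic_neq0.
Qed.

Lemma szego_norm n : coef_fun c (reverse_poly n (szego c n)) =
  toeplitz c (szego c n) (szego c n).
Proof.
have [pm ps] := szego_monic c n.
rewrite -(@toeplitz_monic _ _ n)//; last by move=> k; exact: szego_orth.
by rewrite -toeplitz1 toeplitz_reverse ?ps// subn0.
Qed.

Lemma szego_norm_gt0 n : 0 < coef_fun c (reverse_poly n (szego c n)).
Proof. by rewrite szego_norm cpos// monic_neq0//; have [] := szego_monic c n. Qed.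

Lemma szego_orthogonal m n : m != n -> toeplitz c (szego c m) (szego c n) = 0.
Proof.
wlog mn : m n / (n < m)%N.
  move=> H mn; have [/H|nm] := ltnP n m; first exact.
  by rewrite toeplitzC; apply: H; rewrite 1?eq_sym// ltn_neqAle mn.
by move=> _; apply: (@toeplitz_low _ _ _ m); [rewrite size_szego|move=> k; exact: szego_orth].
Qed.

Lemma toeplitz_low_eq0 p n : (size p <= n)%N ->
  (forall k, (k < n)%N -> toeplitz c p 'X^k = 0) -> p = 0.
Proof.
move=> pn orth; apply/eqP; apply: contraT => /cpos.
by rewrite (@toeplitz_low _ _ _ n)// ltxx.
Qed.

Lemma szego_unique p n : (size p <= n.+1)%N -> p`_n = 1 ->
  (forall k, (k < n)%N -> toeplitz c p 'X^k = 0) -> p = szego c n.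
Proof.
move=> pn p1 orth; apply/eqP; rewrite -subr_eq0; apply/eqP.
apply: (@toeplitz_low_eq0 _ n).
  apply/leq_sizeP => i; rewrite leq_eqVlt => /predU1P[<-|ni].
    have [/monicP] := szego_monic c n; rewrite lead_coefE => + ps.
    by rewrite ps /= coefB p1 => ->; rewrite subrr.
  by rewrite coefB !nth_default ?subrr// ?size_szego// (leq_trans pn).
by move=> k kn; rewrite toeplitzBl orth// szego_orth// subrr.
Qed.

End positive.
End Szego.

(** * From complex orthogonal polynomials to the real recursion *)

Section ComplexOPUC.
Context {R : realType}.
Local Notation C := R[i].
Implicit Types (p q : {poly R}) (P Q : {poly C}) (c : nat -> R).

Definition cpoly p : {poly C} := map_poly (fun x : R => x%:C%C) p.
Definition re_poly P : {poly R} := \poly_(i < size P) complex.Re P`_i.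
Definition im_poly P : {poly R} := \poly_(i < size P) complex.Im P`_i.

Lemma coef_cpoly p i : (cpoly p)`_i = (p`_i)%:C%C.
Proof. by rewrite coef_map. Qed.

Lemma coef_re_poly P i : (re_poly P)`_i = complex.Re P`_i.
Proof. by rewrite coef_poly; case: ltnP => // h; rewrite nth_default. Qed.

Lemma coef_im_poly P i : (im_poly P)`_i = complex.Im P`_i.
Proof. by rewrite coef_poly; case: ltnP => // h; rewrite nth_default. Qed.

Lemma cpoly_re_poly P : im_poly P = 0 -> P = cpoly (re_poly P).
Proof.
move=> H; apply/polyP => i; rewrite coef_cpoly coef_re_poly.
have := congr1 (fun q : {poly R} => q`_i) H; rewrite /= coef_im_poly coef0.
by case: (P`_i) => x y /= ->.
Qed.

Lemma reverse_cpoly n p (z : C) : (size p <= n.+1)%N -> z != 0 ->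
  reversed n (cpoly p) z = (cpoly (reverse_poly n p)).[z].
Proof.
move=> pn z0; rewrite /reversed.
have sc q : size (cpoly q) = size q by rewrite size_map_poly.
rewrite (@horner_coef_wide _ n.+1) ?sc// (@horner_coef_wide _ n.+1); last first.
  by rewrite sc size_poly.
rewrite rmorph_sum mulr_sumr (reindex_inj rev_ord_inj) /=; apply: eq_bigr => i _.
have ni : (i <= n)%N by rewrite -ltnS.
rewrite !coef_cpoly coef_poly ltn_ord subSS rmorphM /= rmorphXn /= fmorphV /= conjcK.
rewrite oppr0 mulrCA; congr (_ * _).
have -> : z ^+ n = z ^+ i * z ^+ (n - i) by rewrite -exprD subnKC.
by rewrite exprVn mulfK// expf_neq0.
Qed.

Definition herm c P Q : C :=
  coef_fun (fun i => coef_fun (fun k => (c (absdiff i k))%:C%C) (map_poly conjc Q)) P.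

Lemma herm_real c p q : herm c (cpoly p) (cpoly q) = (toeplitz c p q)%:C%C.
Proof.
rewrite /herm /toeplitz /coef_fun size_map_poly rmorph_sum.
apply: eq_bigr => i _ /=; rewrite coef_cpoly rmorphM rmorph_sum /=; congr (_ * _).
rewrite !size_map_poly; apply: eq_bigr => k _.
by rewrite coef_map coef_cpoly /= rmorphM /= oppr0.
Qed.

Lemma herm_Xn c P k : herm c P 'X^k = coef_fun (fun i => (c (absdiff i k))%:C%C) P.
Proof.
rewrite /herm; congr coef_fun; apply/funext => i.
by rewrite map_polyXn coef_funXn.
Qed.

Lemma Re_sum (I : Type) (r : seq I) (F : I -> C) :
  complex.Re (\sum_(i <- r) F i) = \sum_(i <- r) complex.Re (F i).
Proof. by apply: (big_morph (@complex.Re R)) => [[x y] [x' y']|]. Qed.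

Lemma Im_sum (I : Type) (r : seq I) (F : I -> C) :
  complex.Im (\sum_(i <- r) F i) = \sum_(i <- r) complex.Im (F i).
Proof. by apply: (big_morph (@complex.Im R)) => [[x y] [x' y']|]. Qed.

Lemma herm_Xn_re c P k : complex.Re (herm c P 'X^k) = toeplitz c (re_poly P) 'X^k.
Proof.
rewrite herm_Xn toeplitzXn (@coef_fun_wide R (size P) _ (re_poly P)) ?size_poly//.
rewrite /coef_fun Re_sum; apply: eq_bigr => i _ /=.
by rewrite coef_re_poly; case: (P`_i) => x y /=; rewrite mulr0 subr0.
Qed.

Lemma herm_Xn_im c P k : complex.Im (herm c P 'X^k) = toeplitz c (im_poly P) 'X^k.
Proof.
rewrite herm_Xn toeplitzXn (@coef_fun_wide R (size P) _ (im_poly P)) ?size_poly//.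
rewrite /coef_fun Im_sum; apply: eq_bigr => i _ /=.
by rewrite coef_im_poly; case: (P`_i) => x y /=; rewrite mulr0 add0r.
Qed.

Lemma herm_linr c P Q Q' (k : C) :
  herm c P (Q + k *: Q') = herm c P Q + conjc k * herm c P Q'.
Proof.
rewrite /herm -coef_fun_linF; congr coef_fun; apply/funext => i.
by rewrite rmorphD /= map_polyZ coef_funD coef_funZ.
Qed.

Lemma herm_low c P Q (Psi : nat -> {poly C}) n :
  (forall k, Psi k \is monic /\ size (Psi k) = k.+1) ->
  (forall k, (k < n)%N -> herm c P (Psi k) = 0) ->
  (size Q <= n)%N -> herm c P Q = 0.
Proof.
move=> PsiM; elim: n Q => [|n IH] Q orth Qn.
  have -> : Q = 0 by apply/eqP; rewrite -size_poly_eq0 -leqn0.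
  rewrite /herm; under [X in coef_fun X]eq_fun do rewrite map_poly0 coef_fun0.
  by rewrite /coef_fun big1// => i _; rewrite mulr0.
have [pm ps] := PsiM n.
have -> : Q = (Q - Q`_n *: Psi n) + Q`_n *: Psi n by rewrite subrK.
rewrite herm_linr orth// mulr0 addr0; apply: IH => [k kn|].
  by apply: orth; exact: ltnW.
apply/leq_sizeP => i; rewrite leq_eqVlt => /predU1P[<-|ni].
  by move/monicP: pm; rewrite lead_coefE ps /= coefB coefZ => ->; rewrite mulr1 subrr.
have h : (size (Psi n) <= i)%N by rewrite ps.
by rewrite coefB coefZ (nth_default _ h) (nth_default _ (leq_trans Qn ni)) mulr0 subrr.
Qed.

(** Complex coefficients are allowed a priori. Since the moments are real, the imaginary part of
    Psi_n is orthogonal to all powers below n; its degree is below n because the leading coefficient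
    is 1, so it vanishes. The real part is then given by [szego_unique]. *)
Lemma herm_opuc_unique c (Psi : nat -> {poly C}) n : toeplitz_pos c ->
  (forall k, Psi k \is monic /\ size (Psi k) = k.+1) ->
  (forall j k, j != k -> herm c (Psi j) (Psi k) = 0) ->
  Psi n = cpoly (szego c n).
Proof.
move=> cpos PsiM orth; have [pm ps] := PsiM n.
have lc : (Psi n)`_n = 1 by move/monicP: pm; rewrite lead_coefE ps.
have oX k : (k < n)%N -> herm c (Psi n) 'X^k = 0.
  move=> kn; apply: (herm_low PsiM (n := n)); last by rewrite size_polyXn.
  by move=> i ni; apply: orth; rewrite gtn_eqF.
have sz F : (size (\poly_(i < size (Psi n)) F i) <= n.+1)%N by move=> *; rewrite -ps size_poly.
have im0 : im_poly (Psi n) = 0.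
  apply: (toeplitz_low_eq0 cpos (n := n)); last first.
    by move=> k kn; rewrite -herm_Xn_im oX.
  apply/leq_sizeP => i; rewrite leq_eqVlt => /predU1P[<-|ni].
    by rewrite coef_im_poly lc.
  by rewrite nth_default// (leq_trans (size_poly _ _))// ps.
rewrite (cpoly_re_poly im0); congr cpoly; apply: szego_unique => //.
- by rewrite (leq_trans (size_poly _ _))// ps.
- by rewrite coef_re_poly lc.
- by move=> k kn; rewrite -herm_Xn_re oX.
Qed.

(** The reversed polynomial has constant term 1, so it is nonzero; testing at 1, 2, 3, ... avoids z
    = 0, where the recursion is not assumed. *)
Lemma reverse_szego_neq0 c n (a : R) :
  (forall z : C, z != 0 -> a%:C%C * (cpoly (reverse_poly n (szego c n))).[z] = 0) ->
  a = 0.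
Proof.
move=> H; apply/eqP; apply: contraT => a0.
pose r := reverse_poly n (szego c n).
have r0 : r`_0 = 1.
  have [/monicP] := szego_monic c n; rewrite lead_coefE => + ps.
  by rewrite ps coef_poly /= subn0.
suff : r = 0 by move=> rE; move: r0; rewrite rE coef0 => /eqP; rewrite eq_sym oner_eq0.
apply: (@roots_geq_poly_eq0 _ _ [seq i.+1%:R | i <- iota 0 (size r)]).
- apply/allP => _ /mapP[i _ ->]; rewrite /root.
  have z0 : ((i.+1%:R : R)%:C)%C != 0 :> C.
    by rewrite fmorph_eq0 pnatr_eq0.
  have /eqP := H _ z0; rewrite mulf_eq0 fmorph_eq0 (negbTE a0) /=.
  by rewrite horner_map fmorph_eq0.
- rewrite map_inj_uniq ?iota_uniq// => i j /eqP.
  by rewrite eqr_nat => /eqP[].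
- by rewrite size_map size_iota.
Qed.

Lemma verblunskyE (mu : set (borelC R) -> \bar R) c n : toeplitz_pos c ->
  (forall P Q : {poly C}, integralC mu (fun z => P.[z] * conjc Q.[z]) = herm c P Q) ->
  verblunsky mu n = schur c n.
Proof.
move=> cpos muE.
have ex : is_verblunsky mu n (schur c n).
  exists (fun j => cpoly (szego c j)).
    split=> [j|j k jk]; last by rewrite muE herm_real szego_orthogonal.
    have [pm ps] := szego_monic c j.
    by rewrite monic_map// size_map_poly.
  move=> z z0; rewrite reverse_cpoly ?size_szego// szegoS.
  rewrite /cpoly rmorphB /= rmorphM /= map_polyX map_polyZ /=.
  by rewrite hornerD hornerN hornerM hornerX hornerZ.
have un a : is_verblunsky mu n a -> a = schur c n.
  move=> [Psi [PsiM orth] rec].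
  have PsiE j : Psi j = cpoly (szego c j).
    by apply: herm_opuc_unique => // i k ik; rewrite -muE orth.
  apply/eqP; rewrite -subr_eq0; apply/eqP/(@reverse_szego_neq0 c n) => z z0.
  have := rec z z0; rewrite !PsiE reverse_cpoly ?size_szego// szegoS.
  rewrite /cpoly rmorphB /= rmorphM /= map_polyX map_polyZ /=.
  rewrite hornerD hornerN hornerM hornerX hornerZ => /addrI/oppr_inj E.
  by rewrite rmorphB mulrBl -E subrr.
by apply: un; rewrite /verblunsky; apply: (@getPex _ (is_verblunsky mu n)); exists (schur c n).
Qed.

End ComplexOPUC.

(** * Lifting a density to the circle *)

Section Density.
Context {R : realType}.
Local Notation mu := (@lebesgue_measure R).
Local Notation T := (measurableTypeR R).
Local Notation D := (`[(-1)%R, 1%R]%classic : set T).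

(* The positivity and continuity proofs are arguments so that the measure
   structure below can be inferred. *)
Definition density (w : R -> R) (w0 : forall x, 0 <= w x) (cw : continuous w) :
    set T -> \bar R :=
  fun A => (\int[mu]_(x in A `&` D) (w x)%:E)%E.

Section fixed.
Variables (w : R -> R) (w0 : forall x, 0 <= w x) (cw : continuous w).
Local Open Scope ereal_scope.
Local Notation nu := (density w0 cw).

Let wD : T -> \bar R := (EFin \o w) \_ D.

Let mw : measurable_fun setT (EFin \o w : T -> \bar R).
Proof. by apply/measurable_EFinP; exact: continuous_measurable_fun. Qed.

Let mwD : measurable_fun setT wD.
Proof.
apply/(measurable_restrictT (EFin \o w : T -> \bar R)) => //.
exact: measurable_funTS.
Qed.

Let wD0 x : 0 <= wD x.
Proof. by rewrite /wD patchE; case: ifP => // _; rewrite lee_fin. Qed.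

Let densityE A : nu A = \int[mu]_(x in A) wD x.
Proof. by rewrite /density integral_mkcondr. Qed.

Let density0 : nu set0 = 0.
Proof. by rewrite densityE integral_set0. Qed.

Let density_ge0 A : 0 <= nu A.
Proof. by rewrite densityE; exact: integral_ge0. Qed.

Let density_sigma_additive : semi_sigma_additive nu.
Proof.
move=> F mF tF mUF.
under eq_cvg do under eq_bigr do rewrite densityE.
rewrite densityE; apply: cvg_toP.
  apply: ereal_nondecreasing_is_cvgn => m n mn.
  by apply: lee_sum_nneg_natr => // k _ _; exact: integral_ge0.
rewrite ge0_integral_bigcup//; exact: measurable_funTS.
Qed.

HB.instance Definition _ := isMeasure.Build _ _ _ nu
  density0 density_ge0 density_sigma_additive.

Import HBNNSimple.

Let integral_density_nnsfun (f : {nnsfun T >-> R}) :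
  \int[nu]_x (f x)%:E = \int[mu]_x ((f x)%:E * wD x).
Proof.
under [LHS]eq_integral do rewrite fimfunE -fsumEFin//.
rewrite [LHS]ge0_integral_fsum//; last 2 first.
  - by move=> r; exact/measurable_EFinP/measurableT_comp.
  - by move=> n x _; rewrite EFinM nnfun_muleindic_ge0.
under [RHS]eq_integral.
  move=> x xD; rewrite fimfunE -fsumEFin// ge0_mule_fsuml; last first.
    by move=> r; rewrite EFinM nnfun_muleindic_ge0.
  over.
rewrite [RHS]ge0_integral_fsum//; last 2 first.
  - move=> r; apply: emeasurable_funM => //.
    by apply/measurable_EFinP; do 2 apply/measurableT_comp => //.
  - by move=> n x _; rewrite mule_ge0// EFinM nnfun_muleindic_ge0.
apply: eq_fsbigr => r _.
transitivity (r%:E * \int[mu]_(x in f @^-1` [set r]) wD x).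
  by rewrite (integralZl_indic_nnsfun _ measurableT) integral_indic// setIT -densityE.
have [r0|r0] := ltP r 0%R.
  rewrite preimage_nnfun0// integral_set0 mule0 integral0_eq// => x _.
  by rewrite indic0 mulr0 mul0e.
under [RHS]eq_integral do rewrite EFinM -muleA.
rewrite ge0_integralZl//.
- congr (_ * _); rewrite [LHS]integral_mkcond/=; apply: eq_integral => x _.
  rewrite patchE indicE; case: ifPn => xE.
    by rewrite mul1e.
  by rewrite mul0e.
- apply: emeasurable_funM => //; apply/measurable_EFinP.
  by apply: measurable_indic.
- by move=> x _; rewrite mule_ge0// lee_fin.
Qed.

(** Simple functions first, then monotone convergence on both sides. *)
Lemma integral_density_ge0 (f : T -> \bar R) :
  measurable_fun setT f -> (forall x, 0 <= f x) ->
  \int[nu]_x f x = \int[mu]_x (f x * wD x).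
Proof.
move=> mf f0.
pose f_ := nnsfun_approx measurableT mf.
transitivity (lim (\int[nu]_x (f_ n x)%:E @[n --> \oo])).
  rewrite -monotone_convergence//=.
  - apply: eq_integral => ? /[!inE] xD; apply/esym/cvg_lim => //=.
    exact: cvg_nnsfun_approx.
  - by move=> n; exact/measurable_EFinP/measurable_funTS.
  - by move=> n ? _; rewrite lee_fin.
  - by move=> ? _ ? ? mn; rewrite lee_fin; exact/lefP/nd_nnsfun_approx.
rewrite (_ : \int[mu]_x (f x * wD x) = lim
    (\int[mu]_x ((f_ n x)%:E * wD x) @[n --> \oo])); last first.
  rewrite -monotone_convergence//=.
  - apply: eq_integral => x _; apply/esym/cvg_lim => //.
    have h : wD x \is a fin_num by rewrite /wD patchE; case: ifP.
    by apply: cvgeZr => //; exact: cvg_nnsfun_approx.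
  - move=> n; apply: emeasurable_funM => //.
    exact/measurable_EFinP/measurable_funTS.
  - by move=> n x _; rewrite mule_ge0// lee_fin.
  - move=> x _ m n mn; rewrite lee_wpmul2r// lee_fin; exact/lefP/nd_nnsfun_approx.
by apply: congr_lim; apply/funext => n /=; exact: integral_density_nnsfun.
Qed.

Lemma ge0_integral_density_pushforward d (Y : measurableType d) (phi : T -> Y)
    (g : Y -> \bar R) :
  measurable_fun setT phi -> measurable_fun setT g -> (forall y, 0 <= g y) ->
  \int[pushforward nu phi]_y g y = \int[mu]_(x in D) (g (phi x) * (w x)%:E).
Proof.
move=> mphi mg g0.
rewrite (@ge0_integral_pushforward _ _ _ _ _ phi mphi nu setT)//.
have mgp : measurable_fun setT (g \o phi) by exact: measurableT_comp.
rewrite preimage_setT integral_density_ge0//; last by move=> x; exact: g0.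
rewrite [RHS]integral_mkcond/=; apply: eq_integral => x _.
by rewrite /wD !patchE; case: ifP => // _; rewrite mule0.
Qed.

(** The positive and negative parts match separately, the weight being nonnegative, so no
    integrability enters. *)
Lemma integral_density_pushforward d (Y : measurableType d) (phi : T -> Y)
    (g : Y -> R) :
  measurable_fun setT phi -> measurable_fun setT g ->
  \int[pushforward nu phi]_y (g y)%:E = \int[mu]_(x in D) (g (phi x) * w x)%:E.
Proof.
move=> mphi mg; have mg' : measurable_fun setT (EFin \o g) by exact/measurable_EFinP.
rewrite integralE [RHS]integralE !ge0_integral_density_pushforward//.
- congr (_ - _); apply: eq_integral => x _.
    by rewrite !funeposE maxe_pMl ?lee_fin// mul0e EFinM.
  by rewrite !funenegE maxe_pMl ?lee_fin// mul0e mulNe EFinM.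
- exact: measurable_funeneg.
- exact: measurable_funepos.
Qed.

End fixed.
End Density.

(** * Measurability and a continuous form of the map to the circle *)

Section CircleMap.
Context {R : realType}.
Local Notation C := R[i].
Local Notation T := (measurableTypeR R).
Implicit Types (x : R) (z : C).

(** On [-1, 1] this is e^(i arccos x). Unlike [circle_map] it is continuous on the whole line, and
    it gives access to half the angle. *)
Definition zeta x : C := (x +i* Num.sqrt (1 - x ^+ 2))%C.

Definition circle x : C := zeta x ^+ 2.

Lemma circleE x : -1 <= x <= 1 ->
  circle x = ((2 * x ^+ 2 - 1) +i* (2 * x * Num.sqrt (1 - x ^+ 2)))%C.
Proof.
move=> xI; rewrite /circle /zeta expr2.
have s2 : Num.sqrt (1 - x ^+ 2) * Num.sqrt (1 - x ^+ 2) = 1 - x ^+ 2.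
  by rewrite -expr2 sqr_sqrtr// subr_ge0; nra.
by simpc; rewrite s2; congr (_ +i* _)%C; ring.
Qed.

Lemma circle_mapE x : -1 <= x <= 1 -> circle_map x = circle x.
Proof.
move=> xI; rewrite circleE// /circle_map mulr_natl cos_mulr2n sin_mulr2n.
by rewrite acosK ?in_itv// sin_acos//; congr (_ +i* _)%C; ring.
Qed.

(** Outside [-1, 1] [acos] chooses from an empty set, hence always the same default. This is what
    makes [circle_map] measurable on the whole line. *)
Lemma circle_map_out x : ~~ (-1 <= x <= 1) -> circle_map x = circle_map (2 : R).
Proof.
move=> xI; have E (y : R) : ~~ (-1 <= y <= 1) -> [set t : R | 0 <= t <= pi /\ cos t = y] = set0.
  move=> /negP yI; apply/seteqP; split=> // t [_ ty]; apply: yI.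
  by rewrite -ty cos_geN1 cos_le1.
have aE : acos x = acos 2.
  by rewrite acos.unlock !E//; apply/negP => /andP[_]; lra.
by rewrite /circle_map aE.
Qed.

Lemma normc_le (x y : R) : `|(x +i* y)%C| <= (`|x| + `|y|)%:C%C.
Proof.
rewrite normc_def /= lecR -(@ler_pXn2r _ 2)// ?nnegrE ?sqrtr_ge0 ?addr_ge0//.
rewrite sqr_sqrtr ?addr_ge0 ?sqr_ge0//.
rewrite -(real_normK (num_real x)) -(real_normK (num_real y)) sqrrD.
by rewrite lerD2r lerDl mulrn_wge0// mulr_ge0.
Qed.

Lemma open_preimage_complex (f g : R -> R) (U : set C) :
  continuous f -> continuous g -> @open C^o U ->
  open ((fun x => (f x +i* g x)%C) @^-1` U).
Proof.
move=> cf cg oU; rewrite openE => x Ux.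
have := oU; rewrite openE => /(_ _ Ux) /nbhs_ballP [e /= e0 eU].
have er : e = (complex.Re e)%:C%C by move: e0; rewrite ltcE /= => /andP[/eqP]; case: (e) => a b /= -> _.
have r0 : 0 < complex.Re e by move: e0; rewrite ltcE => /andP[].
have r2 : 0 < complex.Re e / 2 by rewrite divr_gt0.
have /cvgrPdist_lt /(_ _ r2) h1 := cf x.
have /cvgrPdist_lt /(_ _ r2) h2 := cg x.
rewrite /interior /=; near=> y.
apply: eU; rewrite /ball /= er.
have -> : (f x +i* g x)%C - (f y +i* g y)%C = ((f x - f y) +i* (g x - g y))%C by [].
apply: le_lt_trans (normc_le _ _) _; rewrite ltcR (splitr (complex.Re e)) ltrD//.
  by near: y.
by near: y.
Unshelve. all: by end_near. Qed.

Lemma measurable_circle_map : measurable_fun setT (@circle_map R : T -> borelC R).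
Proof.
apply: (@measurability _ _ T (borelC R) setT _ (@open C^o)) => // _ [U oU <-].
rewrite setTI.
have -> : @circle_map R @^-1` U =
  (`[-1, 1] `&` (fun x : R => ((2 * x ^+ 2 - 1) +i* (2 * x * Num.sqrt (1 - x ^+ 2)))%C) @^-1` U)
  `|` (~` `[-1, 1] `&` [set x | U (circle_map (2 : R))]).
  apply/seteqP; split=> x /=; rewrite in_itv/=.
    have [xI|xI] := boolP (-1 <= x <= 1).
      by rewrite circle_mapE// circleE//; left.
    by rewrite circle_map_out//; right; split => //; exact/negP.
  move=> [[xI]|[/negP xI]]; first by rewrite circle_mapE// circleE.
  by rewrite (circle_map_out xI).
apply: measurableU; apply: measurableI => //.
- apply: open_measurable; apply: open_preimage_complex => //; prove_cont.
- exact: measurableC.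
- have [h|h] := pselect (U (circle_map (2 : R))).
    by rewrite (_ : [set x | _] = setT)//; apply/seteqP; split.
  by rewrite (_ : [set x | _] = set0)//; apply/seteqP; split.
Qed.

Definition measurableC_fun (f : borelC R -> C) : Prop :=
  measurable_fun setT (fun z : borelC R => complex.Re (f z) : T) /\
  measurable_fun setT (fun z : borelC R => complex.Im (f z) : T).

(** Preimages of open intervals are open; the real and imaginary parts are the intended cases. *)
Lemma measurable_contraction (f : C -> R) :
  (forall z w, (`|f z - f w|)%:C%C <= `|z - w|) ->
  measurable_fun setT (f : borelC R -> T).
Proof.
move=> fc; apply: (@measurability _ _ _ _ _ _ (@RGenOpens.G R)).
  exact: RGenOpens.measurableE.
move=> _ [_ [a [b ->]] <-]; rewrite setTI; apply: sub_sigma_algebra.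
change (@open C^o (f @^-1` `]a, b[)); rewrite openE => z /=; rewrite in_itv/= => /andP[az zb].
pose e := Num.min (f z - a) (b - f z).
have e0 : 0 < e by rewrite lt_min !subr_gt0 az zb.
apply/nbhs_ballP; exists (e%:C%C) => /=; first by rewrite ltcR.
move=> w; rewrite /ball /= => zw; rewrite in_itv/=.
have : `|f z - f w| < e by rewrite -ltcR; apply: le_lt_trans zw.
by rewrite lt_min !ltr_norml => /andP[/andP[h1 h2] /andP[h3 h4]]; apply/andP; split; lra.
Qed.

Lemma measurableC_id : measurableC_fun (fun z => z).
Proof.
split; apply: measurable_contraction => z w.
  have := normc_ge_Re (z - w); apply: le_trans.
  by rewrite lecR; case: z w => [x y] [x' y'].
rewrite normc_def lecR -sqrtr_sqr ler_wsqrtr//.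
by case: z w => [x y] [x' y'] /=; rewrite lerDr sqr_ge0.
Qed.

Lemma measurableC_cst k : measurableC_fun (fun=> k).
Proof. by split; exact: measurable_cst. Qed.

Lemma measurableC_conj f : measurableC_fun f -> measurableC_fun (fun z => conjc (f z)).
Proof.
move=> [fr fi]; split.
  by apply: eq_measurable_fun fr => z _; case: (f z).
by apply: eq_measurable_fun (measurableT_comp (@oppr_measurable R setT) fi) => z _ /=; case: (f z).
Qed.

Lemma measurableC_add f g : measurableC_fun f -> measurableC_fun g ->
  measurableC_fun (fun z => f z + g z).
Proof.
move=> [fr fi] [gr gi]; split.
  by apply: eq_measurable_fun (measurable_funD fr gr) => z _ /=; case: (f z) => a b; case: (g z) => c d.
by apply: eq_measurable_fun (measurable_funD fi gi) => z _ /=; case: (f z) => a b; case: (g z) => c d.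
Qed.

Lemma measurableC_mul f g : measurableC_fun f -> measurableC_fun g ->
  measurableC_fun (fun z => f z * g z).
Proof.
move=> [fr fi] [gr gi]; split.
  apply: eq_measurable_fun (measurable_funB (measurable_funM fr gr) (measurable_funM fi gi)).
  by move=> z _ /=; case: (f z) => a b; case: (g z) => c d.
apply: eq_measurable_fun (measurable_funD (measurable_funM fr gi) (measurable_funM fi gr)).
by move=> z _ /=; case: (f z) => a b; case: (g z) => c d.
Qed.

Lemma measurableC_poly (P : {poly C}) : measurableC_fun (fun z => P.[z]).
Proof.
elim/poly_ind: P => [|P k IH].
  have -> : (fun z : borelC R => (0 : {poly C}).[z]) = (fun=> 0).
    by apply/funext => z; rewrite horner0.
  exact: measurableC_cst.
have -> : (fun z : borelC R => (P * 'X + k%:P).[z]) = (fun z => P.[z] * z + k).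
  by apply/funext => z; rewrite hornerMXaddC.
apply: measurableC_add; last exact: measurableC_cst.
by apply: measurableC_mul => //; exact: measurableC_id.
Qed.

End CircleMap.

(** * Moments of the lift *)

Section ComplexIntegral.
Context {R : realType}.
Local Notation C := R[i].
Local Notation mu := (@lebesgue_measure R).
Implicit Types (f g : R -> C) (v : R -> R) (x : R) (p q : {poly R}) (P Q : {poly C}).

Definition continuousC f : Prop :=
  continuous (fun x => complex.Re (f x)) /\ continuous (fun x => complex.Im (f x)).

Lemma continuousC_cst k : continuousC (fun=> k).
Proof. by split; exact: cont_cst. Qed.

Lemma continuousC_conj f : continuousC f -> continuousC (fun x => conjc (f x)).
Proof.
move=> [fr fi]; split.
  have -> : (fun x => complex.Re (conjc (f x))) = (fun x => complex.Re (f x)).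
    by apply/funext => x; case: (f x).
  exact: fr.
have -> : (fun x => complex.Im (conjc (f x))) = (fun x => - complex.Im (f x)).
  by apply/funext => x; case: (f x).
exact: cont_opp.
Qed.

Lemma ReD (z w : C) : complex.Re (z + w) = complex.Re z + complex.Re w.
Proof. by case: z w => a b []. Qed.

Lemma ImD (z w : C) : complex.Im (z + w) = complex.Im z + complex.Im w.
Proof. by case: z w => a b []. Qed.

Lemma ReM (z w : C) : complex.Re (z * w) =
  complex.Re z * complex.Re w - complex.Im z * complex.Im w.
Proof. by case: z w => a b []. Qed.

Lemma ImM (z w : C) : complex.Im (z * w) =
  complex.Re z * complex.Im w + complex.Im z * complex.Re w.
Proof. by case: z w => a b []. Qed.

Lemma continuousC_add f g : continuousC f -> continuousC g ->
  continuousC (fun x => f x + g x).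
Proof.
move=> [fr fi] [gr gi]; split.
  by rewrite (funext (fun x => ReD (f x) (g x))); prove_cont.
by rewrite (funext (fun x => ImD (f x) (g x))); prove_cont.
Qed.

Lemma continuousC_mul f g : continuousC f -> continuousC g ->
  continuousC (fun x => f x * g x).
Proof.
move=> [fr fi] [gr gi]; split.
  by rewrite (funext (fun x => ReM (f x) (g x))); prove_cont.
by rewrite (funext (fun x => ImM (f x) (g x))); prove_cont.
Qed.

Lemma continuousC_exp f n : continuousC f -> continuousC (fun x => f x ^+ n).
Proof.
move=> cf; elim: n => [|n IH]; first exact: continuousC_cst.
have -> : (fun x => f x ^+ n.+1) = (fun x => f x * f x ^+ n).
  by apply/funext => x; rewrite exprS.
exact: continuousC_mul.
Qed.

Lemma continuousC_poly f P : continuousC f -> continuousC (fun x => P.[f x]).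
Proof.
move=> cf; elim/poly_ind: P => [|P k IH].
  have -> : (fun x => (0 : {poly C}).[f x]) = (fun=> 0).
    by apply/funext => x; rewrite horner0.
  exact: continuousC_cst.
have -> : (fun x => (P * 'X + k%:P).[f x]) = (fun x => P.[f x] * f x + k).
  by apply/funext => x; rewrite hornerMXaddC.
by apply: continuousC_add; [exact: continuousC_mul|exact: continuousC_cst].
Qed.

Lemma continuousC_zeta : continuousC (@zeta R).
Proof. by split => /=; [exact: cont_id|prove_cont]. Qed.

Lemma continuousC_circle : continuousC (@circle R).
Proof. exact: continuousC_exp continuousC_zeta. Qed.

Definition cint v f : C :=
  (\int[mu]_(x in `[-1, 1]) (complex.Re (f x) * v x)
   +i* \int[mu]_(x in `[-1, 1]) (complex.Im (f x) * v x))%C.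

Lemma cint_add v f g : continuous v -> continuousC f -> continuousC g ->
  cint v (fun x => f x + g x) = cint v f + cint v g.
Proof.
move=> cv [fr fi] [gr gi]; rewrite /cint.
have -> : forall a b c d : R, ((a +i* b) + (c +i* d) = (a + c) +i* (b + d))%C by [].
rewrite -!integral_add; [|prove_cont..].
by congr (_ +i* _)%C; apply: eq_Rintegral => x _; rewrite (ReD, ImD) mulrDl.
Qed.

Lemma cint_scale v k f : continuous v -> continuousC f ->
  cint v (fun x => k * f x) = k * cint v f.
Proof.
move=> cv [fr fi]; rewrite /cint; case: k => a b.
have -> : forall c d : R, ((a +i* b) * (c +i* d) = (a * c - b * d) +i* (a * d + b * c))%C by [].
rewrite -!integral_scale; [|prove_cont..].
rewrite -integral_sub; [|prove_cont..]; rewrite -integral_add; [|prove_cont..].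
by congr (_ +i* _)%C; apply: eq_Rintegral => x _; rewrite (ReM, ImM) /=; ring.
Qed.

Lemma continuousC_sum (I : Type) (r : seq I) (f : I -> R -> C) :
  (forall i, continuousC (f i)) -> continuousC (fun x => \sum_(i <- r) f i x).
Proof.
move=> cf; elim: r => [|j r IH].
  have -> : (fun x => \sum_(i <- [::]) f i x) = (fun=> 0).
    by apply/funext => x; rewrite big_nil.
  exact: continuousC_cst.
have -> : (fun x => \sum_(i <- j :: r) f i x) = (fun x => f j x + \sum_(i <- r) f i x).
  by apply/funext => x; rewrite big_cons.
exact: continuousC_add.
Qed.

Lemma cint_sum v (I : Type) (r : seq I) (f : I -> R -> C) : continuous v ->
  (forall i, continuousC (f i)) ->
  cint v (fun x => \sum_(i <- r) f i x) = \sum_(i <- r) cint v (f i).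
Proof.
move=> cv cf; elim: r => [|i r IH].
  rewrite big_nil /cint; congr (_ +i* _)%C.
    under eq_Rintegral do rewrite big_nil mul0r.
    by rewrite Rintegral_cst// mul0r.
  under eq_Rintegral do rewrite big_nil mul0r.
  by rewrite Rintegral_cst// mul0r.
rewrite big_cons -IH -cint_add//.
  by rewrite /cint; congr (_ +i* _)%C; apply: eq_Rintegral => x _; rewrite big_cons.
exact: continuousC_sum.
Qed.

Lemma eq_cint v f g : (forall x, -1 <= x <= 1 -> f x = g x) -> cint v f = cint v g.
Proof.
move=> fg; rewrite /cint; congr (_ +i* _)%C; apply: eq_Rintegral => x;
  by rewrite inE/= in_itv/= => /fg ->.
Qed.

Lemma sqrt2E x : -1 <= x <= 1 ->
  Num.sqrt (1 - x ^+ 2) ^+ 2 = 1 - x ^+ 2 :> R.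
Proof. by move=> xI; rewrite sqr_sqrtr// subr_ge0; nra. Qed.

Lemma zeta_conj x : -1 <= x <= 1 -> zeta x * conjc (zeta x) = 1.
Proof.
move=> xI; have s2 := sqrt2E xI.
rewrite /zeta /=.
have -> : forall a b c d : R, ((a +i* b) * (c +i* d) = (a * c - b * d) +i* (a * d + b * c))%C by [].
apply/eqP; rewrite eq_complex /= mulrN opprK -!expr2 s2.
by rewrite addrC subrK eqxx /= mulrN mulrC addNr.
Qed.

Lemma circle_conj x : -1 <= x <= 1 -> circle x * conjc (circle x) = 1.
Proof. by move=> xI; rewrite /circle rmorphXn /= -exprMn zeta_conj// expr1n. Qed.

(** With x = cos t, x -> -x is t -> pi - t: evenness of the weight becomes conjugation symmetry of
    the lift, and the moments are real. *)
Lemma circleN x : circle (- x) = conjc (circle x).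
Proof.
rewrite /circle rmorphXn /= /zeta /= sqrrN !expr2.
have M : forall a b c d : R, ((a +i* b) * (c +i* d) = (a * c - b * d) +i* (a * d + b * c))%C by [].
by rewrite !M; congr (_ +i* _)%C; ring.
Qed.

Lemma integral_odd (h : R -> R) : continuous h -> (forall x, h (- x) = - h x) ->
  \int[mu]_(x in `[-1, 1]) h x = 0.
Proof.
move=> ch hN.
have E : \int[mu]_(x in `[-1, 1]) h x = \int[mu]_(x in `[-1, 1]) h (- x).
  have le11 : -1 <= 1 :> R by lra.
  have := @integration_by_substitution_oppr R h (-1) 1 le11.
  rewrite opprK /Rintegral => -> //.
  exact: continuous_subspaceT.
have {}E : \int[mu]_(x in `[-1, 1]) h x = -1 * \int[mu]_(x in `[-1, 1]) h x.
  rewrite -integral_scale// {1}E; apply: eq_Rintegral => x _.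
  by rewrite hN mulN1r.
by move: E; set I := Rintegral _ _ _ => E; lra.
Qed.

(* The moments of the circle lift of v(x) dx, for an even function v; [circle]
   agrees with [circle_map] on [-1, 1] only. *)
Definition moment v (k : nat) : R :=
  \int[mu]_(x in `[-1, 1]) (complex.Re (circle x ^+ k) * v x).

Section even_weight.
Variable v : R -> R.
Hypotheses (cv : continuous v) (vN : forall x, v (- x) = v x).

Lemma cint_circle k : cint v (fun x => circle x ^+ k) = (moment v k)%:C%C.
Proof.
rewrite /cint; congr (_ +i* _)%C; apply: integral_odd.
  by have [_ ?] := continuousC_exp k continuousC_circle; prove_cont.
move=> x; rewrite vN circleN -rmorphXn /= -mulNr; congr (_ * _).
by case: (circle x ^+ k).
Qed.

Lemma cint_circle2 i k :
  cint v (fun x => circle x ^+ i * conjc (circle x) ^+ k) = (moment v (absdiff i k))%:C%C.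
Proof.
have [ki|ik] := leqP k i.
  have -> : absdiff i k = (i - k)%N by rewrite /absdiff; lia.
  rewrite -cint_circle; apply: eq_cint => x xI.
  by rewrite -{1}(subnK ki) exprD -mulrA -exprMn circle_conj// expr1n mulr1.
have -> : absdiff i k = (k - i)%N by rewrite /absdiff; lia.
transitivity (cint v (fun x => conjc (circle x) ^+ (k - i))).
  apply: eq_cint => x xI.
  by rewrite -{1}(subnK (ltnW ik)) exprD mulrCA -exprMn circle_conj// expr1n mulr1.
have := cint_circle (k - i).
have [cr ci] := continuousC_exp (k - i) continuousC_circle.
move=> H; have im0 := congr1 (@complex.Im R) H; rewrite /cint /= in im0.
have realE (a b m : R) : a = m -> b = 0 -> (a +i* b)%C = m%:C%C by move=> -> ->.
apply: realE.
  by apply: eq_Rintegral => x _; rewrite -rmorphXn; case: (circle x ^+ _).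
transitivity (-1 * \int[mu]_(x in `[-1, 1]) (complex.Im (circle x ^+ (k - i)) * v x)).
  rewrite -integral_scale; last by prove_cont.
  apply: eq_Rintegral => x _; rewrite -rmorphXn; case: (circle x ^+ _) => a b /=.
  by rewrite mulN1r mulNr.
by rewrite im0 mulr0.
Qed.

Lemma cint_poly P Q :
  cint v (fun x => P.[circle x] * conjc Q.[circle x]) = herm (moment v) P Q.
Proof.
pose F i k x := P`_i * (map_poly conjc Q)`_k * (circle x ^+ i * conjc (circle x) ^+ k).
have cc i k : continuousC (fun x => circle x ^+ i * conjc (circle x) ^+ k).
  apply: continuousC_mul; apply: continuousC_exp; first exact: continuousC_circle.
  exact: continuousC_conj continuousC_circle.
have cF i k : continuousC (F i k).
  by apply: continuousC_mul (cc i k); exact: continuousC_cst.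
transitivity (cint v (fun x => \sum_(i < size P) \sum_(k < size (map_poly conjc Q)) F i k x)).
  apply: eq_cint => x _.
  have -> : conjc Q.[circle x] = (map_poly conjc Q).[conjc (circle x)].
    by rewrite horner_map.
  rewrite !horner_coef mulr_suml; apply: eq_bigr => i _.
  rewrite mulr_sumr; apply: eq_bigr => k _.
  by rewrite /F; ring.
have cS i : continuousC (fun x => \sum_(k < size (map_poly conjc Q)) F i k x).
  exact: continuousC_sum.
rewrite cint_sum// /herm /coef_fun; apply: eq_bigr => i _.
rewrite cint_sum// mulr_sumr; apply: eq_bigr => k _.
by rewrite cint_scale// cint_circle2 mulrA.
Qed.

Lemma toeplitz_moment p q : toeplitz (moment v) p q =
  \int[mu]_(x in `[-1, 1])
    (complex.Re ((cpoly p).[circle x] * conjc (cpoly q).[circle x]) * v x).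
Proof. by have := cint_poly (cpoly p) (cpoly q); rewrite herm_real /cint => -[]. Qed.

End even_weight.

Lemma integral_gt0 (h : R -> R) (x0 : R) : continuous h ->
  (forall x, -1 <= x <= 1 -> 0 <= h x) -> -1 < x0 < 1 -> 0 < h x0 ->
  0 < \int[mu]_(x in `[-1, 1]) h x.
Proof.
move=> ch h0 x0I hx0.
have h2 : 0 < h x0 / 2 by rewrite divr_gt0.
have /cvgrPdist_lt /(_ _ h2) := ch x0.
rewrite -nbhs_nearE => /nbhs_ballP [d /= d0 dP].
have /andP[x0a x0b] := x0I.
pose e := Num.min (d / 2) (1 - x0).
have e0 : 0 < e by rewrite lt_min divr_gt0// subr_gt0.
have e1 : e <= 1 - x0 by rewrite ge_min lexx orbT.
have ed : e <= d / 2 by rewrite ge_min lexx.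
apply: (@lt_le_trans _ _ (\int[mu]_(x in `[x0, x0 + e]) (h x0 / 2))).
  by rewrite integral_cst_seg ?lerDl ?ltW// addrC addKr mulr_gt0.
apply: (@le_trans _ _ (\int[mu]_(x in `[x0, x0 + e]) h x)).
  apply: integral_le => //; first exact: cont_cst.
  move=> x /andP[xa xb].
  have : `|h x0 - h x| < h x0 / 2.
    by apply: dP; rewrite /ball /= ler0_norm; lra.
  by rewrite ltr_norml => /andP[_]; lra.
rewrite /Rintegral fine_le//.
- by apply: (integrable_fin_num _ (continuous_integrable _ _ ch)); exact: measurable_itv.
- by apply: (integrable_fin_num _ (continuous_integrable _ _ ch)); exact: measurable_itv.
apply: ge0_subset_integral => //.
- by apply/measurable_EFinP; apply: measurable_funTS; exact: continuous_measurable_fun.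
- by move=> x /=; rewrite !in_itv/= => /andP[? ?]; apply/andP; split; lra.
Qed.

(** The support is infinite: the real part 2x^2 - 1 is injective on ]0, 1[, so the points 1/(i+2)
    have more images than [cpoly p] can have roots. *)
Lemma circle_poly_neq0 p : p != 0 ->
  exists2 x : R, -1 < x < 1 & (cpoly p).[circle x] != 0.
Proof.
move=> p0; apply: contrapT => H.
have Z (x : R) : -1 < x < 1 -> root (cpoly p) (circle x).
  by move=> xI; apply: contraT => nr; exfalso; apply: H; exists x.
have cp0 : cpoly p != 0 by rewrite map_poly_eq0.
pose pt (i : nat) : R := (i.+2%:R)^-1.
have ptI i : 0 < pt i < 1.
  by rewrite invr_gt0 ltr0n /= invf_lt1// ltr1n.
have inj : injective (fun i => circle (pt i)).
  move=> i j; have /andP[i0 i1] := ptI i; have /andP[j0 j1] := ptI j.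
  rewrite !circleE => [[E _]||]; [|by apply/andP; split; lra..].
  have : pt i = pt j.
    have : (pt i - pt j) * (pt i + pt j) = 0 by rewrite -subr_sqr; lra.
    move=> /eqP; rewrite mulf_eq0 => /orP[|] /eqP h; lra.
  by move/invr_inj => /eqP; rewrite eqr_nat => /eqP[].
have := @max_poly_roots _ (cpoly p) [seq circle (pt i) | i <- iota 0 (size (cpoly p))] cp0.
rewrite size_map size_iota ltnn map_inj_uniq// iota_uniq => H2.
suff: false by []. apply: H2 => //.
apply/allP => _ /mapP[i _ ->]; apply: Z.
by have /andP[? ?] := ptI i; apply/andP; split; lra.
Qed.

Lemma moment_pos v : continuous v -> (forall x, v (- x) = v x) ->
  (forall x, 0 < v x) -> toeplitz_pos (moment v).
Proof.
move=> cv vN v0 p p0; rewrite toeplitz_moment//.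
have [x0 xI nz] := circle_poly_neq0 p0.
have [cr ci] : continuousC (fun x => (cpoly p).[circle x] * conjc (cpoly p).[circle x]).
  apply: continuousC_mul; last apply: continuousC_conj.
    exact: continuousC_poly continuousC_circle.
  exact: continuousC_poly continuousC_circle.
have E (z : C) : complex.Re (z * conjc z) = complex.Re z ^+ 2 + complex.Im z ^+ 2.
  by case: z => a b /=; ring.
apply: (@integral_gt0 _ x0) => //.
- by prove_cont.
- by move=> x _; rewrite mulr_ge0 ?(ltW (v0 x))// E addr_ge0// sqr_ge0.
- rewrite mulr_gt0// E; case: (_.[_]) nz => a b /=.
  rewrite eq_complex /= negb_and => /orP[h|h].
    by rewrite ltr_pwDl ?sqr_ge0// exprn_even_gt0.
  by rewrite ltr_wpDl ?sqr_ge0// exprn_even_gt0.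
Qed.

Lemma integralC_lift v (v0 : forall x, 0 <= v x) (cv : continuous v) P Q :
  integralC (circle_lift (density v0 cv)) (fun z => P.[z] * conjc Q.[z]) =
  cint v (fun x => P.[circle x] * conjc Q.[circle x]).
Proof.
have [mr mi] : measurableC_fun (fun z : borelC R => P.[z] * conjc Q.[z]).
  apply: measurableC_mul; last apply: measurableC_conj.
    exact: measurableC_poly.
  exact: measurableC_poly.
rewrite /integralC /circle_lift /cint.
rewrite !integral_density_pushforward//; try exact: measurable_circle_map.
by congr (_ +i* _)%C; rewrite /Rintegral; congr fine; apply: eq_integral => x;
  rewrite inE/= in_itv/= => xI; rewrite circle_mapE.
Qed.

Lemma verblunsky_lift v (v0 : forall x, 0 <= v x) (cv : continuous v) n :
  (forall x, v (- x) = v x) -> (forall x, 0 < v x) ->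
  verblunsky (circle_lift (density v0 cv)) n = schur (moment v) n.
Proof.
move=> vN vp; apply: verblunskyE; first exact: moment_pos.
by move=> P Q; rewrite integralC_lift cint_poly.
Qed.

End ComplexIntegral.

(** * Perturbation of the Verblunsky coefficients *)

Section Perturbation.
Context {R : realType}.
Local Notation mu := (@lebesgue_measure R).
Implicit Types (c : R -> nat -> R) (p : R -> {poly R}) (n k : nat).

Lemma cvg_sumf (I : Type) (r : seq I) (F : set_system R) {FF : Filter F}
    (f : I -> R -> R) (l : I -> R) :
  (forall i, f i t @[t --> F] --> l i) ->
  \sum_(i <- r) f i t @[t --> F] --> \sum_(i <- r) l i.
Proof.
move=> fl; elim: r => [|i r IH].
  by rewrite big_nil; under eq_cvg do rewrite big_nil; exact: cvg_cst.
by rewrite big_cons; under eq_cvg do rewrite big_cons; exact: cvgD.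
Qed.

Lemma coef_fun_cvg (F : set_system R) {FF : Filter F} (f : R -> nat -> R) (g : nat -> R)
    p (q : {poly R}) n :
  (forall t, size (p t) <= n)%N -> (size q <= n)%N ->
  (forall k, f t k @[t --> F] --> g k) -> (forall k, (p t)`_k @[t --> F] --> q`_k) ->
  coef_fun (f t) (p t) @[t --> F] --> coef_fun g q.
Proof.
move=> pn qn fg pq; rewrite (coef_fun_wide _ qn).
under eq_cvg do rewrite (coef_fun_wide _ (pn _)).
by apply: cvg_sumf => i; apply: cvgM.
Qed.

Lemma toeplitz_cvg (F : set_system R) {FF : Filter F} c (c0 : nat -> R) p (p0 q : {poly R}) n :
  (forall t, size (p t) <= n)%N -> (size p0 <= n)%N ->
  (forall k, c t k @[t --> F] --> c0 k) -> (forall k, (p t)`_k @[t --> F] --> p0`_k) ->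
  toeplitz (c t) (p t) q @[t --> F] --> toeplitz c0 p0 q.
Proof.
move=> pn p0n cc pp; apply: (coef_fun_cvg pn) => // k.
by apply: (@coef_fun_cvg _ _ _ _ (fun=> q) q (size q)) => // j; exact: cvg_cst.
Qed.

(** Each step of the recursion is rational in the moments, and the limiting denominator is
    positive. *)
Lemma schur_szego_cvg (F : set_system R) {FF : ProperFilter F} c (c0 : nat -> R) n :
  toeplitz_pos c0 -> (forall k, c t k @[t --> F] --> c0 k) ->
  (forall k, (szego (c t) n)`_k @[t --> F] --> (szego c0 n)`_k) /\
  schur (c t) n @[t --> F] --> schur c0 n.
Proof.
move=> cpos cc.
have S m : (forall k, (szego (c t) m)`_k @[t --> F] --> (szego c0 m)`_k) ->
    schur (c t) m @[t --> F] --> schur c0 m.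
  move=> sc; rewrite /schur; apply: cvgM.
    by apply: (@coef_fun_cvg F _ _ _ _ _ m.+1) => //= *; rewrite ?size_szego.
  apply: cvgV; first by rewrite gt_eqF// szego_norm_gt0.
  apply: (@coef_fun_cvg F _ _ _ _ _ m.+1) => // [t||k]; rewrite ?size_poly//.
  rewrite coef_poly; under eq_cvg do rewrite coef_poly.
  by case: ifP => _; [exact: sc|exact: cvg_cst].
suff H : forall k, (szego (c t) n)`_k @[t --> F] --> (szego c0 n)`_k.
  by split => //; exact: S.
elim: n => [k|n IH k]; first exact: cvg_cst.
rewrite szegoS coefB coefXM coefZ coef_poly.
under eq_cvg do rewrite szegoS coefB coefXM coefZ coef_poly.
apply: cvgB; first by case: ifP => _; [exact: cvg_cst|exact: IH].
apply: cvgM; first exact: S.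
by case: ifP => _; [exact: IH|exact: cvg_cst].
Qed.

(* The increment of the Verblunsky coefficient is an exact bilinear expression:
   the orthogonality relations of both families of polynomials cancel all the
   other terms. *)
Lemma schur_increment (c c0 : nat -> R) n : toeplitz_pos c -> toeplitz_pos c0 ->
  (schur c n - schur c0 n) * coef_fun c0 (reverse_poly n (szego c0 n)) =
  toeplitz (fun k => c k - c0 k) (szego c n.+1) (reverse_poly n (szego c0 n)).
Proof.
move=> cpos c0pos; set r := reverse_poly n _.
have sr : (size r <= n.+1)%N by exact: size_poly.
have Z (d : nat -> R) : toeplitz_pos d -> toeplitz d (szego d n.+1) r = 0.
  by move=> dpos; apply: (@toeplitz_low _ _ _ _ n.+1) => // k; exact: szego_orth.
have -> : toeplitz (fun k => c k - c0 k) (szego c n.+1) r =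
    toeplitz c (szego c n.+1) r - toeplitz c0 (szego c n.+1) r.
  rewrite /toeplitz /coef_fun -sumrB; apply: eq_bigr => i _.
  rewrite -mulrBr -sumrB; congr (_ * _); apply: eq_bigr => k _; exact: mulrBr.
rewrite Z// sub0r -[toeplitz c0 _ r]subr0 -(Z c0 c0pos) -toeplitzBl.
set D := szego c n.+1 - szego c0 n.+1.
have lc (d : nat -> R) : (szego d n)`_n = 1.
  by have [/monicP] := szego_monic d n; rewrite lead_coefE => + ps; rewrite ps.
have lcS (d : nat -> R) : (szego d n.+1)`_n.+1 = 1.
  by have [/monicP] := szego_monic d n.+1; rewrite lead_coefE => + ps; rewrite ps.
(* D has degree at most n and r is orthogonal to X, ..., X^n for c0, so the pairing sees only the
   constant coefficient of D, which is the increment sought. *)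
have D0 : D`_0 = schur c0 n - schur c n.
  by rewrite /D !szegoS !coefB !coefXM !coefZ !coef_poly /= subn0 !lc; ring.
have sD : (size D <= n.+1)%N.
  apply/leq_sizeP => j; rewrite leq_eqVlt => /predU1P[<-|nj].
    by rewrite coefB !lcS subrr.
  by rewrite coefB !nth_default ?subrr// size_szego.
rewrite {1}/toeplitz (coef_fun_wide _ sD) big_ord_recl D0 big1 => [|i _].
  rewrite addr0 /absdiff.
  have -> : (fun k => c0 (nat_of_ord (@ord0 n) - k + (k - nat_of_ord (@ord0 n)))%N) = c0.
    by apply/funext => k; rewrite /= sub0n add0n subn0.
  by ring.
have -> : coef_fun (fun k => c0 (absdiff (lift ord0 i) k)) r = toeplitz c0 r 'X^(lift ord0 i).
  by rewrite toeplitzC /toeplitz coef_funXn.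
rewrite toeplitz_reverse ?size_szego//; last by rewrite lift0.
by rewrite szego_orth// ?mulr0// lift0; have := ltn_ord i; lia.
Qed.

(** In the increment formula only the moments form a difference quotient; the polynomial
    [szego (c h) n.+1] merely has to converge as h -> 0. *)
Lemma schur_derive c (dc : nat -> R) n : (forall t, toeplitz_pos (c t)) ->
  (forall k, is_derive (0 : R) 1 (fun t => c t k) (dc k)) ->
  is_derive (0 : R) 1 (fun t => schur (c t) n)
   (toeplitz dc (szego (c 0) n.+1) (reverse_poly n (szego (c 0) n)) /
    coef_fun (c 0) (reverse_poly n (szego (c 0) n))).
Proof.
move=> cpos cd; set r := reverse_poly _ _; set N := coef_fun _ _.
have N0 : N != 0 by rewrite gt_eqF// szego_norm_gt0.
have quot (f : R -> R) (d : R) : is_derive (0 : R) 1 f d <->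
    h^-1 * (f h - f 0) @[h --> 0^'] --> d.
  have E : (fun h : R => h^-1 *: (f (h *: 1 + 0) - f 0)) = (fun h => h^-1 * (f h - f 0)).
    by apply/funext => h; rewrite /GRing.scale /= mulr1 addr0.
  split=> [[df <-]|fd].
    by move: df; rewrite /derivable /derive E.
  split; last by rewrite /derive E; apply/cvg_lim.
  by rewrite /derivable E; apply/cvg_ex; exists d.
have cc k : c h k @[h --> 0^'] --> c 0 k.
  have := (quot _ _).1 (cd k) => H.
  have h0 : h @[h --> (0:R)^'] --> (0 : R) by apply: nbhs_dnbhs.
  have : h * (h^-1 * (c h k - c 0 k)) + c 0 k @[h --> 0^'] --> 0 * dc k + c 0 k.
    by apply: cvgD (cvg_cst _); exact: cvgM.
  rewrite mul0r add0r; apply: cvg_trans; apply: near_eq_cvg; near=> h.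
  by rewrite /= mulrA divff ?mul1r ?subrK//; near: h; exact: nbhs_dnbhs_neq.
apply/quot.
have E h : h^-1 * (schur (c h) n - schur (c 0) n) =
    toeplitz (fun k => h^-1 * (c h k - c 0 k)) (szego (c h) n.+1) r * N^-1.
  have -> : toeplitz (fun k => h^-1 * (c h k - c 0 k)) (szego (c h) n.+1) r =
      h^-1 * toeplitz (fun k => c h k - c 0 k) (szego (c h) n.+1) r.
    rewrite /toeplitz /coef_fun mulr_sumr; apply: eq_bigr => i _.
    by rewrite [RHS]mulrCA [in RHS]mulr_sumr; congr (_ * _); apply: eq_bigr => k _; rewrite mulrCA.
  by rewrite -schur_increment// -/N mulrA mulfK.
under eq_cvg do rewrite E.
apply: cvgM; last exact: cvg_cst.
apply: (@toeplitz_cvg _ _ _ _ _ _ _ n.+2) => [t||k|k]; rewrite ?size_szego//.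
  exact: (quot _ _).1 (cd k).
by have [H _] := schur_szego_cvg n.+1 (cpos 0) cc; exact: H.
Unshelve. all: by end_near. Qed.

(** From e^s (1 - s) <= 1, multiplied by 1 + s > 0, one gets e^s - 1 - s <= s^2 e^s, and e^s <= 2 on
    this range. *)
Lemma expR_quadratic (s : R) : `|s| <= 2^-1 -> `|expR s - 1 - s| <= 2 * s ^+ 2.
Proof.
rewrite ler_norml => /andP[s1 s2].
have e1 := expR_ge1Dx s; rewrite ger0_norm; last by lra.
have e2 := expR_ge1Dx (- s).
have eV : expR s * expR (- s) = 1 by rewrite -expRD subrr expR0.
have e0 := expR_gt0 s.
have H : expR s * (1 - s) <= 1 by rewrite -[leRHS]eV ler_wpM2l// ltW.
have : expR s <= 2 by nra.
nra.
Qed.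

Lemma exp_integral_derive (f b : R -> R) : continuous f -> continuous b ->
  is_derive (0 : R) 1 (fun t => \int[mu]_(x in `[-1, 1]) (f x * expR (t * b x)))
    (\int[mu]_(x in `[-1, 1]) (f x * b x)).
Proof.
move=> cf cb; have le11 : -1 <= 1 :> R by lra.
have [Mf Mf0 fM] := continuous_bounded_seg le11 cf.
have [M M0 bM] := continuous_bounded_seg le11 cb.
set G := fun t => _; set I := Rintegral _ _ _.
have ce (h : R) : continuous (fun x => expR (h * b x)).
  by apply: cont_comp; [prove_cont|exact: continuous_expR].
(* The range of h keeps |h b| <= 1/2; the constant is 2 from [expR_quadratic] times the length 2 of
   the interval. *)
have rem (h : R) : `|h| <= (2 * M)^-1 -> `|G h - G 0 - h * I| <= 4 * Mf * M ^+ 2 * h ^+ 2.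
  move=> hM.
  have -> : G h - G 0 - h * I =
      \int[mu]_(x in `[-1, 1]) (f x * (expR (h * b x) - 1 - h * b x)).
    rewrite /G /I -integral_sub; [|prove_cont..].
    rewrite -integral_scale; [|prove_cont..].
    rewrite -integral_sub; [|prove_cont..].
    by apply: eq_Rintegral => x _; rewrite mul0r expR0; ring.
  have -> : 4 * Mf * M ^+ 2 * h ^+ 2 = (Mf * (2 * (h * M) ^+ 2)) * (1 - -1) by ring.
  apply: integral_norm_le => //; first by prove_cont.
  move=> x xI; rewrite normrM ler_pM ?fM//.
  have hb : `|h * b x| <= `|h| * M by rewrite normrM ler_wpM2l ?bM.
  apply: (le_trans (expR_quadratic _)).
    apply: (le_trans hb); move: hM; rewrite invfM => hM.
    by rewrite -ler_pdivlMr//.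
  rewrite ler_pM2l// -(real_normK (num_real (h * b x))) -(real_normK (num_real (h * M))).
  by rewrite ler_pXn2r ?nnegrE// normrM [`|h * M|]normrM (gtr0_norm M0) -normrM.
have E : (fun h : R => h^-1 *: (G (h *: 1 + 0) - G 0)) = (fun h => h^-1 * (G h - G 0)).
  by apply/funext => h; rewrite /GRing.scale /= mulr1 addr0.
have H : h^-1 * (G h - G 0) @[h --> 0^'] --> I.
  pose K := 4 * Mf * M ^+ 2.
  have K0 : 0 < K by rewrite !mulr_gt0// exprn_gt0.
  apply/cvgrPdist_le => e e0; near=> h.
  have h0 : h != 0 by near: h; exact: nbhs_dnbhs_neq.
  have -> : I - h^-1 * (G h - G 0) = - (h^-1 * (G h - G 0 - h * I)).
    by rewrite [in RHS]mulrBr mulKf// opprB.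
  rewrite normrN normrM normfV ler_pdivrMl ?normr_gt0//.
  apply: (le_trans (rem h _)).
    by near: h; apply: dnbhs0_le; rewrite invr_gt0 mulr_gt0.
  rewrite -/K -(real_normK (num_real h)) expr2 mulrCA ler_pM2l ?normr_gt0//.
  rewrite -ler_pdivlMl//; near: h; apply: dnbhs0_le.
  by rewrite mulr_gt0// invr_gt0.
split; last by rewrite /derive E; apply/cvg_lim.
by rewrite /derivable E; apply/cvg_ex; exists I.
Unshelve. all: by end_near. Qed.

End Perturbation.

(** * The Gibbs family *)

Section Clamp.
Context {R : realType}.
Implicit Types (x : R) (f : R -> R).

(** The projection onto [-1, 1]. Composing with it turns a function continuous on the segment only
    into one continuous everywhere; being odd, it preserves evenness. *)
Definition clamp x : R := (`|x + 1| - `|x - 1|) / 2.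

Lemma clamp_id x : -1 <= x <= 1 -> clamp x = x.
Proof.
move=> /andP[x1 x2]; rewrite /clamp ger0_norm ?ler0_norm; lra.
Qed.

Lemma clampN x : clamp (- x) = - clamp x.
Proof.
have e1 : - x + 1 = - (x - 1) by ring.
have e2 : - x - 1 = - (x + 1) by ring.
rewrite /clamp e1 e2 !normrN.
by rewrite -mulNr opprB.
Qed.

Lemma clamp_itv x : -1 <= clamp x <= 1.
Proof.
have h1 := ler_distD x 1 (-1); have := ler_distD (-x) (-1) 1.
rewrite /clamp; case: (ger0P (x + 1)); case: (ger0P (x - 1)) => *;
  by apply/andP; split; lra.
Qed.

Lemma continuous_clamp f : {within `[-1, 1], continuous f} -> continuous (f \o clamp).
Proof.
move=> /subspace_continuousP cf x.
have cc : continuous clamp.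
  have cn (k : R) : continuous (fun x : R => `|x + k|).
    by apply: cont_comp; [prove_cont|exact: norm_continuous].
  rewrite /clamp; have := cn 1; have := cn (-1) => c1 c2; prove_cont.
have cI : `[-1, 1]%classic (clamp x) by rewrite /= in_itv/= clamp_itv.
apply: (@cvg_comp _ _ _ clamp f); last exact: cf.
move=> U; rewrite /within /= => HU.
have H : nbhs x (clamp @^-1` [set y | `[-1, 1]%classic y -> U y]) := cc x _ HU.
change (nbhs x (clamp @^-1` U)); apply: filterS H => y /= H; apply: H.
by rewrite in_itv/= clamp_itv.
Qed.

End Clamp.

Section Response.
Context {R : realType}.
Local Notation mu := (@lebesgue_measure R).
Variables (B b : R -> R).
Hypotheses (cb : continuous b) (bN : forall x, b (- x) = b x)
  (Bb : forall x, -1 <= x <= 1 -> B x = b x).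

Definition gibbs (t x : R) : R :=
  expR (t * b x) / \int[mu]_(u in `[-1, 1]) expR (t * b u).

Lemma continuous_expRM (t : R) : continuous (fun x => expR (t * b x)).
Proof. by apply: cont_comp; [prove_cont|exact: continuous_expR]. Qed.

Lemma partition_gt0 (t : R) : 0 < \int[mu]_(u in `[-1, 1]) expR (t * b u).
Proof.
apply: (@integral_gt0 _ _ 0) => //; first exact: continuous_expRM.
  by apply/andP; split; lra.
exact: expR_gt0.
Qed.

Lemma gibbs_gt0 t x : 0 < gibbs t x.
Proof. by rewrite divr_gt0 ?expR_gt0// partition_gt0. Qed.

Lemma gibbs_ge0 t x : 0 <= gibbs t x.
Proof. exact: ltW (gibbs_gt0 t x). Qed.

Lemma continuous_gibbs t : continuous (gibbs t).
Proof. have := @continuous_expRM t; rewrite /gibbs => h; prove_cont. Qed.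

Lemma gibbsN t x : gibbs t (- x) = gibbs t x.
Proof. by rewrite /gibbs bN. Qed.

Lemma eta_density t : eta B t = density (gibbs_ge0 t) (@continuous_gibbs t).
Proof.
apply/funext => A; rewrite /eta /density; apply: eq_integral => x.
rewrite inE /= => -[_]; rewrite in_itv/= => xI.
rewrite /gibbs Bb//; congr (_ / _)%:E.
by apply: eq_Rintegral => u; rewrite inE/= in_itv/= => uI; rewrite Bb.
Qed.

Lemma alphaB_schur n t : alphaB B n t = schur (moment (gibbs t)) n.
Proof.
rewrite /alphaB eta_density verblunsky_lift// => x.
  exact: gibbsN.
exact: gibbs_gt0.
Qed.

Lemma gibbs0 : gibbs 0 = fun=> 2^-1.
Proof.
apply/funext => x; rewrite /gibbs mul0r expR0 mul1r; congr (_^-1).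
under eq_Rintegral do rewrite mul0r expR0.
by rewrite integral_cst_seg; lra.
Qed.

Lemma integral_centered (f : R -> R) (m : R) : continuous f ->
  \int[mu]_(x in `[-1, 1]) (f x * ((b x - m) / 2)) =
  2^-1 * \int[mu]_(x in `[-1, 1]) (f x * b x) - m / 2 * \int[mu]_(x in `[-1, 1]) f x.
Proof.
move=> cf; rewrite -!integral_scale; [|prove_cont..].
rewrite -integral_sub; [|prove_cont..].
by apply: eq_Rintegral => x _; field.
Qed.

(** Differentiating the normalising integral as well replaces b by b minus its mean. *)
Lemma moment_gibbs_derive k : is_derive (0 : R) 1 (fun t => moment (gibbs t) k)
  (moment (fun x => (b x - 2^-1 * \int[mu]_(u in `[-1, 1]) b u) / 2) k).
Proof.
have [cr _] := continuousC_exp k (@continuousC_circle R).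
set m := Rintegral _ _ _.
have -> : (fun t => moment (gibbs t) k) =
    (fun t => (\int[mu]_(x in `[-1, 1]) (complex.Re (circle x ^+ k) * expR (t * b x))) *
      (\int[mu]_(u in `[-1, 1]) (1 * expR (t * b u)))^-1).
  apply/funext => t; rewrite mulrC /moment -integral_scale; last first.
    by have := @continuous_expRM t => h; prove_cont.
  apply: eq_Rintegral => x _; rewrite /gibbs mulrA mulrC; congr (_^-1 * _).
  by apply: eq_Rintegral => u _; rewrite mul1r.
have dN := exp_integral_derive cr cb.
have dZ := exp_integral_derive (@cont_cst R 1) cb.
have Z0 : \int[mu]_(u in `[-1, 1]) (1 * expR (0 * b u)) = 2.
  under eq_Rintegral do rewrite mul0r expR0 mulr1.
  by rewrite integral_cst_seg; lra.
have dZV : is_derive (0 : R) 1 (fun t => (\int[mu]_(u in `[-1, 1]) (1 * expR (t * b u)))^-1)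
    (- (2 ^- 2) * m).
  have Z1 : \int[mu]_(u in `[-1, 1]) (1 * expR (0 * b u)) != 0 by rewrite Z0 pnatr_eq0.
  apply: is_derive_eq (is_deriveV Z1 dZ) _; rewrite Z0 /GRing.scale /=; congr (_ * _).
  by apply: eq_Rintegral => x _; rewrite mul1r.
apply: is_derive_eq (D_mul dN dZV) _; rewrite Z0.
under [X in X * (- _ * _)]eq_Rintegral do rewrite mul0r expR0 mulr1.
rewrite /moment.
by rewrite integral_centered//; field.
Qed.

Definition uniform_moment : nat -> R := moment (fun=> 2^-1).

Lemma uniform_moment_pos : toeplitz_pos uniform_moment.
Proof. by apply: moment_pos => //; exact: cont_cst. Qed.

Lemma alphaB_derive n : is_derive (0 : R) 1 (alphaB B n)
  ((\int[mu]_(x in `[-1, 1])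
     (complex.Re ((cpoly (szego uniform_moment n.+1)).[circle x] *
       conjc (cpoly (reverse_poly n (szego uniform_moment n))).[circle x]) * b x)) /
   (2 * coef_fun uniform_moment (reverse_poly n (szego uniform_moment n)))).
Proof.
have -> : alphaB B n = fun t => schur (moment (gibbs t)) n.
  by apply/funext => t; exact: alphaB_schur.
have pos t : toeplitz_pos (moment (gibbs t)).
  apply: moment_pos; [exact: continuous_gibbs|exact: gibbsN|exact: gibbs_gt0].
apply: is_derive_eq (schur_derive n pos moment_gibbs_derive) _.
rewrite gibbs0 -/uniform_moment invfM mulrA; congr (_ / _).
have cv : continuous (fun x => (b x - 2^-1 * \int[mu]_(u in `[-1, 1]) b u) / 2) by prove_cont.
rewrite toeplitz_moment//; last by move=> x; rewrite bN.
set p := szego _ n.+1; set r := reverse_poly n _.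
(* The mean of b drops out, since Phi_(n+1) is orthogonal to the reversal of Phi_n, whose degree is
   at most n. *)
have Z : toeplitz uniform_moment p r = 0.
  apply: (@toeplitz_low _ _ _ _ n.+1); first exact: size_poly.
  by move=> k; apply: szego_orth; exact: uniform_moment_pos.
move: Z; rewrite toeplitz_moment//; last exact: cont_cst.
have [cr _] : continuousC (fun x => (cpoly p).[circle x] * conjc (cpoly r).[circle x]).
  apply: continuousC_mul; last apply: continuousC_conj.
    exact: continuousC_poly continuousC_circle.
  exact: continuousC_poly continuousC_circle.
rewrite integral_centered// => Z.
have {}Z : \int[mu]_(x in `[-1, 1]) complex.Re ((cpoly p).[circle x] * conjc (cpoly r).[circle x]) = 0.
  move: Z; under eq_Rintegral do rewrite mulrC.
  by rewrite integral_scale// => /eqP; rewrite mulf_eq0 invr_eq0 pnatr_eq0 => /eqP.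
by rewrite Z mulr0 subr0 mulrC.
Qed.

End Response.

(** * The uniform measure *)

Section UniformWeight.
Context {R : realType}.
Local Notation C := R[i].
Local Notation mu := (@lebesgue_measure R).
Implicit Types (x : R) (k n : nat) (p q : {poly R}).

Local Notation s x := (Num.sqrt (1 - x ^+ 2)).

Definition zeta_re k x : R := complex.Re (zeta x ^+ k).
Definition zeta_im k x : R := complex.Im (zeta x ^+ k).

Lemma zeta_reS k x : zeta_re k.+1 x = x * zeta_re k x - s x * zeta_im k x.
Proof. by rewrite /zeta_re exprS ReM. Qed.

Lemma zeta_imS k x : zeta_im k.+1 x = x * zeta_im k x + s x * zeta_re k x.
Proof. by rewrite /zeta_im exprS ImM. Qed.

Lemma continuous_zeta_re k : continuous (zeta_re k).
Proof. by have [] := continuousC_exp k (@continuousC_zeta R). Qed.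

Lemma continuous_zeta_im k : continuous (zeta_im k).
Proof. by have [] := continuousC_exp k (@continuousC_zeta R). Qed.

Lemma sqrt_1mx2_derive x : -1 < x < 1 ->
  is_derive x 1 (fun y : R => s y) (- x / s x).
Proof.
move=> xI; have s0 := sqrt_1mx2_gt0 xI.
have p0 : 0 < 1 - x ^+ 2 by move: s0; rewrite sqrtr_gt0.
have d : is_derive x 1 (fun y : R => 1 - y ^+ 2) (- (2 * x)).
  apply: is_derive_eq (D_add (D_cst 1 x) (D_opp (D_exp 2 (D_id x)))) _.
  by rewrite /= expr1; ring.
apply: is_derive_eq (D_comp d (is_derive1_sqrt p0)) _.
by move: s0; move: (Num.sqrt _) => S S0; field; rewrite gt_eqF.
Qed.

Lemma zeta_derive k x : -1 < x < 1 ->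
  is_derive x 1 (zeta_re k) (k%:R * zeta_im k x / s x) /\
  is_derive x 1 (zeta_im k) (- (k%:R * zeta_re k x / s x)).
Proof.
move=> xI; have ds := sqrt_1mx2_derive xI; have s0 := sqrt_1mx2_gt0 xI.
have sn : s x != 0 by rewrite gt_eqF.
elim: k => [|k [dr di]].
  rewrite !mul0r oppr0; split.
    by rewrite (_ : zeta_re 0 = fun=> 1)//; exact: D_cst.
  by rewrite (_ : zeta_im 0 = fun=> 0)//; exact: D_cst.
rewrite zeta_reS zeta_imS natD1; split.
  rewrite (_ : zeta_re k.+1 = fun x => x * zeta_re k x - s x * zeta_im k x); last first.
    by apply/funext => y; exact: zeta_reS.
  apply: is_derive_eq (D_add (D_mul (D_id x) dr) (D_opp (D_mul ds di))) _.
  by field.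
rewrite (_ : zeta_im k.+1 = fun x => x * zeta_im k x + s x * zeta_re k x); last first.
  by apply/funext => y; exact: zeta_imS.
apply: is_derive_eq (D_add (D_mul (D_id x) di) (D_mul ds dr)) _.
by field.
Qed.

(* With x = cos t, [zeta_re k] is cos(k t) and [zeta_im k] is sin(k t); integrate
   ((1 - x^2) P' cos(k t))' and use the Legendre equation. *)
Lemma legendre_zeta_integral k :
  \int[mu]_(x in `[-1, 1]) (s x * zeta_im k.+1 x * (legendre k.+1)^`().[x]) =
  k.+2%:R * \int[mu]_(x in `[-1, 1]) ((legendre k.+1).[x] * zeta_re k.+1 x).
Proof.
set P := legendre k.+1.
have cr := @continuous_zeta_re k.+1; have ci := @continuous_zeta_im k.+1.
pose F x := ((1 - 'X ^+ 2) * P^`()).[x] * zeta_re k.+1 x.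
pose f x := k.+1%:R * (s x * zeta_im k.+1 x * P^`().[x] -
  k.+2%:R * (P.[x] * zeta_re k.+1 x)).
have cf : continuous f by rewrite /f; prove_cont.
have : \int[mu]_(x in `[-1, 1]) f x = F 1 - F (-1).
  apply: (@FTC_seg _ _ _ _ F); first lra.
  - exact: continuous_subspaceT.
  - move=> x _; suff: continuous F by exact.
    by rewrite /F; prove_cont.
  - move=> x xI; have [dr _] := zeta_derive k.+1 xI; have s0 := sqrt_1mx2_gt0 xI.
    have sn : s x != 0 by rewrite gt_eqF.
    have s2 : s x ^+ 2 = 1 - x ^+ 2 by rewrite sqrt2E//; lra.
    apply: is_derive_eq (D_mul (D_poly _ (D_id x)) dr) _.
    have ode : ((1 - 'X ^+ 2) * P^`())^`().[x] = - (k.+1%:R * k.+2%:R) * P.[x].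
      by rewrite legendre_ODE natrM mulNr hornerN !hornerM !horner_natr mulNr.
    have dE : ((1 - 'X ^+ 2) * P^`()).[x] = s x ^+ 2 * P^`().[x].
      by rewrite s2 !hornerE.
    rewrite mulr1 ode dE /f.
    by move: (k.+1%:R : R) (k.+2%:R : R) => K K2; field.
have -> : F 1 = 0 by rewrite /F !hornerE /= expr1n subrr !mul0r.
have -> : F (-1) = 0 by rewrite /F !hornerE /= sqrrN expr1n subrr !mul0r.
rewrite subrr /f integral_scale; last by prove_cont.
move=> /eqP; rewrite mulf_eq0 pnatr_eq0 /= integral_sub; [|prove_cont..].
by rewrite subr_eq0 integral_scale; [move/eqP|prove_cont].
Qed.

Lemma reverse_circle n p x : (size p <= n.+1)%N -> -1 <= x <= 1 ->
  (cpoly (reverse_poly n p)).[circle x] = circle x ^+ n * conjc (cpoly p).[circle x].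
Proof.
move=> pn xI; have cc := circle_conj xI.
have z0 : circle x != 0.
  by apply: contraTneq isT => z0; move: cc; rewrite z0 mul0r => /esym/eqP; rewrite oner_eq0.
rewrite -reverse_cpoly// /reversed; congr (_ * conjc _.[_]).
by apply: (@mulIf _ (conjc (circle x))); rewrite ?conjc_eq0 ?mulVf ?conjc_eq0.
Qed.

(* zeta^k times this is, up to a constant, z Phi_(k-1)(z) for the lift of the
   uniform measure: the closed form that makes the case t = 0 explicit. *)
Definition legendre_wave k x : C :=
  (k%:R * (legendre k).[x] +i* (s x * (legendre k)^`().[x]))%C.

Lemma conjc_scaleX (beta : R) (z w : C) k :
  conjc (beta%:C%C * z ^+ k * w) = beta%:C%C * conjc z ^+ k * conjc w.
Proof.
have M (u v : C) : conjc (u * v) = conjc u * conjc v by rewrite rmorphM.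
have X (u : C) : conjc (u ^+ k) = conjc u ^+ k by rewrite rmorphXn.
by rewrite !M X conjc_real.
Qed.

Lemma cpoly_szegoS c n (z : C) : (cpoly (szego c n.+1)).[z] =
  z * (cpoly (szego c n)).[z] -
  (schur c n)%:C%C * (cpoly (reverse_poly n (szego c n))).[z].
Proof.
rewrite szegoS /cpoly rmorphB /= rmorphM /= map_polyX map_polyZ /=.
by rewrite hornerD hornerN hornerM hornerX hornerZ.
Qed.

Lemma circle_zeta k x : circle x ^+ k = zeta x ^+ k * zeta x ^+ k.
Proof. by rewrite /circle -exprM mul2n -addnn exprD. Qed.

(* The real part is P_(k+1) = x P_k - (1 - x^2) P_k' / (k + 1), the imaginary
   part P_(k+1)' = x P_k' + (k + 1) P_k. *)
Lemma legendre_waveS k x : -1 <= x <= 1 ->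
  zeta x * (k.+2%:R * (legendre k.+1).[x] +i* (s x * (legendre k.+1)^`().[x]))%C =
  legendre_wave k.+2 x.
Proof.
move=> xI; have s2 := sqrt2E xI.
have M : forall a b c d : R, ((a +i* b) * (c +i* d) = (a * c - b * d) +i* (a * d + b * c))%C by [].
rewrite /zeta /legendre_wave M; congr (_ +i* _)%C.
  rewrite [s x * (_ * _)]mulrA -expr2 s2 legendre_derivCE legendreSE nat2p3.
  by rewrite !natD1; ring.
by rewrite [in RHS]legendre_derivSE; ring.
Qed.

Lemma coef_moment (v : R -> R) q : continuous v -> (forall x, v (- x) = v x) ->
  coef_fun (moment v) q = \int[mu]_(x in `[-1, 1]) (complex.Re (cpoly q).[circle x] * v x).
Proof.
move=> cv vN; rewrite -toeplitz1 toeplitz_moment//; apply: eq_Rintegral => x _.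
by rewrite expr0 /cpoly rmorph1 hornerC rmorph1 mulr1.
Qed.

Local Notation c0 := (@uniform_moment R).

(** The factor beta is left undetermined: it cancels in [schur_uniform] and in the final
    derivative. *)
Definition szego_wave n (beta : R) : Prop := forall x, -1 <= x <= 1 ->
  circle x * (cpoly (szego c0 n)).[circle x] =
    beta%:C%C * zeta x ^+ n.+1 * legendre_wave n.+1 x.

Lemma reverse_szego_wave n beta x : szego_wave n beta -> -1 <= x <= 1 ->
  (cpoly (reverse_poly n (szego c0 n))).[circle x] =
    beta%:C%C * zeta x ^+ n.+1 * conjc (legendre_wave n.+1 x).
Proof.
move=> H xI; rewrite reverse_circle ?size_szego//.
have cc := circle_conj xI; have zz := zeta_conj xI.
set p := cpoly _ in H *.
have -> : circle x ^+ n * conjc p.[circle x] =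
    circle x ^+ n.+1 * conjc (circle x * p.[circle x]).
  by rewrite rmorphM exprSr -mulrA [circle x * (_ * _)]mulrA cc mul1r.
rewrite H// conjc_scaleX circle_zeta.
set w := conjc (legendre_wave _ _).
transitivity (beta%:C%C * zeta x ^+ n.+1 * w * (zeta x * conjc (zeta x)) ^+ n.+1).
  by rewrite exprMn; ring.
by rewrite zz expr1n mulr1.
Qed.

Lemma Re_wave (beta : R) k x (w : C) :
  complex.Re (beta%:C%C * zeta x ^+ k * w) =
  beta * (zeta_re k x * complex.Re w - zeta_im k x * complex.Im w).
Proof.
rewrite /zeta_re /zeta_im; case: (zeta x ^+ k) => a b; case: w => c d /=; ring.
Qed.

(** With k = n + 1, [legendre_zeta_integral] reduces both integrals to one number I: the numerator
    is (beta/2)(k - (k+1)) I, the denominator (beta/2)(k + (k+1)) I. That I is nonzero follows from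
    positivity of the denominator. *)
Lemma schur_uniform n beta : szego_wave n beta ->
  schur c0 n = - ((n.+1).*2.+1)%:R^-1.
Proof.
move=> H; have Npos := szego_norm_gt0 (@uniform_moment_pos R) n.
have cv : continuous (fun _ : R => 2^-1 : R) by exact: cont_cst.
have cr := @continuous_zeta_re n.+1; have ci := @continuous_zeta_im n.+1.
pose P : {poly R} := legendre n.+1.
pose I := \int[mu]_(x in `[-1, 1]) (P.[x] * zeta_re n.+1 x).
have IL := legendre_zeta_integral n; rewrite -/P -/I in IL.
have num : coef_fun (c0 \o S) (szego c0 n) = - (beta / 2) * I.
  rewrite -coef_funXl coef_moment//.
  transitivity (\int[mu]_(x in `[-1, 1]) (beta / 2 * n.+1%:R * (P.[x] * zeta_re n.+1 x) -
      beta / 2 * (s x * zeta_im n.+1 x * P^`().[x]))).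
    apply: eq_Rintegral => x; rewrite inE/= in_itv/= => xI.
    rewrite /cpoly rmorphM /= map_polyX hornerM hornerX H// Re_wave /= -/P.
    by move: (n.+1%:R : R) => K; field.
  rewrite integral_sub; [|prove_cont..].
  rewrite !integral_scale; [|prove_cont..].
  by rewrite IL -/I [n.+2%:R]natD1; ring.
have den : coef_fun c0 (reverse_poly n (szego c0 n)) =
    beta / 2 * ((n.+1).*2.+1)%:R * I.
  rewrite coef_moment//.
  transitivity (\int[mu]_(x in `[-1, 1]) (beta / 2 * n.+1%:R * (P.[x] * zeta_re n.+1 x) +
      beta / 2 * (s x * zeta_im n.+1 x * P^`().[x]))).
    apply: eq_Rintegral => x; rewrite inE/= in_itv/= => xI.
    rewrite (reverse_szego_wave H)// Re_wave /= -/P.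
    by move: (n.+1%:R : R) => K; field.
  rewrite integral_add; [|prove_cont..].
  rewrite !integral_scale; [|prove_cont..].
  by rewrite IL -/I [n.+2%:R]natD1 nat2p1; ring.
rewrite /schur num den; rewrite den in Npos.
have : beta / 2 * ((n.+1).*2.+1)%:R * I != 0 by rewrite gt_eqF.
rewrite !mulf_eq0 !negb_or => /andP[/andP[/andP[b0 _] k0] I0].
by move: k0; move: (_%:R : R) => K k0; field; rewrite b0 k0 I0.
Qed.

Lemma szegoS_wave n beta x : szego_wave n beta -> -1 <= x <= 1 ->
  (cpoly (szego c0 n.+1)).[circle x] = beta%:C%C * zeta x ^+ n.+1 *
    (legendre_wave n.+1 x +
     (((n.+1).*2.+1)%:R^-1)%:C%C * conjc (legendre_wave n.+1 x)).
Proof.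
move=> H xI; have N (a : R) : (- a)%:C%C = - a%:C%C :> C by rewrite rmorphN.
rewrite cpoly_szegoS (schur_uniform H) (H _ xI) (reverse_szego_wave H xI) N mulNr opprK.
set l := (_^-1)%:C%C; set bC := (beta%:C)%C; set w := conjc _.
by ring.
Qed.

Lemma szego_wave_exists n : exists2 beta, beta != 0 & szego_wave n beta.
Proof.
have realE (a b d : R) : a%:C%C * (b +i* d)%C = ((a * b) +i* (a * d))%C.
  by apply/eqP; rewrite eq_complex /= !mul0r subr0 addr0 !eqxx.
elim: n => [|n [beta b0 H]].
  exists 1; first exact: oner_neq0.
  move=> x xI; rewrite /= /cpoly rmorph1 hornerC mulr1 mul1r expr1 /circle expr2.
  congr (_ * _); rewrite /legendre_wave legendre1 !hornerE derivX hornerC.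
  by rewrite mulr1.
have K0 : ((n.+1).*2.+1)%:R != 0 :> R by rewrite natS_neq0.
exists (beta * ((n.+1).*2%:R / ((n.+1).*2.+1)%:R)).
  by rewrite !mulf_neq0// ?invr_neq0// pnatr_eq0.
move=> x xI; rewrite (szegoS_wave H)// -(legendre_waveS _ xI).
rewrite {1}/circle [zeta x ^+ n.+2]exprS.
set z := zeta x ^+ n.+1; set w := legendre_wave _ _.
set w' := (_ +i* _)%C.
(* With k = n + 1, adding conj(w)/(2k+1) scales the real part by (2k+2)/(2k+1) and the imaginary
   part by 2k/(2k+1). Factoring out the latter turns k P_k into (k+1) P_k, as [legendre_waveS]
   requires. *)
have E : w + ((((n.+1).*2.+1)%:R^-1 : R)%:C)%C * conjc w =
    (((n.+1).*2%:R / ((n.+1).*2.+1)%:R : R)%:C)%C * w'.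
  rewrite /w /w' /legendre_wave !realE.
  have D (a b d e : R) : ((a +i* b) + (d +i* e) = (a + d) +i* (b + e))%C by [].
  rewrite /= D; congr (_ +i* _)%C.
    by move: K0; rewrite nat2p1 natD2 [n.+2%:R]natD1; move: (n.+1%:R : R) => K K0; field.
  by move: K0; rewrite nat2p1 natD2; move: (n.+1%:R : R) => K K0; field.
have M (a d : R) : (a * d)%:C%C = a%:C%C * d%:C%C :> C by rewrite rmorphM.
rewrite E M; set l := (_ / _)%:C%C; set bC := (beta%:C)%C.
by ring.
Qed.

Theorem alphaB_uniform_derive (B b : R -> R) n : continuous b ->
  (forall x, b (- x) = b x) -> (forall x, -1 <= x <= 1 -> B x = b x) ->
  is_derive (0 : R) 1 (alphaB B n) (((n.+1).*2.+1)%:R^-1 *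
    \int[mu]_(x in `[-1, 1]) (b x * (n.+1%:R * n.+2%:R * (legendre n.+1).[x] ^+ 2 -
      (1 - x ^+ 2) * (legendre n.+1)^`().[x] ^+ 2))).
Proof.
move=> cb bN Bb; have [beta b0 H] := szego_wave_exists n.
apply: is_derive_eq (alphaB_derive cb bN Bb n) _.
set P := legendre n.+1; set r := reverse_poly n _; set k : R := n.+1%:R.
have K0 : ((n.+1).*2.+1)%:R != 0 :> R by rewrite natS_neq0.
have k0 : k != 0 by rewrite natS_neq0.
have prodE x (u w : C) : -1 <= x <= 1 ->
    complex.Re ((beta%:C%C * zeta x ^+ n.+1 * u) * conjc (beta%:C%C * zeta x ^+ n.+1 * w)) =
    beta ^+ 2 * complex.Re (u * conjc w).
  move=> xI; rewrite conjc_scaleX.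
  have -> : beta%:C%C * zeta x ^+ n.+1 * u * (beta%:C%C * conjc (zeta x) ^+ n.+1 * conjc w) =
    (zeta x * conjc (zeta x)) ^+ n.+1 * ((beta ^+ 2)%:C%C * (u * conjc w)).
    by rewrite exprMn rmorphXn /=; ring.
  by rewrite zeta_conj// expr1n mul1r ReM /= mul0r subr0.
have s2 x : -1 <= x <= 1 -> s x ^+ 2 = 1 - x ^+ 2 by exact: sqrt2E.
(* The phases cancel, leaving Re(w^2) + |w|^2/(2k+1) for the wave w; its k^2 P^2 and (1-x^2) P'^2
   parts combine to 2k/(2k+1) times the bracket. *)
have num : \int[mu]_(x in `[-1, 1])
     (complex.Re ((cpoly (szego c0 n.+1)).[circle x] * conjc (cpoly r).[circle x]) * b x) =
    beta ^+ 2 * (2 * k / ((n.+1).*2.+1)%:R) *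
    \int[mu]_(x in `[-1, 1]) (b x * (n.+1%:R * n.+2%:R * P.[x] ^+ 2 -
      (1 - x ^+ 2) * P^`().[x] ^+ 2)).
  rewrite -integral_scale; last by prove_cont.
  apply: eq_Rintegral => x; rewrite inE/= in_itv/= => xI.
  rewrite (szegoS_wave H)// (reverse_szego_wave H)// prodE// conjcK -(s2 _ xI) ReM /= -/P.
  move: K0; rewrite nat2p1 [n.+2%:R]natD1 -/k; move: k {k0} => K K0.
  by field.
(* By the Legendre equation the integral of (1-x^2) P'^2 is k(k+1) times that of P^2, so half of k^2
   + k(k+1) meets the norm 2/(2k+1) and gives k. *)
have den : coef_fun c0 r = beta ^+ 2 * k.
  rewrite szego_norm; last exact: uniform_moment_pos.
  rewrite toeplitz_moment//; last exact: cont_cst.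
  have P2 : poly_int (P * P) = _ := legendre_norm n.+1.
  have PP : poly_int (P^`() * ((1 - 'X ^+ 2) * P^`())) = k * n.+2%:R * poly_int (P * P).
    have := poly_int_deriv (P * ((1 - 'X ^+ 2) * P^`())).
    have e1 : (1 - 'X ^+ 2).[1] = 0 :> R by rewrite !hornerE /= expr1n subrr.
    have eN1 : (1 - 'X ^+ 2).[-1] = 0 :> R by rewrite !hornerE /= sqrrN expr1n subrr.
    rewrite !hornerM e1 eN1 !mul0r !mulr0 subrr.
    have -> : (P * ((1 - 'X ^+ 2) * P^`()))^`() =
        P^`() * ((1 - 'X ^+ 2) * P^`()) - (n.+1 * n.+2)%:R * (P * P).
      by rewrite derivM legendre_ODE -/P; move: (_%:R : {poly R}) P^`() => m P'; ring.
    by rewrite poly_intB poly_intMn natrM => /eqP; rewrite subr_eq0 => /eqP.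
  transitivity (2^-1 * beta ^+ 2 * (k ^+ 2 * poly_int (P * P) +
      poly_int (P^`() * ((1 - 'X ^+ 2) * P^`())))); last first.
    rewrite PP P2 [n.+2%:R]natD1; move: K0; rewrite nat2p1 -/k; move: k {k0 PP num} => K K0.
    by field.
  rewrite /poly_int -!integral_scale; [|exact: continuous_poly..].
  rewrite -integral_add; [|prove_cont; exact: continuous_poly..].
  rewrite -integral_scale; last by prove_cont; exact: continuous_poly.
  apply: eq_Rintegral => x; rewrite inE/= in_itv/= => xI.
  set p := cpoly _.
  have -> : p.[circle x] * conjc p.[circle x] =
      (circle x * p.[circle x]) * conjc (circle x * p.[circle x]).
    rewrite [conjc (_ * _)]rmorphM mulrACA; have -> := circle_conj xI.
    by rewrite mul1r.
  rewrite (H _ xI) prodE// ReM /= -/P !hornerM.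
  have -> : (1 - 'X ^+ 2).[x] = s x ^+ 2 by rewrite (s2 _ xI) !hornerE.
  by field.
rewrite num den -/k -/P; move: (Rintegral _ _ _) => I.
move: K0 k0; move: (_%:R : R) k {num den} => K k K0 k0.
by field; rewrite K0 k0 b0.
Qed.

End UniformWeight.

(** * Asymptotics *)

Section Asymptotics.
Context {R : realType}.

Lemma inv_odd_cvg : (n.*2.+1%:R)^-1 @[n --> \oo] --> (0 : R).
Proof.
apply/cvgrPdist_le => e e0; near=> n.
rewrite sub0r normrN normfV ger0_norm// invf_ple ?posrE//.
have : e^-1 <= n%:R by near: n; exact: nbhs_infty_ger.
by move/le_trans; apply; rewrite ler_nat -addnn; lia.
Unshelve. all: by end_near. Qed.

Lemma ln_div_odd_cvg : ln n%:R / n.*2.+1%:R @[n --> \oo] --> (0 : R).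
Proof.
apply/cvgrPdist_le => e e0; near=> n.
have n0 : (0 : R) < n%:R by rewrite ltr0n; near: n; exact: nbhs_infty_gt.
have n1 : (1 : R) <= n%:R by rewrite ler1n -(ltr0n R).
have s0 : 0 < Num.sqrt (n%:R : R) by rewrite sqrtr_gt0.
have s2 : Num.sqrt (n%:R : R) ^+ 2 = n%:R by rewrite sqr_sqrtr// ltW.
have l0 : 0 <= ln (n%:R : R) by exact: ln_ge0.
have l1 : ln (n%:R : R) <= 2 * Num.sqrt n%:R.
  have -> : ln (n%:R : R) = 2 * ln (Num.sqrt n%:R) by rewrite -{1}s2 lnXn// mulr_natl.
  by rewrite ler_pM2l// ltW// ln_sublinear.
have es : e^-1 <= Num.sqrt (n%:R : R).
  rewrite -(@ler_pXn2r _ 2) ?nnegrE ?invr_ge0 ?(ltW e0) ?sqrtr_ge0// s2.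
  by near: n; exact: nbhs_infty_ger.
rewrite sub0r normrN ger0_norm ?divr_ge0// ler_pdivrMr// nat2p1 -[in leRHS]s2.
have : 1 <= e * Num.sqrt (n%:R : R) by rewrite -ler_pdivrMl// mulr1.
by move: (Num.sqrt _) (ln _) s0 l1 => S l S0 l1 h; nra.
Unshelve. all: by end_near. Qed.

(** Everything is expanded through n/(2n+1) = 1/2 - i/2 with i = 1/(2n+1). Since n S_n grows like
    log n, the correction also needs log n / (2n+1) -> 0. *)
Lemma response_asymptotics (S M : nat -> R) (a g A : R) :
  n%:R * S n - 2 / pi ^+ 2 * ln n%:R @[n --> \oo] --> 2 / pi ^+ 2 * g ->
  M n @[n --> \oo] --> A ->
  n%:R ^+ 2 * (n.*2.+1%:R^-1 * (2^-1 * (a * (pi * S n) + 2 / n.*2.+1%:R * M n))) -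
    (a / (2 * pi) * ln n%:R + (a * g / (2 * pi) + 4^-1 * A)) @[n --> \oo] --> (0 : R).
Proof.
move=> HS HM; have p0 := @pi_gt0 R.
pose i n : R := n.*2.+1%:R^-1.
have ci : i n @[n --> \oo] --> (0 : R) := inv_odd_cvg.
have cl := ln_div_odd_cvg.
have cr : 2^-1 - 2^-1 * i n @[n --> \oo] --> (2^-1 - 2^-1 * 0 : R).
  by apply: cvgB; [exact: cvg_cst|apply: cvgM => //; exact: cvg_cst].
rewrite mulr0 subr0 in cr.
pose t n := n%:R * S n - 2 / pi ^+ 2 * ln n%:R.
have E : (fun n => n%:R ^+ 2 * (n.*2.+1%:R^-1 * (2^-1 * (a * (pi * S n) + 2 / n.*2.+1%:R * M n))) -
    (a / (2 * pi) * ln n%:R + (a * g / (2 * pi) + 4^-1 * A))) =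
  (fun n => a * pi / 4 * (t n - 2 / pi ^+ 2 * g) -
     a * pi / 4 * (t n * i n + 2 / pi ^+ 2 * (ln n%:R / n.*2.+1%:R)) +
     ((2^-1 - 2^-1 * i n) * (2^-1 - 2^-1 * i n) * M n - 4^-1 * A)).
  apply/funext => n; rewrite /t /i nat2p1.
  have k0 : 2 * n%:R + 1 != 0 :> R by rewrite -nat2p1 natS_neq0.
  move: p0 k0; move: (pi : R) (n%:R : R) (S n) (M n) => p k s m p0 k0.
  by field; rewrite k0 gt_eqF.
rewrite E.
have -> : (0 : R) = a * pi / 4 * (2 / pi ^+ 2 * g - 2 / pi ^+ 2 * g) -
     a * pi / 4 * (2 / pi ^+ 2 * g * 0 + 2 / pi ^+ 2 * 0) +
     (2^-1 * 2^-1 * A - 4^-1 * A).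
  have -> : 4^-1 = 2^-1 * 2^-1 :> R by field.
  by ring.
apply: cvgD; last first.
  by apply: cvgB; [apply: cvgM HM; exact: cvgM|exact: cvg_cst].
apply: cvgB; apply: cvgM; try exact: cvg_cst.
  by apply: cvgB; [exact: HS|exact: cvg_cst].
apply: cvgD; first exact: cvgM.
by apply: cvgM => //; exact: cvg_cst.
Qed.

End Asymptotics.

(** * Green's identity for B and P_n^2 *)

Section ByParts.
Context {R : realType}.
Local Notation mu := (@lebesgue_measure R).
Variables (B J : R -> R) (a : R).
Hypotheses (Bcont : {within `[-1, 1], continuous B})
  (BC2 : C2_oo B (-1) 1)
  (Bright : (1 - x ^+ 2) * derive1 B x @[x --> 1^'-] --> (0 : R))
  (Bleft : (1 - x ^+ 2) * derive1 B x @[x --> (-1)^'+] --> (0 : R))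
  (Jcont : {within `[-1, 1], continuous J})
  (LB : forall x : R, x \in `]-1, 1[ ->
    legendre_op B x = a / Num.sqrt (1 - x ^+ 2) + J x).
Local Notation b := (B \o clamp).
Local Notation j := (J \o clamp).

Let cb : continuous b. Proof. exact: continuous_clamp. Qed.
Let cj : continuous j. Proof. exact: continuous_clamp. Qed.

Lemma integral_oo_cc (f : R -> R) : continuous f ->
  \int[mu]_(x in `]-1, 1[) f x = \int[mu]_(x in `[-1, 1]) f x.
Proof.
move=> cf; have fi := continuous_integrable (-1) 1 cf.
rewrite Rintegral_itv_bndo_bndc ?Rintegral_itv_obnd_cbnd//.
  apply: integrableS fi => // x /=.
  by rewrite !in_itv/= => /andP[/ltW -> ->].
apply: integrableS fi => //; exact: subset_itv_oo_cc.
Qed.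

Lemma legendre_by_parts n :
  \int[mu]_(x in `[-1, 1]) (b x * (n%:R * n.+1%:R * (legendre n).[x] ^+ 2 -
      (1 - x ^+ 2) * (legendre n)^`().[x] ^+ 2)) =
  2^-1 * (a * (pi * \sum_(k < n.+1) cbin2 k * cbin2 (n - k)) +
     \int[mu]_(x in `[-1, 1]) (j x * (legendre n).[x] ^+ 2)).
Proof.
set P := legendre n.
pose h1 x := b x * (n%:R * n.+1%:R * P.[x] ^+ 2 - (1 - x ^+ 2) * P^`().[x] ^+ 2) -
  2^-1 * (j x * P.[x] ^+ 2).
pose h2 x := - (a / 2) * P.[x] ^+ 2 / Num.sqrt (1 - x ^+ 2).
(* Inside the interval f is (B L(P^2) - P^2 LB)/2, split into a continuous part and the arcsine
   singularity so that each is known to be integrable. *)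
pose f x := h1 x + h2 x.
have ch1 : continuous h1 by rewrite /h1; prove_cont.
have cP2 : continuous (fun x => - (a / 2) * P.[x] ^+ 2) by prove_cont.
have i2 : mu.-integrable `]-1, 1[ (EFin \o h2) by exact: arcsine_weight_integrable.
have i1 : mu.-integrable `]-1, 1[ (EFin \o h1).
  apply: integrableS (continuous_integrable (-1) 1 ch1) => //; exact: subset_itv_oo_cc.
have cf : {in `]-1, 1[, continuous f}.
  move=> x xI; apply: (@continuousD _ _ _ h1 h2); first exact: ch1.
  exact: continuous_arcsine_density.
have bE (x : R) : -1 <= x <= 1 -> B x = b x by move=> xI; rewrite /= clamp_id.
pose D x := (1 - x ^+ 2) * derive1 B x.
pose q x := (1 - x ^+ 2) * (P.[x] * P^`().[x]).
(* The boundary form of Green's identity: half of (1-x^2)(B' P^2 - B (P^2)'). *)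
pose F x := - (q x * B x) + 2^-1 * (D x * P.[x] ^+ 2).
have omE (y : R) : ((1 - 'X ^+ 2) * P^`()).[y] = (1 - y ^+ 2) * P^`().[y].
  by rewrite hornerM; congr (_ * _); rewrite !hornerE.
have dF (x : R) : -1 < x < 1 -> is_derive x 1 F (f x).
  move=> xI; have xI' : x \in `]-1, 1[ by rewrite in_itv.
  have [dB dB' _] := BC2 xI'.
  have isB : is_derive x 1 B (derive1 B x) := DeriveDef dB (esym (derive1E B x)).
  have dp : is_derive x 1 (fun y : R => 1 - y ^+ 2) (- (2 * x)).
    apply: is_derive_eq (D_add (D_cst 1 x) (D_opp (D_exp 2 (D_id x)))) _.
    by rewrite /= expr1; ring.
  have isD : is_derive x 1 D (- (a / Num.sqrt (1 - x ^+ 2) + J x)).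
    have LBx := LB xI'; rewrite -LBx /legendre_op opprK.
    have [dD _] := D_mul dp (derivableP dB').
    exact: DeriveDef dD (esym (derive1E D x)).
  have ode : ((1 - 'X ^+ 2) * P^`())^`().[x] = - (n%:R * n.+1%:R) * P.[x].
    by rewrite legendre_ODE natrM mulNr hornerN !hornerM !horner_natr mulNr.
  have dPP : is_derive x 1 (fun y => ((1 - 'X ^+ 2) * P^`()).[y]) (((1 - 'X ^+ 2) * P^`())^`().[x] * 1).
    exact: D_poly (D_id x).
  rewrite (_ : F = fun x => - (((1 - 'X ^+ 2) * P^`()).[x] * P.[x] * B x) + 2^-1 * (D x * P.[x] ^+ 2)); last first.
    by apply/funext => y; rewrite /F /q omE; ring.
  apply: is_derive_eq (D_add (D_opp (D_mul (D_mul dPP (D_poly P (D_id x))) isB))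
    (D_mul (D_cst 2^-1 x) (D_mul isD (D_exp 2 (D_poly P (D_id x)))))) _.
  have xx : -1 <= x <= 1 by case/andP: xI => *; apply/andP; split; lra.
  rewrite ode omE /f /h1 /h2 -!bE// [(J \o clamp) x]/= clamp_id//.
  have s0 : Num.sqrt (1 - x ^+ 2) != 0 by rewrite gt_eqF// sqrt_1mx2_gt0.
  move: s0; rewrite /D; move: (Num.sqrt _) => s s0 /=.
  by field.
(* One argument for both endpoints: [q] vanishes there through 1 - x^2, and [D] tends to 0 by
   hypothesis. *)
have lim0 (c : R) (G : set_system R) (FG : ProperFilter G) : c ^+ 2 = 1 -> G --> c ->
    (\forall x \near G, -1 <= x <= 1) -> D x @[x --> G] --> (0 : R) ->
    F x @[x --> G] --> (0 : R).
  move=> c1 Gc GI GD.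
  have cq : continuous (fun x => - (q x * b x)) by rewrite /q; prove_cont.
  have cP : continuous (fun x => P.[x] ^+ 2) by prove_cont.
  have L : - (q x * b x) + 2^-1 * (D x * P.[x] ^+ 2) @[x --> G] -->
      - (q c * b c) + 2^-1 * (0 * P.[c] ^+ 2).
    apply: cvgD; first exact: cvg_trans (cvg_app _ Gc) (cq c).
    apply: cvgM; first exact: cvg_cst.
    apply: cvgM => //; exact: cvg_trans (cvg_app _ Gc) (cP c).
  have z : - (q c * b c) + 2^-1 * (0 * P.[c] ^+ 2) = 0.
    by rewrite /q c1 subrr !mul0r mulr0 oppr0 addr0.
  rewrite z in L; apply: cvg_trans L; apply: near_eq_cvg.
  by apply: filterS GI => x xI; rewrite /F bE.
have Fr : F x @[x --> 1^'-] --> (0 : R).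
  apply: (@lim0 1) => //; first by rewrite expr1n.
    exact: cvg_at_left_filter cvg_id.
  near=> x; apply/andP; split; last by near: x; exact: nbhs_left_le.
  by near: x; apply: nbhs_left_ge; lra.
have Fl : F x @[x --> (-1)^'+] --> (0 : R).
  apply: (@lim0 (-1)) => //; first by rewrite sqrrN expr1n.
    exact: cvg_at_right_filter cvg_id.
  near=> x; apply/andP; split; first by near: x; exact: nbhs_right_ge.
  by near: x; apply: nbhs_right_le; lra.
have fi : mu.-integrable `]-1, 1[ (EFin \o f).
  by apply: eq_integrable (integrableD _ i1 i2) => // x _; rewrite /f /= EFinD.
have := FTC_oo cf dF Fr Fl fi.
rewrite subrr /f RintegralD// integral_oo_cc//.
rewrite /h1 integral_sub; [|prove_cont..].
have -> : \int[mu]_(x in `]-1, 1[) h2 x =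
    - (a / 2) * (pi * \sum_(k < n.+1) cbin2 k * cbin2 (n - k)).
  have p0 : (pi : R) != 0 by rewrite gt_eqF// pi_gt0.
  have := arcsine_meanE cP2; rewrite /arcsine_mean /arcsine => /(mulfI (invr_neq0 p0)) ->.
  by rewrite integral_scale ?legendre_sqr_cos_integral//; prove_cont.
rewrite integral_scale; last by prove_cont.
set I := Rintegral _ _ _; set K := Rintegral _ _ _; set T := _ * \sum_(_ < _) _.
by move=> h; lra.
Unshelve. all: by end_near. Qed.

End ByParts.

Theorem theorem4p4 (R : realType) (B J : R -> R) (a : R)
  (Bcont : {within `[-1, 1], continuous B})
  (BC2 : C2_oo B (-1) 1)
  (Beven : forall x : R, x \in `[-1, 1] -> B (- x) = B x)
  (Bright : (1 - x ^+ 2) * derive1 B x @[x --> 1^'-] --> (0 : R))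
  (Bleft : (1 - x ^+ 2) * derive1 B x @[x --> (-1)^'+] --> (0 : R))
  (Jcont : {within `[-1, 1], continuous J})
  (LB : forall x : R, x \in `]-1, 1[ ->
    legendre_op B x = a / Num.sqrt (1 - x ^+ 2) + J x) :
  (forall n : nat, (1 <= n)%N -> derivable (alphaB B n.-1) 0 1) /\
  (fun n : nat => response B n -
     (a / (2 * pi) * (ln n%:R / n%:R ^+ 2) +
      (n%:R ^+ 2)^-1 * (a * (euler_gamma R + ln 16) / (2 * pi) +
                        4^-1 * arcsine_mean J)) : R^o)
  =o_\oo (fun n : nat => (n%:R ^+ 2)^-1 : R^o).
Proof.
have cb := continuous_clamp Bcont; have cj := continuous_clamp Jcont.
have bN (x : R) : (B \o clamp) (- x) = (B \o clamp) x.
  by rewrite /= clampN Beven// in_itv/= clamp_itv.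
have Bb (x : R) : -1 <= x <= 1 -> B x = (B \o clamp) x by move=> xI; rewrite /= clamp_id.
have dA n := alphaB_uniform_derive n cb bN Bb.
split=> [n _|]; first by have [] := dA n.-1.
(* The arcsine mean integrates over the open interval, where J and its clamped extension agree. *)
have AJ : arcsine_mean J = arcsine (J \o clamp).
  rewrite -arcsine_meanE//; congr (_ * _); apply: eq_Rintegral => x.
  by rewrite inE/= in_itv/= => /andP[x1 x2]; rewrite clamp_id//; apply/andP; split; lra.
have RE n : (0 < n)%N -> response B n = n.*2.+1%:R^-1 * (2^-1 *
    (a * (pi * \sum_(k < n.+1) cbin2 k * cbin2 (n - k)) +
     2 / n.*2.+1%:R * legendre_mean n (J \o clamp))).
  case: n => // n _; rewrite /response /= derive1E (derive_val (f := alphaB B n)).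
  rewrite (legendre_by_parts Bcont BC2 Bright Bleft Jcont LB); congr (_ * (_ * (_ + _))).
  have K0 : n.+1.*2.+1%:R != 0 :> R by rewrite natS_neq0.
  rewrite /legendre_mean; move: (Rintegral _ _ _) => I; move: K0.
  by move: (_%:R : R) => K K0; field.
have := response_asymptotics a (@cbin2_conv_cvg R) (legendre_mean_cvg cj).
rewrite -AJ => lim0.
(* Multiplied by n^2, the little-o claim becomes the limit 0 just obtained. *)
apply/eqoP => e e0; near=> n.
have n0 : (0 < n)%N by near: n; exact: nbhs_infty_gt.
have k0 : (0 : R) < n%:R ^+ 2 by rewrite exprn_gt0// ltr0n.
rewrite [`|(_^-1 : R^o)|]ger0_norm ?invr_ge0 ?(ltW k0)// ler_pdivlMr//.
rewrite -[X in _ * X]ger0_norm ?(ltW k0)// -normrM RE//.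
have : `|0 - (n%:R ^+ 2 * (n.*2.+1%:R^-1 * (2^-1 * (a * (pi * \sum_(k < n.+1) cbin2 k * cbin2 (n - k)) + 2 / n.*2.+1%:R * legendre_mean n (J \o clamp)))) -
    (a / (2 * pi) * ln n%:R + (a * (euler_gamma R + ln 16) / (2 * pi) + 4^-1 * arcsine_mean J)))| <= e.
  by near: n; move/cvgrPdist_le : lim0; apply.
rewrite sub0r normrN; apply: le_trans; rewrite le_eqVlt; apply/orP; left; apply/eqP; congr (`|_|).
rewrite mulrBl; congr (_ - _); first by rewrite mulrC.
have p0 := @pi_gt0 R; move: p0 k0; move: (pi : R) (n%:R ^+ 2 : R) => p k p0 k0.
by field; rewrite !gt_eqF.
Unshelve. all: by end_near. Qed.
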